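(* Let $\varepsilon>0$, $M>0$ and $\phi_0,\phi_T\in (L^2(\mathbb R))^4$ with $\|\phi_0\|=\|\phi_T\|$. Then there exists $T_0>0$ such that for all $T>T_0$ there exist controls $u_1,u_{1r},u_{1b},u_2,u_{2r},u_{2b}\in L^\infty((0,T),\mathbb C)$, each with $L^\infty$-norm smaller than $M$, such that the solution $\phi(t)$ of the two trapped ions system with initial datum $\phi(0)=\phi_0$ satisfies $$\|\phi(T)-\phi_T\|_{(L^2(\mathbb R))^4}<\varepsilon.$$
   Context: The state is $\phi=(\phi_{gg},\phi_{eg},\phi_{ge},\phi_{ee})\in (L^2(\mathbb R))^4$. Let $a=\frac{1}{\sqrt2}(x+\partial_x)$ and $a^\dagger=\frac{1}{\sqrt2}(x-\partial_x)$ be the annihilation and creation operators on $L^2(\mathbb R)$, and let $u^*$ denote the complex conjugate of $u\in\mathbb C$. The two trapped ions system, with complex-valued controls $u_1,u_{1r},u_{1b},u_2,u_{2r},u_{2b}$, is $$\begin{aligned} i\tfrac{d}{dt}\phi_{gg} &= (u_1+u_{1r}a^\dagger+u_{1b}a)\phi_{eg}+(u_2+u_{2r}a^\dagger+u_{2b}a)\phi_{ge},\\ i\tfrac{d}{dt}\phi_{eg} &= (u_1^*+u_{1r}^*a+u_{1b}^*a^\dagger)\phi_{gg}+(u_2+u_{2r}a^\dagger+u_{2b}a)\phi_{ee},\\ i\tfrac{d}{dt}\phi_{ge} &= (u_1+u_{1r}a^\dagger+u_{1b}a)\phi_{ee}+(u_2^*+u_{2r}^*a+u_{2b}^*a^\dagger)\phi_{gg},\\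 i\tfrac{d}{dt}\phi_{ee} &= (u_1^*+u_{1r}^*a+u_{1b}^*a^\dagger)\phi_{ge}+(u_2^*+u_{2r}^*a+u_{2b}^*a^\dagger)\phi_{eg}. \end{aligned}$$ The norm on $(L^2(\mathbb R))^4$ is the standard Hilbert norm. *)

(* Defs.v *)
From mathcomp Require Import all_boot all_order all_algebra.
From mathcomp Require Import all_classical all_reals all_analysis.
From mathcomp Require Import complex.

Set Implicit Arguments.
Unset Strict Implicit.
Unset Printing Implicit Defensive.

Import Order.TTheory GRing.Theory Num.Theory.
Local Open Scope ring_scope.
Local Open Scope classical_set_scope.

Section TrappedIons.
Variable R : realType.

Local Notation mu := (@lebesgue_measure R).

Definition cabs (z : R[i]) : R := Num.sqrt (complex.Re z ^+ 2 + complex.Im z ^+ 2).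

Definition rC (r : R) : R[i] := Complex r 0.

Definition iC : R[i] := Complex 0 1.

Definition cmeasurable (D : set R) (f : R -> R[i]) : Prop :=
  measurable_fun D (fun x => complex.Re (f x)) /\
  measurable_fun D (fun x => complex.Im (f x)).

Definition cintegrable (D : set R) (f : R -> R[i]) : Prop :=
  mu.-integrable D (fun x => (complex.Re (f x))%:E) /\
  mu.-integrable D (fun x => (complex.Im (f x))%:E).

Definition cintegral (D : set R) (f : R -> R[i]) : R[i] :=
  Complex (Rintegral mu D (fun x => complex.Re (f x)))
          (Rintegral mu D (fun x => complex.Im (f x))).

Definition L2fun (f : R -> R[i]) : Prop :=
  cmeasurable setT f /\ mu.-integrable setT (fun x => ((cabs (f x)) ^+ 2)%:E).

Definition L2norm2 (f : R -> R[i]) : R :=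
  Rintegral mu setT (fun x => (cabs (f x)) ^+ 2).

Definition L2inner (f g : R -> R[i]) : R[i] :=
  cintegral setT (fun x => conjc (f x) * g x).

(* a state phi = (phi_gg, phi_eg, phi_ge, phi_ee), indexed by 'I_4 in this order *)
Definition state := 'I_4 -> R -> R[i].

Definition L2state (phi : state) : Prop := forall k : 'I_4, L2fun (phi k).

Definition norm4 (phi : state) : R := Num.sqrt (\sum_(k < 4) L2norm2 (phi k)).

Definition sub_state (phi psi : state) : state := fun k x => phi k x - psi k x.

Definition inner4 (psi phi : state) : R[i] := \sum_(k < 4) L2inner (psi k) (phi k).

Definition smooth_real (f : R -> R) : Prop := forall (n : nat) (x : R), derivable (f^`(n)) x 1.

Definition test_fun (f : R -> R[i]) : Prop :=
  smooth_real (fun x => complex.Re (f x)) /\ smooth_real (fun x => complex.Im (f x)) /\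
  exists K : R, forall x, K < `|x| -> f x = 0.

Definition test_state (psi : state) : Prop := forall k : 'I_4, test_fun (psi k).

Definition cderiv (f : R -> R[i]) : R -> R[i] :=
  fun x => Complex ((fun y => complex.Re (f y))^`() x) ((fun y => complex.Im (f y))^`() x).

Definition ann (f : R -> R[i]) : R -> R[i] :=
  fun x => rC (Num.sqrt 2)^-1 * (rC x * f x + cderiv f x).
Definition cre (f : R -> R[i]) : R -> R[i] :=
  fun x => rC (Num.sqrt 2)^-1 * (rC x * f x - cderiv f x).

(* controls: u 0 = u_1, u 1 = u_1r, u 2 = u_1b, u 3 = u_2, u 4 = u_2r, u 5 = u_2b *)
Definition controls := 'I_6 -> R -> R[i].

(* (c + cr a^dagger + cb a) f  and its formal adjoint (c^* + cr^* a + cb^* a^dagger) f *)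
Definition opA (c cr cb : R[i]) (f : R -> R[i]) : R -> R[i] :=
  fun x => c * f x + cr * cre f x + cb * ann f x.
Definition opAd (c cr cb : R[i]) (f : R -> R[i]) : R -> R[i] :=
  fun x => conjc c * f x + conjc cr * ann f x + conjc cb * cre f x.

(* the Hamiltonian H(t) of the two trapped ions system (right-hand side of
   i d/dt phi = H(t) phi), applied to a (smooth) state *)
Definition hamiltonian (u : controls) (t : R) (psi : state) : state :=
  fun k =>
  let A1 := opA (u 0%R t) (u 1%R t) (u 2%R t) in
  let A1d := opAd (u 0%R t) (u 1%R t) (u 2%R t) in
  let A2 := opA (u 3%R t) (u 4%R t) (u 5%R t) in
  let A2d := opAd (u 3%R t) (u 4%R t) (u 5%R t) in
  let gg := psi 0%R in let eg := psi 1%R in let ge := psi 2%R in let ee := psi 3%R in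
  match val k with
  | 0%N => fun x => A1 eg x + A2 ge x
  | 1%N => fun x => A1d gg x + A2 ee x
  | 2%N => fun x => A1 ee x + A2d gg x
  | _ => fun x => A1d ge x + A2d eg x
  end.

Definition admissible_controls (M T : R) (u : controls) : Prop :=
  (forall k : 'I_6, cmeasurable `]0, T[ (u k)) /\
  exists M', M' < M /\ forall (k : 'I_6) (t : R), 0 < t < T -> cabs (u k t) <= M'.

(* (weak) solution on [0,T] of  i d/dt phi = H(t) phi  in C([0,T]; (L^2)^4):
   for every test state psi, t |-> <psi, phi(t)> satisfies
   <psi,phi(t)> - <psi,phi(0)> = int_0^t -i <H(s) psi, phi(s)> ds
   (H(s) is formally self-adjoint). *)
Definition solution (u : controls) (T : R) (phi : R -> state) : Prop :=
  (forall t, 0 <= t <= T -> L2state (phi t)) /\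
  (forall t, 0 <= t <= T -> forall e : R, 0 < e -> exists2 d : R, 0 < d &
     forall s, 0 <= s <= T -> `|s - t| < d -> norm4 (sub_state (phi s) (phi t)) < e) /\
  (forall psi : state, test_state psi -> forall t, 0 <= t <= T ->
     cintegrable `[0, t] (fun s => inner4 (hamiltonian u s psi) (phi s)) /\
     inner4 psi (phi t) - inner4 psi (phi 0)
       = cintegral `[0, t] (fun s => - iC * inner4 (hamiltonian u s psi) (phi s))).

End TrappedIons.

(* Main.v *)
(** All controls used are piecewise constant, of two kinds: pulses whose
    Hamiltonian is [(al x + be) S], with [S] a flip of one ion, which rotate the
    two levels of that ion pointwise by the angle [t (al x + be)], and pulses whose
    Hamiltonian is [- i ga d/dx S], which translate the two eigenspaces of [S]
    in opposite directions.  Products of these flows are isometries, and their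
    strong closure contains the rotations by [f x] for many angle functions [f]:
    these are stable under sums, pointwise limits and, by a Trotter argument,
    under [(f, g) |-> g cos f], hence under products and exponentials, so that
    indicators of intervals can be reached as limits of [exp (- exp (n (n (x - a) + 1)))].
    Conjugating a translation pulse by a constant rotation moves the ground and
    the excited parts apart.  A truncated state is thus steered to a scalar
    function on the level [gg]: separate the levels of an ion, and flip the
    excited part.  That function is approximated by a step function on a dyadic
    grid, whose cells are merged two at a time until a single cell [0, s) with a
    nonnegative height remains; the height is determined by the norm.  Running
    the inverse program of the target, of the same norm, concludes. *)

Require Import Defs.
From mathcomp Require Import all_boot all_order all_algebra.
From mathcomp Require Import all_classical all_reals all_analysis.
From mathcomp Require Import complex measurable_realfun.
From mathcomp Require Import zify ring lra.

Set Implicit Arguments.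
Unset Strict Implicit.
Unset Printing Implicit Defensive.
Import Order.TTheory GRing.Theory Num.Theory.
Import numFieldNormedType.Exports.
Local Open Scope ring_scope.
Local Open Scope classical_set_scope.

(** * Square-integrable states *)

Section L2.
Variable R : realType.
Local Notation mu := (@lebesgue_measure R).
Local Notation C := R[i].
Local Notation Re := complex.Re.
Local Notation Im := complex.Im.
Implicit Types (f g : R -> C) (phi psi chi : state R).

(** The Hamiltonian is unbounded, and no existence theory for its evolution is invoked: only pulses
    whose flow has a closed formula are used, and the formula is checked against the weak
    formulation by moving the generator onto the test state. These pulses come from [u_r = u_b],
    since [a + a^dagger] is a multiple of [x], and from [u_r = - u_b], since [a^dagger - a] is a
    multiple of [d/dx]. A flow depends only on the product of its coefficients with its duration.
    The bound [M] therefore costs nothing but time, and the time left after a program is spent with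
    zero controls, which gives every [T > T0]. Multiplication pulses alone yield affine angles,
    which cannot address a single cell. Nonlinear angles come from the noncommutation of rotations
    about two orthogonal axes of the same ion. Isometry keeps errors from growing and makes steering
    symmetric, so it suffices to steer both data to a common one-parameter family. For the norm to
    fix the parameter, both data must end on cells of the same width; hence step approximations are
    provided on every sufficiently fine dyadic grid. *)

Definition sqnormc (z : C) : R := Re z ^+ 2 + Im z ^+ 2.
Definition sqnormv (v : 'I_4 -> C) : R := \sum_k sqnormc (v k).

Lemma ReD (z w : C) : Re (z + w) = Re z + Re w. Proof. by case: z; case: w. Qed.
Lemma ImD (z w : C) : Im (z + w) = Im z + Im w. Proof. by case: z; case: w. Qed.
Lemma ReN (z : C) : Re (- z) = - Re z. Proof. by case: z. Qed.
Lemma ImN (z : C) : Im (- z) = - Im z. Proof. by case: z. Qed.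
Lemma ReM (z w : C) : Re (z * w) = Re z * Re w - Im z * Im w.
Proof. by case: z; case: w. Qed.
Lemma ImM (z w : C) : Im (z * w) = Re z * Im w + Im z * Re w.
Proof. by case: z; case: w. Qed.
Lemma ReJ (z : C) : Re (conjc z) = Re z. Proof. by case: z. Qed.
Lemma ImJ (z : C) : Im (conjc z) = - Im z. Proof. by case: z. Qed.
Lemma RerC (r : R) : Re (rC r) = r. Proof. by []. Qed.
Lemma ImrC (r : R) : Im (rC r) = 0. Proof. by []. Qed.
Lemma ReiC : Re (iC R) = 0. Proof. by []. Qed.
Lemma ImiC : Im (iC R) = 1. Proof. by []. Qed.
Lemma Re0 : Re (0 : C) = 0. Proof. by []. Qed.
Lemma Im0 : Im (0 : C) = 0. Proof. by []. Qed.
Lemma Re1 : Re (1 : C) = 1. Proof. by []. Qed.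
Lemma Im1 : Im (1 : C) = 0. Proof. by []. Qed.
Definition reimE := (ReD, ImD, ReN, ImN, ReM, ImM, ReJ, ImJ, RerC, ImrC, ReiC,
  ImiC, Re0, Im0, Re1, Im1).

Lemma eqcP (z w : C) : Re z = Re w -> Im z = Im w -> z = w.
Proof. by case: z; case: w => a b c d /= -> ->. Qed.

Lemma cabs_sq (z : C) : cabs z ^+ 2 = sqnormc z.
Proof. by rewrite /cabs sqr_sqrtr// addr_ge0 ?sqr_ge0. Qed.

Lemma sqnormc_ge0 z : 0 <= sqnormc z.
Proof. by rewrite addr_ge0 ?sqr_ge0. Qed.
Lemma sqnormv_ge0 v : 0 <= sqnormv v.
Proof. by apply: sumr_ge0 => i _; exact: sqnormc_ge0. Qed.

Lemma sqnormcM z w : sqnormc (z * w) = sqnormc z * sqnormc w.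
Proof. rewrite /sqnormc !reimE; ring. Qed.
Lemma sqnormcJ z : sqnormc (conjc z) = sqnormc z.
Proof. rewrite /sqnormc !reimE; ring. Qed.
Lemma sqnormcN z : sqnormc (- z) = sqnormc z.
Proof. rewrite /sqnormc !reimE; ring. Qed.
Lemma sqnormc_eq0 z : sqnormc z = 0 -> z = 0.
Proof.
move=> /eqP; rewrite paddr_eq0 ?sqr_ge0// !sqrf_eq0 => /andP[/eqP a /eqP b].
exact: eqcP.
Qed.
Lemma sqnormc0 : sqnormc 0 = 0. Proof. by rewrite /sqnormc !reimE expr0n addr0. Qed.
Lemma sqnormcrC (r : R) : sqnormc (rC r) = r ^+ 2.
Proof. by rewrite /sqnormc !reimE expr0n addr0. Qed.

(** Young's inequality with a free weight. It involves squares only, so it passes through sums and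
    integrals; optimising over [d] afterwards restores the triangle inequality. *)
Lemma sqnormcD_le (d : R) z w : 0 < d ->
  sqnormc (z + w) <= (1 + d) * sqnormc z + (1 + d^-1) * sqnormc w.
Proof.
move=> d0; rewrite /sqnormc !reimE.
have aux (a b : R) : (a + b) ^+ 2 <= (1 + d) * a ^+ 2 + (1 + d^-1) * b ^+ 2.
  rewrite -subr_ge0.
  have -> : (1 + d) * a ^+ 2 + (1 + d^-1) * b ^+ 2 - (a + b) ^+ 2 =
     d^-1 * (d * a - b) ^+ 2 by field; rewrite gt_eqF.
  by rewrite mulr_ge0 ?sqr_ge0// invr_ge0 ltW.
by have := aux (Re z) (Re w); have := aux (Im z) (Im w); lra.
Qed.

Lemma sqnormvD_le (d : R) u v : 0 < d ->
  sqnormv (fun k => u k + v k) <= (1 + d) * sqnormv u + (1 + d^-1) * sqnormv v.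
Proof.
move=> d0; rewrite /sqnormv !mulr_sumr -big_split/=.
by apply: ler_sum => k _; exact: sqnormcD_le.
Qed.

Lemma sqnormc_le_v (v : 'I_4 -> C) k : sqnormc (v k) <= sqnormv v.
Proof.
rewrite /sqnormv (bigD1 k)//= lerDl; apply: sumr_ge0 => i _; exact: sqnormc_ge0.
Qed.

Local Notation meas f := (measurable_fun [set: R] (f : R -> R)).

Lemma cmeasD f g : cmeasurable setT f -> cmeasurable setT g ->
  cmeasurable setT (fun x => f x + g x).
Proof.
move=> [? ?] [? ?]; split; under eq_fun do rewrite !reimE; exact: measurable_funD.
Qed.
Lemma cmeasN f : cmeasurable setT f -> cmeasurable setT (fun x => - f x).
Proof.
by move=> [? ?]; split; under eq_fun do rewrite !reimE; exact: measurableT_comp.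
Qed.
Lemma cmeasB f g : cmeasurable setT f -> cmeasurable setT g ->
  cmeasurable setT (fun x => f x - g x).
Proof. by move=> mf mg; apply: cmeasD => //; exact: cmeasN. Qed.
Lemma cmeasM f g : cmeasurable setT f -> cmeasurable setT g ->
  cmeasurable setT (fun x => f x * g x).
Proof.
move=> [? ?] [? ?]; split; under eq_fun do rewrite !reimE.
  by apply: measurable_funB; exact: measurable_funM.
by apply: measurable_funD; exact: measurable_funM.
Qed.
Lemma cmeasJ f : cmeasurable setT f -> cmeasurable setT (fun x => conjc (f x)).
Proof.
by move=> [? ?]; split; under eq_fun do rewrite !reimE; [|exact: measurable_funN].
Qed.
Lemma cmeas_cst (c : C) : cmeasurable setT (fun=> c).
Proof. by split; exact: measurable_cst. Qed.
Lemma cmeasrC (h : R -> R) : meas h -> cmeasurable setT (fun x => rC (h x)).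
Proof. by move=> mh; split => //=; exact: measurable_cst. Qed.
Lemma cmeas_comp f (h : R -> R) : meas h -> cmeasurable setT f ->
  cmeasurable setT (fun x => f (h x)).
Proof.
by move=> mh [? ?]; split; [apply: (@measurableT_comp _ _ _ _ _ _ (fun x => Re (f x)))|
  apply: (@measurableT_comp _ _ _ _ _ _ (fun x => Im (f x)))].
Qed.
Lemma cmeas_if (h : R -> bool) f g : measurable_fun [set: R] h ->
  cmeasurable setT f -> cmeasurable setT g ->
  cmeasurable setT (fun x => if h x then f x else g x).
Proof.
move=> mh [? ?] [? ?]; split.
  rewrite (_ : (fun x => _) = (fun x => if h x then Re (f x) else Re (g x))).
    exact: measurable_fun_ifT.
  by apply/funext => x; case: (h x).
rewrite (_ : (fun x => _) = (fun x => if h x then Im (f x) else Im (g x))).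
  exact: measurable_fun_ifT.
by apply/funext => x; case: (h x).
Qed.

Lemma meas_sqnormc f : cmeasurable setT f -> meas (fun x => sqnormc (f x)).
Proof. by move=> [? ?]; apply: measurable_funD; exact: measurable_funX. Qed.

Definition mstate phi := forall k, cmeasurable setT (phi k).

Lemma meas_sqnormv phi : mstate phi -> meas (fun x => sqnormv (phi ^~ x)).
Proof.
move=> mp; rewrite /sqnormv; apply: measurable_sum => k.
exact: meas_sqnormc.
Qed.

Local Notation integ f := (mu.-integrable [set: R] (EFin \o (f : R -> R))).

Lemma integ_le (f g : R -> R) : meas f -> integ g ->
  (forall x, `|f x| <= g x) -> integ f.
Proof.
move=> mf ig fg; apply: (le_integrable _ _ _ ig) => //.
  exact/measurable_EFinP.
by move=> x _ /=; rewrite lee_fin (le_trans (fg x))// ler_norm.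
Qed.

Lemma integD (f g : R -> R) : integ f -> integ g -> integ (fun x => f x + g x).
Proof. by move=> i j; have := integrableD measurableT i j. Qed.
Lemma integB (f g : R -> R) : integ f -> integ g -> integ (fun x => f x - g x).
Proof. by move=> i j; have := integrableB measurableT i j. Qed.
Lemma integZ (c : R) (f : R -> R) : integ f -> integ (fun x => c * f x).
Proof. by move=> i; have := integrableZl measurableT c i. Qed.
Lemma integ_sum I (s : seq I) (F : I -> R -> R) : (forall i, integ (F i)) ->
  integ (fun x => \sum_(i <- s) F i x).
Proof.
move=> iF; elim: s => [|i s IH].
  rewrite (_ : (fun x => _) = cst 0); last by apply/funext => x; rewrite big_nil.
  exact: integrable0.
under eq_fun do rewrite big_cons.
exact: integD.
Qed.

Lemma L2funP f : L2fun f <-> cmeasurable setT f /\ integ (fun x => sqnormc (f x)).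
Proof.
rewrite /L2fun; under [X in mu.-integrable setT X]eq_fun do rewrite cabs_sq.
by [].
Qed.

Lemma L2stateP phi :
  L2state phi <-> mstate phi /\ integ (fun x => sqnormv (phi ^~ x)).
Proof.
split.
  move=> h; split; first by move=> k; have [] := h k.
  by apply: integ_sum => k; have /L2funP[] := h k.
move=> [m i] k; apply/L2funP; split => //.
apply: (integ_le (meas_sqnormc (m k)) i) => x.
by rewrite ger0_norm ?sqnormc_ge0//; exact: (sqnormc_le_v (phi ^~ x)).
Qed.

(** The sum over the levels sits inside the integral, so that estimates can be made pointwise on
    vectors of [C^4]; [norm4E] compares it with [norm4]. *)
Definition sqnorm phi : R := (\int[mu]_x (sqnormv (phi ^~ x)))%R.

Lemma sqnorm_ge0 phi : 0 <= sqnorm phi.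
Proof. by apply: Rintegral_ge0 => x _; exact: sqnormv_ge0. Qed.

Lemma Rint_sum I (s : seq I) (F : I -> R -> R) : (forall i, integ (F i)) ->
  (\int[mu]_x (\sum_(i <- s) F i x) = \sum_(i <- s) \int[mu]_x F i x)%R.
Proof.
move=> iF; elim: s => [|i s IH].
  rewrite big_nil; under eq_Rintegral do rewrite big_nil.
  by rewrite Rintegral_cst//= mul0r.
rewrite big_cons -IH -RintegralD//; last exact: integ_sum.
by apply: eq_Rintegral => x _; rewrite big_cons.
Qed.

Lemma norm4E phi : L2state phi -> norm4 phi = Num.sqrt (sqnorm phi).
Proof.
move=> h; rewrite /norm4 /sqnorm /sqnormv Rint_sum; last first.
  by move=> k; have /L2funP[] := h k.
congr Num.sqrt; apply: eq_bigr => k _; rewrite /L2norm2.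
by apply: eq_Rintegral => x _; rewrite cabs_sq.
Qed.

Lemma L2state_dom (c : R) phi psi : mstate phi -> L2state psi ->
  (forall x, sqnormv (phi ^~ x) <= c * sqnormv (psi ^~ x)) -> L2state phi.
Proof.
move=> mp /L2stateP[mq iq] h; apply/L2stateP; split => //.
apply: (integ_le (meas_sqnormv mp) (integZ c iq)) => x.
by rewrite ger0_norm ?sqnormv_ge0.
Qed.

Definition add_state phi psi : state R := fun k x => phi k x + psi k x.

Lemma L2stateD phi psi : L2state phi -> L2state psi -> L2state (add_state phi psi).
Proof.
move=> /L2stateP[mp ip] /L2stateP[mq iq].
have m : mstate (add_state phi psi) by move=> k; exact: cmeasD.
apply/L2stateP; split => //.
apply: (integ_le (meas_sqnormv m) (integD (integZ 2 ip) (integZ 2 iq))) => x.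
rewrite ger0_norm ?sqnormv_ge0//.
by have := @sqnormvD_le 1 (phi ^~ x) (psi ^~ x) ltr01; rewrite invr1.
Qed.

Lemma sqnormvN v : sqnormv (fun k => - v k) = sqnormv v.
Proof. by apply: eq_bigr => k _; rewrite sqnormcN. Qed.

Lemma L2stateN phi : L2state phi -> L2state (fun k x => - phi k x).
Proof.
move=> h; apply: (@L2state_dom 1 _ phi) => //.
  by move=> k; apply: cmeasN; have [] := h k.
by move=> x; rewrite mul1r sqnormvN.
Qed.

Lemma L2stateB phi psi : L2state phi -> L2state psi -> L2state (sub_state phi psi).
Proof. by move=> h1 h2; exact: (L2stateD h1 (L2stateN h2)). Qed.

Lemma sqnormD_le (d : R) phi psi : 0 < d -> L2state phi -> L2state psi ->
  sqnorm (add_state phi psi) <= (1 + d) * sqnorm phi + (1 + d^-1) * sqnorm psi.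
Proof.
move=> d0 lp lq; have /L2stateP[_ iS] := L2stateD lp lq.
move: lp lq => /L2stateP[mp ip] /L2stateP[mq iq].
rewrite /sqnorm -!RintegralZl// -RintegralD//; [|exact: integZ|exact: integZ].
apply: le_Rintegral => //; first by apply: integD; exact: integZ.
by move=> x _; exact: sqnormvD_le.
Qed.

Lemma norm4_ge0 phi : 0 <= norm4 phi. Proof. exact: sqrtr_ge0. Qed.

(** The optimal weight is the ratio of the square roots of [b] and [a]. It serves both states and
    vectors of [C^4]. *)
Lemma sqrt_minkowski (a b c : R) : 0 <= a -> 0 <= b -> 0 <= c ->
  (forall d, 0 < d -> c <= (1 + d) * a + (1 + d^-1) * b) ->
  Num.sqrt c <= Num.sqrt a + Num.sqrt b.
Proof.
move=> a0 b0 c0 h; apply/ler_addgt0Pr => e e0.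
(* Adding [e / 2] to each root makes both positive, so that the weight [B / A] is defined even when
   [a] or [b] vanishes. *)
have [A A0 [hA hA']] : exists2 A, 0 < A & a <= A ^+ 2 /\ A = Num.sqrt a + e / 2.
  have s0 := sqrtr_ge0 a.
  exists (Num.sqrt a + e / 2); first by lra.
  by split => //; rewrite -[leLHS]sqr_sqrtr//; nra.
have [B B0 [hB hB']] : exists2 B, 0 < B & b <= B ^+ 2 /\ B = Num.sqrt b + e / 2.
  have s0 := sqrtr_ge0 b.
  exists (Num.sqrt b + e / 2); first by lra.
  by split => //; rewrite -[leLHS]sqr_sqrtr//; nra.
have -> : Num.sqrt a + Num.sqrt b + e = A + B by rewrite hA' hB'; field.
clear hA' hB'; have AB : 0 < A + B by exact: addr_gt0.
have BA : 0 < B / A by exact: divr_gt0.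
rewrite -(ger0_norm (ltW AB)) -sqrtr_sqr; apply: ler_wsqrtr.
apply: (le_trans (h _ BA)).
have -> : (A + B) ^+ 2 = (1 + B / A) * A ^+ 2 + (1 + (B / A)^-1) * B ^+ 2.
  by field; rewrite (gt_eqF A0) (gt_eqF B0).
have BA' : 0 < (B / A)^-1 by rewrite invr_gt0.
by apply: lerD; apply: ler_wpM2l => //; apply: addr_ge0 => //; exact: ltW.
Qed.

Lemma norm4D phi psi : L2state phi -> L2state psi ->
  norm4 (add_state phi psi) <= norm4 phi + norm4 psi.
Proof.
move=> lp lq; have ls := L2stateD lp lq.
rewrite (norm4E lp) (norm4E lq) (norm4E ls).
apply: sqrt_minkowski; [exact: sqnorm_ge0..|].
by move=> d d0; exact: sqnormD_le.
Qed.

Lemma sub_stateE phi psi chi :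
  sub_state phi chi = add_state (sub_state phi psi) (sub_state psi chi).
Proof. by apply/funext => k; apply/funext => x; rewrite /add_state /sub_state; ring. Qed.

Definition dist phi psi : R := norm4 (sub_state phi psi).

Lemma dist_triangle psi phi chi : L2state phi -> L2state psi -> L2state chi ->
  dist phi chi <= dist phi psi + dist psi chi.
Proof.
move=> a b c; rewrite /dist (sub_stateE phi psi chi).
by apply: norm4D; exact: L2stateB.
Qed.

Lemma norm4_eq phi psi : L2state phi -> L2state psi ->
  (forall x, sqnormv (phi ^~ x) = sqnormv (psi ^~ x)) -> norm4 phi = norm4 psi.
Proof.
move=> a b h; rewrite !norm4E//; congr Num.sqrt.
by apply: eq_Rintegral => x _.
Qed.

Lemma distC phi psi : L2state phi -> L2state psi -> dist phi psi = dist psi phi.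
Proof.
move=> a b; apply: norm4_eq; [exact: L2stateB|exact: L2stateB|].
move=> x; rewrite -sqnormvN; congr sqnormv; apply/funext => k.
by rewrite /sub_state; ring.
Qed.

Lemma norm40 : norm4 (fun _ _ => 0 : C) = 0.
Proof.
rewrite norm4E.
  rewrite /sqnorm; under eq_Rintegral do rewrite /sqnormv big1 ?sqnormc0//.
  by rewrite Rintegral_cst// mul0r sqrtr0.
apply/L2stateP; split; first by move=> k; exact: cmeas_cst.
rewrite (_ : (fun x => _) = cst 0); first exact: integrable0.
by apply/funext => x /=; rewrite /sqnormv big1// => k _; rewrite sqnormc0.
Qed.

Lemma dist0 phi : dist phi phi = 0.
Proof.
rewrite /dist -[RHS]norm40; congr norm4.
by apply/funext => k; apply/funext => x; rewrite /sub_state subrr.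
Qed.

Lemma norm4_dist phi psi : L2state phi -> L2state psi ->
  `|norm4 phi - norm4 psi| <= dist phi psi.
Proof.
move=> a b; have aux p q : L2state p -> L2state q -> norm4 p - norm4 q <= dist p q.
  move=> c d; rewrite lerBlDr.
  have -> : norm4 p = norm4 (add_state (sub_state p q) q).
    by congr norm4; apply/funext => k; apply/funext => x;
      rewrite /add_state /sub_state; ring.
  by apply: norm4D => //; exact: L2stateB.
by rewrite ler_norml aux// andbT lerNl opprB (distC a b) aux.
Qed.

Lemma cvg_Rintegral0 (F : nat -> R -> R) (G : R -> R) :
  (forall n, meas (F n)) -> integ G -> (forall n x, `|F n x| <= G x) ->
  (forall x, (fun n => F n x) @ \oo --> (0 : R)) ->
  (fun n => \int[mu]_x F n x)%R @ \oo --> (0 : R).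
Proof.
move=> mF iG hb hc.
have h1 : {ae mu, forall x : R, setT x -> (fun n => (F n x)%:E) @ \oo --> (0%R)%:E}.
  apply: aeW => x _; apply/fine_cvgP; split; first exact: nearW.
  exact: hc.
have h2 : {ae mu, forall (x : R) (n : nat), setT x -> (`|(F n x)%:E| <= (G x)%:E)%E}.
  by apply: aeW => x n _; rewrite lee_fin.
have h3 n : measurable_fun setT (fun x : R => (F n x)%:E).
  by apply/measurable_EFinP; exact: (mF n).
have [_ _] := @dominated_convergence _ _ _ mu setT measurableT _ (cst 0%:E) _
  h3 (measurable_cst _) h1 iG h2.
rewrite integral0 => h.
have -> : (fun n => \int[mu]_x F n x)%R = fine \o (fun n => \int[mu]_x (F n x)%:E)%E by [].
rewrite -[0]/(fine 0%E); exact: fine_cvg.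
Qed.

(** Dominated convergence in the form used for pointwise rotations: the squared differences are
    controlled at each point by a fixed square-integrable state. *)
Lemma cvg_dist_dom (c : R) (F : nat -> state R) phi psi :
  (forall n, mstate (F n)) -> mstate phi -> L2state psi ->
  (forall n x, sqnormv (sub_state (F n) phi ^~ x) <= c * sqnormv (psi ^~ x)) ->
  (forall x, (fun n => sqnormv (sub_state (F n) phi ^~ x)) @ \oo --> (0 : R)) ->
  (fun n => sqnorm (sub_state (F n) phi)) @ \oo --> (0 : R).
Proof.
move=> mF mp /L2stateP[mq iq] hb hc.
apply: (cvg_Rintegral0 _ (integZ c iq) _ hc) => [n|n x].
  by apply: meas_sqnormv => k; exact: (cmeasB (mF n k) (mp k)).
by rewrite ger0_norm ?sqnormv_ge0//; exact: hb.
Qed.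

End L2.

(** * Translation invariance of the Lebesgue measure *)

Section Translation.
Variable R : realType.
Local Notation mu := (@lebesgue_measure R).
Local Notation integ f := (mu.-integrable [set: R] (EFin \o (f : R -> R))).

Let sh (a : R) : measurableTypeR R -> measurableTypeR R := fun x => x + a.

Lemma measurable_shift (a : R) : measurable_fun [set: R] (fun x : R => x + a).
Proof. by apply: measurable_funD => //; exact: measurable_cst. Qed.

Let msh (a : R) : measurable_fun [set: measurableTypeR R] (sh a).
Proof. exact: measurable_shift. Qed.

(** Uniqueness of the Lebesgue measure: the pushforward gives half-open intervals their length. *)
Lemma pushforward_shift (a : R) (A : set R) : measurable A ->
  pushforward mu (sh a) A = mu A.
Proof.
move=> mA; apply/esym.
pose m := pushforward mu (sh a).
apply: (@lebesgue_measure_unique R m _ A mA) => // X /ocitvP[->|[[u v] /= uv ->]].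
  by rewrite !measure0.
rewrite /m /pushforward.
have -> : sh a @^-1` `]u, v] = `]u - a, v - a].
  by apply/seteqP; split => x; rewrite /sh /= !in_itv/= ltrBlDr lerBrDr.
rewrite !lebesgue_measure_itv /= !lte_fin uv ltrD2r uv.
by rewrite -!EFinB; congr EFin; ring.
Qed.

Lemma integrable_shift (a : R) (D : set R) (f : R -> R) : measurable D ->
  measurable_fun [set: R] f ->
  mu.-integrable D (EFin \o f) ->
  mu.-integrable ((fun x => x + a) @^-1` D) (EFin \o (fun x => f (x + a))).
Proof.
move=> mD mf /integrableP[_ h]; apply/integrableP; split.
  apply: measurable_funTS; apply/measurable_EFinP.
  apply: (@measurableT_comp _ _ _ _ _ _ f) => //; exact: measurable_shift.
apply: le_lt_trans h.
have mg : measurable_fun D (fun x : R => `|(f x)%:E|%E).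
  by apply: measurable_funTS; apply: measurableT_comp => //; exact/measurable_EFinP.
rewrite -[X in (X <= _)%E](@ge0_integral_pushforward _ _ _ _ _ _ (msh a) mu D
  (fun x : R => `|(f x)%:E|%E))//.
rewrite (eq_measure_integral mu)// => A mA _; exact: pushforward_shift.
Qed.

Lemma Rintegral_shift (a : R) (D : set R) (f : R -> R) : measurable D ->
  measurable_fun [set: R] f -> mu.-integrable D (EFin \o f) ->
  (\int[mu]_(x in (fun x => x + a) @^-1` D) f (x + a) = \int[mu]_(x in D) f x)%R.
Proof.
move=> mD mf fi; rewrite /Rintegral; congr fine.
have mf' : measurable_fun [set: R] (EFin \o f) by exact/measurable_EFinP.
have fi' := integrable_shift a mD mf fi.
have := @integral_pushforward _ _ _ _ _ _ (msh a) mu D _ mf' fi' mD.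
move=> /= <-; apply: eq_measure_integral => A mA _; exact: pushforward_shift.
Qed.

Lemma RintegralT_shift (a : R) (f : R -> R) :
  measurable_fun [set: R] f -> integ f ->
  (\int[mu]_x f (x + a) = \int[mu]_x f x)%R.
Proof.
move=> mf fi; rewrite -(Rintegral_shift a measurableT mf fi).
by congr (Rintegral mu _ _).
Qed.

Lemma integrableT_shift (a : R) (f : R -> R) :
  measurable_fun [set: R] f -> integ f -> integ (fun x => f (x + a)).
Proof. by move=> mf fi; have := integrable_shift a measurableT mf fi. Qed.

End Translation.

(** * Flips and rotations of an ion *)

Section Spin.
Variable R : realType.
Local Notation C := R[i].
Local Notation Re := complex.Re.
Local Notation Im := complex.Im.

Lemma big_I4 (V : nmodType) (F : 'I_4 -> V) :
  \sum_k F k = F 0%R + F 1%R + F 2%R + F 3%R.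
Proof.
rewrite !big_ord_recr big_ord0 /= add0r.
by congr (F _ + F _ + F _ + F _); apply: val_inj.
Qed.

Lemma I4_ind (P : 'I_4 -> Prop) : P 0%R -> P 1%R -> P 2%R -> P 3%R -> forall k, P k.
Proof.
move=> h0 h1 h2 h3 [[|[|[|[|//]]]] hk].
- by have -> : Ordinal hk = 0%R by exact: val_inj.
- by have -> : Ordinal hk = 1%R by exact: val_inj.
- by have -> : Ordinal hk = 2%R by exact: val_inj.
- by have -> : Ordinal hk = 3%R by exact: val_inj.
Qed.

(* [b = false] is the first ion, [b = true] the second one *)
Definition flip (b : bool) (k : 'I_4) : 'I_4 :=
  nth 0%R (if b then [:: 2; 3; 0; 1]%R else [:: 1; 0; 3; 2]%R) k.
Definition excited (b : bool) (k : 'I_4) : bool :=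
  if b then (2 <= k)%N else odd k.
(** The flip is the matrix [S v k = phase b w k * v (flip b k)]. The conjugate on excited levels
    makes [S] Hermitian, and for unimodular [w] it satisfies [S^2 = 1]; [w] is the direction of its
    axis in the equatorial plane of the Bloch sphere. *)
Definition phase (b : bool) (w : C) (k : 'I_4) : C :=
  if excited b k then conjc w else w.

Lemma flipK b k : flip b (flip b k) = k.
Proof. by elim/I4_ind: k; case: b. Qed.
Lemma excited_flip b k : excited b (flip b k) = ~~ excited b k.
Proof. by elim/I4_ind: k; case: b. Qed.
Lemma excited_flipN b k : excited (~~ b) (flip b k) = excited (~~ b) k.
Proof. by elim/I4_ind: k; case: b. Qed.
Lemma phase_flip b w k : phase b w (flip b k) = conjc (phase b w k).
Proof. by rewrite /phase excited_flip; case: (excited b k); rewrite /= ?conjcK. Qed.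
Lemma sqnormc_phase b w k : sqnormc (phase b w k) = sqnormc w.
Proof. by rewrite /phase; case: ifP => // _; rewrite sqnormcJ. Qed.

Lemma mulcJ (z : C) : z * conjc z = rC (sqnormc z).
Proof. by apply: eqcP; rewrite /sqnormc !reimE; ring. Qed.

Lemma phaseJ b w k : sqnormc w = 1 -> phase b w k * conjc (phase b w k) = 1.
Proof. by move=> h; rewrite mulcJ sqnormc_phase h. Qed.

Lemma sum_flip (V : nmodType) b (F : 'I_4 -> V) : \sum_k F (flip b k) = \sum_k F k.
Proof.
rewrite [RHS](reindex_inj (h := flip b))//.
by apply: (can_inj (g := flip b)); exact: flipK.
Qed.

(** This is [exp (- i th S)], which equals [cos th - i sin th S] because [S^2 = 1]. *)
Definition rotv (b : bool) (w : C) (th : R) (v : 'I_4 -> C) : 'I_4 -> C :=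
  fun k => rC (cos th) * v k - iC R * rC (sin th) * phase b w k * v (flip b k).

Lemma sqnormv_rotv b w th v : sqnormc w = 1 ->
  sqnormv (rotv b w th v) = sqnormv v.
Proof.
move=> hw; suff h : sqnormv (rotv b w th v) =
    \sum_k (cos th ^+ 2 * sqnormc (v k) + sin th ^+ 2 * sqnormc (v k)).
  rewrite h; apply: eq_bigr => k _.
  by rewrite -mulrDl cos2Dsin2 mul1r.
rewrite big_split/= -[X in _ = _ + X](sum_flip b) -big_split/=.
pose X k := 2 * cos th * sin th * Im (conjc (v k) * phase b w k * v (flip b k)).
have -> : sqnormv (rotv b w th v) = \sum_k (cos th ^+ 2 * sqnormc (v k) +
    sin th ^+ 2 * sqnormc (v (flip b k)) + X k).
  apply: eq_bigr => k _; rewrite /X /rotv.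
  have := sqnormc_phase b w k; rewrite hw /sqnormc !reimE => h.
  set a := Re (v k); set a' := Im (v k); set c := Re (v (flip b k));
  set c' := Im (v (flip b k)); set p := Re (phase b w k) in h *;
  set p' := Im (phase b w k) in h *.
  transitivity (cos th ^+ 2 * (a ^+ 2 + a' ^+ 2) +
    sin th ^+ 2 * ((c ^+ 2 + c' ^+ 2) * (p ^+ 2 + p' ^+ 2)) +
    2 * cos th * sin th * ((a * p + a' * p') * c' + (a * p' - a' * p) * c));
    first by ring.
  by rewrite h; ring.
rewrite big_split/= -[RHS]addr0; congr (_ + _).
(* The cross terms cancel in pairs: exchanging a level with its flipped partner conjugates the
   product inside the imaginary part, as [S] is Hermitian. *)
have : \sum_k X k = - \sum_k X k.
  rewrite -{1}(sum_flip b) -sumrN; apply: eq_bigr => k _.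
  rewrite /X flipK phase_flip !reimE; ring.
by move=> /eqP; rewrite -addr_eq0 -mulr2n mulrn_eq0 /= => /eqP.
Qed.

Lemma rotvD b w t s v : sqnormc w = 1 ->
  rotv b w t (rotv b w s v) = rotv b w (t + s) v.
Proof.
move=> hw; apply/funext => k; rewrite /rotv flipK phase_flip.
have h := phaseJ b k hw; rewrite cosD sinD.
have i2 : iC R * iC R = -1 by apply: eqcP; rewrite !reimE; ring.
have rD (x y : R) : rC (x + y) = rC x + rC y by apply: eqcP; rewrite !reimE; ring.
have rB (x y : R) : rC (x - y) = rC x - rC y by apply: eqcP; rewrite !reimE; ring.
have rM (x y : R) : rC (x * y) = rC x * rC y by apply: eqcP; rewrite !reimE; ring.
rewrite rB rD !rM.
transitivity (rC (cos t) * rC (cos s) * v k +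
  (iC R * iC R) * rC (sin t) * rC (sin s) *
  (phase b w k * conjc (phase b w k)) * v k -
  iC R * phase b w k * v (flip b k) *
  (rC (cos t) * rC (sin s) + rC (sin t) * rC (cos s))); first by ring.
by rewrite h i2; ring.
Qed.

Lemma rotv0 b w v : rotv b w 0 v = v.
Proof.
by apply/funext => k; rewrite /rotv cos0 sin0; apply: eqcP; rewrite !reimE; ring.
Qed.

End Spin.

(** * Weak derivatives along translations *)

Section Inner.
Variable R : realType.
Local Notation mu := (@lebesgue_measure R).
Local Notation C := R[i].
Local Notation Re := complex.Re.
Local Notation Im := complex.Im.
Implicit Types (f g h : R -> C) (phi psi : state R).
Local Notation integ f := (mu.-integrable [set: R] (EFin \o (f : R -> R))).
Local Notation cinteg f := (cintegrable [set: R] (f : R -> C)).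

Lemma integ_ext (f g : R -> R) : f =1 g -> integ f -> integ g.
Proof. by move=> /funext ->. Qed.

Lemma cintegZ (c : C) f : cinteg f -> cinteg (fun x => c * f x).
Proof.
move=> [a b]; split.
  by apply: integ_ext (integB (integZ (Re c) a) (integZ (Im c) b)) => x; rewrite reimE.
by apply: integ_ext (integD (integZ (Re c) b) (integZ (Im c) a)) => x; rewrite reimE.
Qed.

Lemma cintegralTD f g : cinteg f -> cinteg g ->
  cintegral setT (fun x => f x + g x) = cintegral setT f + cintegral setT g.
Proof.
move=> [a b] [c d]; apply: eqcP; rewrite reimE /cintegral /=.
  by rewrite -RintegralD//; apply: eq_Rintegral => x _; rewrite reimE.
by rewrite -RintegralD//; apply: eq_Rintegral => x _; rewrite reimE.
Qed.
Lemma Re_cintegral D f : Re (cintegral D f) = (\int[mu]_(x in D) Re (f x))%R.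
Proof. by []. Qed.
Lemma Im_cintegral D f : Im (cintegral D f) = (\int[mu]_(x in D) Im (f x))%R.
Proof. by []. Qed.

Lemma cintegralTZ (c : C) f : cinteg f ->
  cintegral setT (fun x => c * f x) = c * cintegral setT f.
Proof.
move=> [a b]; apply: eqcP; rewrite [RHS]reimE !Re_cintegral !Im_cintegral.
  rewrite -!RintegralZl// -RintegralB//; [|exact: integZ|exact: integZ].
  by apply: eq_Rintegral => x _; rewrite reimE.
rewrite -!RintegralZl// -RintegralD//; [|exact: integZ|exact: integZ].
by apply: eq_Rintegral => x _; rewrite reimE.
Qed.

Lemma normM2D_le (a b c d : R) :
  `|a * b + c * d| <= a ^+ 2 + b ^+ 2 + c ^+ 2 + d ^+ 2.
Proof.
have aux (u v : R) : `|u * v| <= u ^+ 2 + v ^+ 2.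
  rewrite normrM -(real_normK (num_real u)) -(real_normK (num_real v)).
  have := normr_ge0 u; have := normr_ge0 v.
  by move: `|u| `|v| => x y x0 y0; nra.
apply: (le_trans (ler_normD _ _)); have := aux a b; have := aux c d; lra.
Qed.

Lemma cinteg_JM f g : L2fun f -> L2fun g -> cinteg (fun x => conjc (f x) * g x).
Proof.
move=> /L2funP[mf fi] /L2funP[mg gi].
have [mr mi] := cmeasM (cmeasJ mf) mg.
have key z w : `|Re (conjc z * w)| <= sqnormc z + sqnormc w /\
    `|Im (conjc z * w)| <= sqnormc z + sqnormc w :> R.
  rewrite /sqnormc !reimE; split.
    rewrite (_ : _ - _ = Re z * Re w + Im z * Im w); last by ring.
    apply: (le_trans (normM2D_le _ _ _ _)); lra.
  apply: (le_trans (normM2D_le _ _ _ _)); rewrite sqrrN; lra.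
by split; [apply: (integ_le mr (integD fi gi))|apply: (integ_le mi (integD fi gi))] => x;
  have [] := key (f x) (g x).
Qed.

Lemma L2innerDr f g h : L2fun f -> L2fun g -> L2fun h ->
  L2inner f (fun x => g x + h x) = L2inner f g + L2inner f h.
Proof.
move=> a b c; rewrite /L2inner -cintegralTD; [|exact: cinteg_JM..].
by congr cintegral; apply/funext => x; rewrite mulrDr.
Qed.
Lemma L2innerZr (c : C) f g : L2fun f -> L2fun g ->
  L2inner f (fun x => c * g x) = c * L2inner f g.
Proof.
move=> a b; rewrite /L2inner -cintegralTZ; last exact: cinteg_JM.
by congr cintegral; apply/funext => x; ring.
Qed.
Lemma L2innerZl (c : C) f g : L2fun f -> L2fun g ->
  L2inner (fun x => c * f x) g = conjc c * L2inner f g.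
Proof.
move=> a b; rewrite /L2inner -cintegralTZ; last exact: cinteg_JM.
by congr cintegral; apply/funext => x; apply: eqcP; rewrite !reimE; ring.
Qed.

Lemma L2funZ (c : C) f : L2fun f -> L2fun (fun x => c * f x).
Proof.
move=> /L2funP[mf fi]; apply/L2funP; split; first exact: (cmeasM (cmeas_cst c)).
by apply: integ_ext (integZ (sqnormc c) fi) => x; rewrite sqnormcM.
Qed.
Lemma L2funD f g : L2fun f -> L2fun g -> L2fun (fun x => f x + g x).
Proof.
move=> /L2funP[mf fi] /L2funP[mg gi]; apply/L2funP; split; first exact: cmeasD.
apply: (integ_le (meas_sqnormc (cmeasD mf mg)) (integD (integZ 2 fi) (integZ 2 gi))) => x.
rewrite ger0_norm ?sqnormc_ge0//.
by have := @sqnormcD_le _ 1 (f x) (g x) ltr01; rewrite invr1.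
Qed.
Lemma L2fun_shift (a : R) f : L2fun f -> L2fun (fun x => f (x + a)).
Proof.
move=> /L2funP[mf fi]; apply/L2funP; split.
  exact: (cmeas_comp (measurable_shift a) mf).
exact: (integrableT_shift a (meas_sqnormc mf) fi).
Qed.

(** Continuous differentiability with a prescribed derivative, by components: exactly the input of
    the fundamental theorem of calculus on real and imaginary parts. *)
Definition C1c (J J' : R -> C) := forall t : R,
  [/\ is_derive t 1 (fun s => Re (J s)) (Re (J' t)),
      is_derive t 1 (fun s => Im (J s)) (Im (J' t)),
      {for t, continuous (fun s => Re (J' s))} &
      {for t, continuous (fun s => Im (J' s))}].

Lemma C1c_ext J J' K K' : J =1 K -> J' =1 K' -> C1c J J' -> C1c K K'.
Proof. by move=> /funext -> /funext ->. Qed.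

Lemma C1cD J J' K K' : C1c J J' -> C1c K K' ->
  C1c (fun t => J t + K t) (fun t => J' t + K' t).
Proof.
move=> a b t; have [a1 a2 a3 a4] := a t; have [b1 b2 b3 b4] := b t.
rewrite (_ : (fun s => Re (J s + K s)) = (fun s => Re (J s)) \+ (fun s => Re (K s)));
  last by apply/funext => s; rewrite /= reimE.
rewrite (_ : (fun s => Im (J s + K s)) = (fun s => Im (J s)) \+ (fun s => Im (K s)));
  last by apply/funext => s; rewrite /= reimE.
rewrite (_ : (fun s => Re (J' s + K' s)) = (fun s => Re (J' s)) \+ (fun s => Re (K' s)));
  last by apply/funext => s; rewrite /= reimE.
rewrite (_ : (fun s => Im (J' s + K' s)) = (fun s => Im (J' s)) \+ (fun s => Im (K' s)));
  last by apply/funext => s; rewrite /= reimE.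
rewrite !reimE; split; [exact: is_deriveD|exact: is_deriveD|exact: continuousD|
  exact: continuousD].
Qed.

Lemma C1cZ (c : C) J J' : C1c J J' -> C1c (fun t => c * J t) (fun t => c * J' t).
Proof.
move=> a t; have [a1 a2 a3 a4] := a t.
have e1 (K : R -> C) : (fun s => Re (c * K s)) =
    (Re c \*: (fun s => Re (K s))) \- (Im c \*: (fun s => Im (K s))).
  by apply/funext => s; rewrite /= reimE.
have e2 (K : R -> C) : (fun s => Im (c * K s)) =
    (Re c \*: (fun s => Im (K s))) \+ (Im c \*: (fun s => Re (K s))).
  by apply/funext => s; rewrite /= reimE.
rewrite !e1 !e2 !reimE; split.
- exact: is_deriveB.
- exact: is_deriveD.
- by apply: continuousB; apply: continuousM => //; exact: cvg_cst.
- by apply: continuousD; apply: continuousM => //; exact: cvg_cst.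
Qed.

Lemma C1c_sum (J J' : 'I_4 -> R -> C) : (forall k, C1c (J k) (J' k)) ->
  C1c (fun t => \sum_k J k t) (fun t => \sum_k J' k t).
Proof.
move=> h; apply: (@C1c_ext (fun t => J 0%R t + J 1%R t + J 2%R t + J 3%R t)
  (fun t => J' 0%R t + J' 1%R t + J' 2%R t + J' 3%R t)).
- by move=> t; rewrite big_I4.
- by move=> t; rewrite big_I4.
- by do !apply: C1cD => //.
Qed.

Lemma C1c_scale (c : R) J J' : C1c J J' ->
  C1c (fun t => J (c * t)) (fun t => rC c * J' (c * t)).
Proof.
move=> a t; have [a1 a2 a3 a4] := a (c * t).
have dc : is_derive t 1 (fun s : R => c * s) c.
  by apply: is_derive_eq; rewrite /GRing.scale/= ?mulr1 ?mulr0 ?add0r ?addr0.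
have cc : {for t, continuous (fun s : R => c * s)}.
  by apply: continuousM => //; exact: cvg_cst.
have cr (f : R -> R) : {for c * t, continuous f} -> {for t, continuous (fun s => c * f (c * s))}.
  move=> cf; apply: continuousM; first exact: cvg_cst.
  exact: (@continuous_comp _ _ _ (fun s : R => c * s) f).
have dr (f : R -> R) (l : R) : is_derive (c * t) 1 f l ->
    is_derive t 1 (fun s => f (c * s)) (c * l).
  by move=> df; have := @is_derive1_comp _ f (fun s : R => c * s) t l c df dc; rewrite mulrC.
have e1 z : Re (rC c * z) = c * Re z by rewrite !reimE; ring.
have e2 z : Im (rC c * z) = c * Im z by rewrite !reimE; ring.
rewrite (_ : (fun s => Re (rC c * J' (c * s))) = fun s => c * Re (J' (c * s)));
  last by apply/funext => s; rewrite e1.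
rewrite (_ : (fun s => Im (rC c * J' (c * s))) = fun s => c * Im (J' (c * s)));
  last by apply/funext => s; rewrite e2.
rewrite e1 e2; split; [exact: dr|exact: dr| |].
  exact: (cr (fun s => Re (J' s))).
exact: (cr (fun s => Im (J' s))).
Qed.

(** The weak formulation of the system is an integral identity of this shape, with [J] the pairing
    against a test state. *)
Lemma C1c_FTC J J' (t : R) : C1c J J' -> 0 <= t ->
  cintegrable `[0, t] J' /\ J t - J 0 = cintegral `[0, t] J'.
Proof.
move=> h t0.
have aux (f f' : R -> R) : (forall s : R, is_derive s 1 f (f' s)) -> continuous f' ->
    mu.-integrable `[0, t] (EFin \o f') /\
    f t - f 0 = (\int[mu]_(s in `[0, t]) f' s)%R.
  move=> df cf'.
  have wf : {within `[0, t], continuous f'} by exact: continuous_subspaceT.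
  have ifi : mu.-integrable `[0, t] (EFin \o f').
    by apply: continuous_compact_integrable => //; exact: segment_compact.
  (* The fundamental theorem is applied on a nondegenerate interval, so [t = 0] is treated apart. *)
  split=> //; move: t0; rewrite le_eqVlt => /orP[/eqP <-|t0].
    by rewrite subrr set_itv1 Rintegral_set1.
  have cf : continuous f.
    by move=> s; apply: differentiable_continuous; apply/derivable1_diffP;
      have [] := df s.
  rewrite /Rintegral (continuous_FTC2 (F := f) t0 wf)//.
    split; [by move=> s _; have [] := df s| |].
      exact/cvg_at_right_filter/cf.
    exact/cvg_at_left_filter/cf.
  by move=> s _; rewrite derive1E; have [_ ->] := df s.
have [i1 e1] := aux (fun s => Re (J s)) (fun s => Re (J' s))
  (fun s => let: And4 a _ _ _ := h s in a) (fun s => let: And4 _ _ a _ := h s in a).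
have [i2 e2] := aux (fun s => Im (J s)) (fun s => Im (J' s))
  (fun s => let: And4 _ a _ _ := h s in a) (fun s => let: And4 _ _ _ a := h s in a).
by split => //; apply: eqcP; rewrite !reimE.
Qed.

End Inner.

(** * Differentiation and continuity under the integral sign *)

Section Under.
Variable R : realType.
Local Notation mu := (@lebesgue_measure R).
Local Notation C := R[i].
Local Notation Re := complex.Re.
Local Notation Im := complex.Im.
Local Notation integ f := (mu.-integrable [set: R] (EFin \o (f : R -> R))).

Lemma is_derive_under_integral (f f' : R -> R -> R) (G : R -> R) (t : R) :
  (forall s, integ (f s)) ->
  (forall s x : R, is_derive s 1 (f ^~ x) (f' s x)) ->
  integ G -> (forall s x : R, `|s - t| < 1 -> `|f' s x| <= G x) ->
  is_derive t 1 (fun s => \int[mu]_x f s x)%R (\int[mu]_x f' t x)%R.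
Proof.
move=> fi df Gi hG.
have It : (`]t - 1, t + 1[%classic : set R) t by rewrite /= in_itv /=; lra.
have G0 x : 0 <= G x by apply: (le_trans _ (hG t x _)); rewrite ?subrr ?normr0.
have d1 s x : partial1of2 f s x = f' s x.
  by rewrite partial1of2E; have [_ ->] := df s x.
have bnd s x : (`]t - 1, t + 1[%classic : set R) s -> setT x -> `|partial1of2 f s x| <= G x.
  move=> hs _; rewrite d1; apply: hG; move: hs; rewrite /= in_itv /= ltr_norml => hs; lra.
have der s x : (`]t - 1, t + 1[%classic : set R) s -> setT x -> derivable (f ^~ x) s 1.
  by move=> _ _; have [] := df s x.
split.
  by have := @derivable_under_integral R _ _ mu f setT measurableT t (t - 1) (t + 1) It
    (fun s _ => fi s) der G G0 Gi bnd.
rewrite -derive1E.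
have -> := @differentiation_under_integral R _ _ mu f setT measurableT t (t - 1) (t + 1) It
    (fun s _ => fi s) der G G0 Gi bnd.
by apply: eq_Rintegral => x _; rewrite d1.
Qed.

Lemma continuous_under_integral_dom (f : R -> R -> R) (G : R -> R) (t : R) :
  (forall s, integ (f s)) -> (forall x, continuous (f ^~ x)) ->
  integ G -> (forall s x, `|s - t| < 1 -> `|f s x| <= G x) ->
  {for t, continuous (fun s => \int[mu]_x f s x)%R}.
Proof.
move=> fi cf Gi hG.
have := @continuity_under_integral R _ _ mu f setT measurableT (t - 1) (t + 1)
  (fun s _ => fi s) _ G Gi _ t.
apply.
- by apply: aeW => x _ s _; exact: cf.
- move=> s; rewrite /= in_itv /= => hs; apply: aeW => x _; apply: hG.
  by rewrite ltr_norml; lra.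
- by rewrite inE /= in_itv /=; lra.
Qed.

(** The model of a pairing along a multiplication pulse, where [g] is the unbounded angle rate.
    Differentiation brings down a factor [g]; integrability of [g a] and [g b], which compactly
    supported test functions provide, is what absorbs it. *)
Lemma C1_mult (g a b : R -> R) : measurable_fun setT g ->
  measurable_fun setT a -> measurable_fun setT b ->
  integ a -> integ b -> integ (fun x => g x * a x) -> integ (fun x => g x * b x) ->
  (forall t : R, is_derive t 1
    (fun t : R => \int[mu]_x (cos (t * g x) * a x + sin (t * g x) * b x))%R
    (\int[mu]_x (cos (t * g x) * (g x * b x) - sin (t * g x) * (g x * a x)))%R) /\
  continuous (fun t : R => \int[mu]_x (cos (t * g x) * (g x * b x) - sin (t * g x) * (g x * a x)))%R.
Proof.
move=> mg ma mb ai bi gai gbi.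
have mcs (t : R) : measurable_fun setT (fun x : R => cos (t * g x)) /\
    measurable_fun setT (fun x : R => sin (t * g x)).
  have mt : measurable_fun setT (fun x : R => t * g x) by exact: measurable_funM.
  split; apply: (measurableT_comp _ mt); apply: continuous_measurable_fun.
    exact: continuous_cos.
  exact: continuous_sin.
have key (t : R) (u v : R -> R) : measurable_fun setT u -> measurable_fun setT v ->
   integ u -> integ v -> integ (fun x => cos (t * g x) * u x + sin (t * g x) * v x).
  move=> mu_ mv ui vi; have [mc ms] := mcs t.
  apply: (integ_le _ (integD (integrable_norm ui) (integrable_norm vi))).
    by apply: measurable_funD; exact: measurable_funM.
  move=> x /=; apply: (le_trans (ler_normD _ _)); rewrite !normrM.
  by apply: lerD; rewrite ler_piMl ?cos_max ?sin_max.
have bnd (t : R) (u v : R) (x : R) : `|cos (t * g x) * u + sin (t * g x) * v| <= `|u| + `|v|.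
  apply: (le_trans (ler_normD _ _)); rewrite !normrM.
  by apply: lerD; rewrite ler_piMl ?cos_max ?sin_max.
have mga : measurable_fun setT (fun x => - (g x * a x)).
  by apply: measurable_funN; exact: measurable_funM.
have mgb : measurable_fun setT (fun x => g x * b x) by exact: measurable_funM.
have gai' : integ (fun x => - (g x * a x)).
  by apply: integ_ext (integZ (-1) gai) => x; rewrite mulN1r.
have E (t : R) : (\int[mu]_x (cos (t * g x) * (g x * b x) - sin (t * g x) * (g x * a x)) =
    \int[mu]_x (cos (t * g x) * (g x * b x) + sin (t * g x) * - (g x * a x)))%R.
  by apply: eq_Rintegral => x _; rewrite mulrN.
have G := integD (integrable_norm gbi) (integrable_norm gai').
rewrite (funext E).
split=> [t|].
  rewrite E.
  apply: (is_derive_under_integral (f := fun t x => cos (t * g x) * a x + sin (t * g x) * b x)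
    (f' := fun t x => cos (t * g x) * (g x * b x) + sin (t * g x) * - (g x * a x)) _ _ G).
  - by move=> s; exact: key.
  - move=> s x.
    have dl : is_derive s 1 (fun s : R => s * g x) (g x).
      by apply: is_derive_eq; rewrite /GRing.scale/= ?mulr1 ?mulr0 ?add0r ?addr0.
    have dc := @is_derive1_comp _ cos (fun s : R => s * g x) s _ _ (is_derive_cos _) dl.
    have ds := @is_derive1_comp _ sin (fun s : R => s * g x) s _ _ (is_derive_sin _) dl.
    apply: is_derive_eq; rewrite /GRing.scale/=; ring.
  - by move=> s x _; exact: bnd.
move=> t; apply: (continuous_under_integral_dom _ _ G).
- by move=> s; exact: key.
- move=> x s.
  have cl : {for s, continuous (fun s : R => s * g x)}.
    by apply: continuousM => //; exact: cvg_cst.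
  apply: cvgD; (apply: cvgM; last exact: cvg_cst).
    apply: (@continuous_comp _ _ _ (fun s : R => s * g x) cos) => //; exact: continuous_cos.
  apply: (@continuous_comp _ _ _ (fun s : R => s * g x) sin) => //; exact: continuous_sin.
- by move=> s x _; exact: bnd.
Qed.

Lemma C1c_mult (g : R -> R) (a b : R -> C) : measurable_fun setT g ->
  cmeasurable setT a -> cmeasurable setT b ->
  cintegrable setT a -> cintegrable setT b ->
  cintegrable setT (fun x => rC (g x) * a x) -> cintegrable setT (fun x => rC (g x) * b x) ->
  C1c (fun t => cintegral setT (fun x => rC (cos (t * g x)) * a x + rC (sin (t * g x)) * b x))
   (fun t => cintegral setT (fun x =>
      rC (cos (t * g x)) * (rC (g x) * b x) - rC (sin (t * g x)) * (rC (g x) * a x))).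
Proof.
move=> mg [ma1 ma2] [mb1 mb2] [ai1 ai2] [bi1 bi2] [ga1 ga2] [gb1 gb2].
have e1 r z : Re (rC r * z) = r * Re z :> R by rewrite !reimE; ring.
have e2 r z : Im (rC r * z) = r * Im z :> R by rewrite !reimE; ring.
have ext1 (f : R -> C) : integ (fun x => Re (rC (g x) * f x)) ->
  integ (fun x => g x * Re (f x)) by apply: integ_ext => x; rewrite e1.
have ext2 (f : R -> C) : integ (fun x => Im (rC (g x) * f x)) ->
  integ (fun x => g x * Im (f x)) by apply: integ_ext => x; rewrite e2.
have [d1 c1] := C1_mult mg ma1 mb1 ai1 bi1 (ext1 _ ga1) (ext1 _ gb1).
have [d2 c2] := C1_mult mg ma2 mb2 ai2 bi2 (ext2 _ ga2) (ext2 _ gb2).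
have E1 (t : R) : Re (cintegral setT (fun x => rC (cos (t * g x)) * a x + rC (sin (t * g x)) * b x))
   = (\int[mu]_x (cos (t * g x) * Re (a x) + sin (t * g x) * Re (b x)))%R.
  by rewrite Re_cintegral; apply: eq_Rintegral => x _; rewrite reimE !e1.
have E2 (t : R) : Im (cintegral setT (fun x => rC (cos (t * g x)) * a x + rC (sin (t * g x)) * b x))
   = (\int[mu]_x (cos (t * g x) * Im (a x) + sin (t * g x) * Im (b x)))%R.
  by rewrite Im_cintegral; apply: eq_Rintegral => x _; rewrite reimE !e2.
have E3 (t : R) : Re (cintegral setT (fun x =>
      rC (cos (t * g x)) * (rC (g x) * b x) - rC (sin (t * g x)) * (rC (g x) * a x)))
   = (\int[mu]_x (cos (t * g x) * (g x * Re (b x)) - sin (t * g x) * (g x * Re (a x))))%R.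
  by rewrite Re_cintegral; apply: eq_Rintegral => x _; rewrite ReD ReN !e1.
have E4 (t : R) : Im (cintegral setT (fun x =>
      rC (cos (t * g x)) * (rC (g x) * b x) - rC (sin (t * g x)) * (rC (g x) * a x)))
   = (\int[mu]_x (cos (t * g x) * (g x * Im (b x)) - sin (t * g x) * (g x * Im (a x))))%R.
  by rewrite Im_cintegral; apply: eq_Rintegral => x _; rewrite ImD ImN !e2.
move=> t; rewrite E3 E4 (funext E1) (funext E2) (funext E3) (funext E4).
by split; [exact: d1|exact: d2|exact: c1|exact: c2].
Qed.

End Under.

(** * Test functions and pairings along translations *)

Section TestFunctions.
Variable R : realType.
Local Notation mu := (@lebesgue_measure R).
Local Notation C := R[i].
Local Notation Re := complex.Re.
Local Notation Im := complex.Im.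
Local Notation integ f := (mu.-integrable [set: R] (EFin \o (f : R -> R))).

Definition rtest (p : R -> R) : Prop :=
  smooth_real p /\ exists K : R, forall x, K < `|x| -> p x = 0.

Lemma rtest_is_derive p (x : R) : rtest p -> is_derive x 1 p (derive1 p x).
Proof. by move=> [sp _]; have := sp 0%N x; rewrite derive1n0 derive1E => d; split. Qed.

Lemma rtest_continuous p : rtest p -> continuous p.
Proof.
move=> hp x; apply: differentiable_continuous; apply/derivable1_diffP.
by have [] := rtest_is_derive x hp.
Qed.

Lemma rtest_measurable p : rtest p -> measurable_fun [set: R] p.
Proof. by move=> hp; apply: continuous_measurable_fun; exact: rtest_continuous. Qed.

Lemma rtest_deriv p : rtest p -> rtest p^`().
Proof.
move=> hp; have [sp [K hK]] := hp; split.
  by move=> n x; have := sp n.+1 x; rewrite derive1Sn.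
exists K => x Kx; rewrite derive1E.
rewrite (@near_eq_derive _ _ _ p (cst 0) x 1) ?derive_cst//.
have : \forall y \near x, K < `|y|.
  have cn : {for x, continuous (fun y : R => `|y|)} by exact: norm_continuous.
  exact: (cvgr_gt `|x| cn).
by apply: filterS => y; exact: hK.
Qed.

Lemma rtest_bound p : rtest p -> exists K B : R,
  [/\ 0 <= K, 0 <= B, (forall x, `|p x| <= B) & forall x, K < `|x| -> p x = 0].
Proof.
move=> hp; have [_ [K0 hK0]] := hp.
pose K := Num.max K0 0.
have K_ge0 : 0 <= K by rewrite le_max lexx orbT.
have hK x : K < `|x| -> p x = 0.
  by move=> h; apply: hK0; apply: le_lt_trans h; rewrite le_max lexx.
have KK : - K <= K by lra.
have cn : {within `[- K, K], continuous (fun x => `|p x|)}.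
  apply: continuous_subspaceT => x.
  apply: (@continuous_comp _ _ _ p (fun y : R => `|y|)); first exact: rtest_continuous.
  exact: norm_continuous.
have [c _ hc] := EVT_max KK cn.
exists K, `|p c|; split => // x.
have [h|h] := leP `|x| K; last by rewrite hK// normr0.
by apply: hc; rewrite in_itv /= -ler_norml.
Qed.

Lemma integ_indic_seg (K : R) : integ (\1_(`[- K, K] : set R)).
Proof.
exact: (integrable_indic_itv (- K) K true false).
Qed.

Lemma indic_seg_norm (K x : R) : `|x| <= K -> \1_(`[- K, K] : set R) x = 1 :> R.
Proof. by move=> h; rewrite indicE mem_set//= in_itv /= -ler_norml. Qed.

Lemma indic01 (A : set R) (x : R) : 0 <= (\1_A x : R) <= 1.
Proof. by rewrite indicE; case: (x \in A); rewrite !lexx !ler01. Qed.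

(** With [i] an indicator, this bounds a square-integrable function localised to a segment by an
    integrable one. *)
Lemma mul01_le_sqr (i y : R) : 0 <= i <= 1 -> 0 <= y -> i * y <= i + y ^+ 2.
Proof.
move=> /andP[i0 i1] y0; apply: (@le_trans _ _ (i * (1 + y ^+ 2))).
  by rewrite ler_wpM2l//; nra.
by rewrite mulrDr mulr1 lerD2l ler_piMl ?sqr_ge0.
Qed.

(** As [q] is merely square integrable, the translation is first moved onto the smooth factor [p] by
    a change of variables; the derivative then falls on [p], and the change of variables is
    undone. *)
Lemma C1_shift (p q : R -> R) (t : R) : rtest p -> measurable_fun setT q ->
  integ (fun x => q x ^+ 2) ->
  is_derive t 1 (fun t : R => \int[mu]_x (p x * q (x - t)))%R
    (\int[mu]_x (derive1 p x * q (x - t)))%R.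
Proof.
move=> hp mq q2.
have hp' := rtest_deriv hp.
have [K [B [K0 B0 hB hK]]] := rtest_bound hp.
have [K' [B' [K'0 B'0 hB' hK']]] := rtest_bound hp'.
have ms (s : R) := measurable_shift s.
(* A translate by [s] of a function supported in [[-L, L]] lives in [[-(L + |s|), L + |s|]], so a
   dominating function that is uniform for [s] near [t] only has to enlarge the segment. *)
have dom (r : R -> R) (L A : R) (s : R) : measurable_fun setT r -> 0 <= A ->
    (forall x, `|r x| <= A) -> (forall x, L < `|x| -> r x = 0) ->
    forall x, `|r (x + s) * q x| <=
      A * (\1_(`[- (L + `|s|), L + `|s|] : set R) x * `|q x|).
  move=> mr A0 hA hL x; rewrite normrM.
  have [h|h] := leP `|x| (L + `|s|).
    by rewrite indic_seg_norm// mul1r ler_wpM2r.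
  rewrite hL ?normr0 ?mul0r; last first.
    have : `|x| <= `|x + s| + `|s|.
      by rewrite -{1}(addrK s x) (le_trans (ler_normB _ _)).
    lra.
  by rewrite mulr_ge0// mulr_ge0//; have /andP[] := indic01 (`[- (L + `|s|), L + `|s|] : set R) x.
have iG (A L : R) : integ (fun x => A * (\1_(`[- L, L] : set R) x * `|q x|)).
  apply: integZ; apply: (integ_le _ (integD (integ_indic_seg L) q2)).
    apply: measurable_funM; first exact: measurable_indic.
    exact: measurableT_comp.
  move=> x; have /andP[i0 i1] := indic01 (`[- L, L] : set R) x.
  rewrite ger0_norm ?mulr_ge0// -(real_normK (num_real (q x))).
  by apply: mul01_le_sqr => //; rewrite i0 i1.
have mpq (r : R -> R) (s : R) : rtest r -> measurable_fun setT (fun x : R => r (x + s) * q x).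
  move=> hr; apply: measurable_funM => //.
  by apply: (measurableT_comp _ (ms s)); exact: rtest_measurable.
have ipq (r : R -> R) (s : R) : rtest r -> integ (fun x : R => r (x + s) * q x).
  move=> hr; have [L [A [L0 A0 hA hL]]] := rtest_bound hr.
  exact: (integ_le (mpq r s hr) (iG A _) (dom r L A s (rtest_measurable hr) A0 hA hL)).
have sh (r : R -> R) : rtest r ->
    (fun s => \int[mu]_x (r x * q (x - s)))%R = (fun s => \int[mu]_x (r (x + s) * q x))%R.
  move=> hr; apply/funext => s.
  have m1 : measurable_fun setT (fun x : R => r x * q (x - s)).
    apply: measurable_funM; first exact: rtest_measurable.
    exact: (measurableT_comp mq (ms (- s))).
  have i1 : integ (fun x : R => r x * q (x - s)).
    have := integrableT_shift (- s) (mpq r s hr) (ipq r s hr).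
    by apply: integ_ext => x; rewrite subrK.
  rewrite -(RintegralT_shift s m1 i1).
  by apply: eq_Rintegral => x _; rewrite addrK.
rewrite (sh _ hp).
have -> : (\int[mu]_x (derive1 p x * q (x - t)) = \int[mu]_x (derive1 p (x + t) * q x))%R.
  by have /(congr1 (fun h => h t)) := sh _ hp'.
apply: (is_derive_under_integral (f := fun s x => p (x + s) * q x)
  (f' := fun s x => derive1 p (x + s) * q x) _ _ (iG B' (K' + (`|t| + 1)))).
- by move=> s; exact: ipq.
- move=> s x.
  have := is_deriveD (is_derive_cst x s 1) (is_derive_id s (1 : R)).
  rewrite add0r => dl.
  have dc := @is_derive1_comp _ p (fun s : R => x + s) s _ _ (rtest_is_derive _ hp) dl.
  apply: is_derive_eq; rewrite /GRing.scale/=; ring.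
- move=> s x hs.
  apply: (le_trans (dom _ K' B' s (rtest_measurable hp') B'0 hB' hK' x)).
  rewrite ler_wpM2l// ler_wpM2r//.
  have st : `|s| <= `|t| + 1.
    by rewrite -(subrK t s) (le_trans (ler_normD _ _))// addrC lerD2l ltW.
  have [h|h] := leP `|x| (K' + `|s|).
    by rewrite !indic_seg_norm//; lra.
  rewrite [leLHS]indicE memNset ?mulr0n; last by rewrite /= in_itv /= -ler_norml; apply/negP; rewrite -ltNge.
  by have /andP[] := indic01 (`[- (K' + (`|t| + 1)), K' + (`|t| + 1)] : set R) x.
Qed.

Lemma test_funP (psi : R -> C) : test_fun psi ->
  rtest (fun x => Re (psi x)) /\ rtest (fun x => Im (psi x)).
Proof.
move=> [a [b [K hK]]]; split; split => //; exists K => x h; by rewrite hK.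
Qed.

Lemma test_fun_cderiv (psi : R -> C) : test_fun psi -> test_fun (cderiv psi).
Proof.
move=> tp; have [t1 t2] := test_funP tp.
have [a [K hK]] := rtest_deriv t1; have [b [L hL]] := rtest_deriv t2.
have e1 : (fun x => Re (cderiv psi x)) = derive1 (fun x => Re (psi x)) by [].
have e2 : (fun x => Im (cderiv psi x)) = derive1 (fun x => Im (psi x)) by [].
rewrite /test_fun e1 e2; split; [exact: a|split; [exact: b|]].
exists (Num.max K L) => x; rewrite gt_max => /andP[h1 h2].
by apply: eqcP; [exact: hK|exact: hL].
Qed.

Lemma test_fun_meas (psi : R -> C) : test_fun psi -> cmeasurable setT psi.
Proof. by move=> /test_funP[a b]; split; exact: rtest_measurable. Qed.

Lemma test_fun_L2_mul (psi : R -> C) (g : R -> R) : test_fun psi -> continuous g ->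
  L2fun (fun x => rC (g x) * psi x).
Proof.
move=> tp cg; have mp := test_fun_meas tp.
have mg : measurable_fun setT g by exact: continuous_measurable_fun.
have m := cmeasM (cmeasrC mg) mp.
apply/L2funP; split => //.
have [t1 t2] := test_funP tp; have [K [B [K0 B0 hB hK]]] := rtest_bound t1.
have [L [A [L0 A0 hA hL]]] := rtest_bound t2.
pose M := Num.max K L.
have M0 : - M <= M.
  have : 0 <= M by rewrite le_max K0.
  lra.
have cn : {within `[- M, M], continuous (fun x => g x ^+ 2)}.
  by apply: continuous_subspaceT => x; apply: continuousM; exact: cg.
have [c _ hc] := EVT_max M0 cn.
apply: (integ_le (meas_sqnormc m) (integZ (g c ^+ 2 * (B ^+ 2 + A ^+ 2)) (integ_indic_seg M))) => x.
rewrite ger0_norm ?sqnormc_ge0// sqnormcM sqnormcrC.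
have [h|h] := leP `|x| M.
  rewrite indic_seg_norm// mulr1 ler_pM ?sqr_ge0 ?sqnormc_ge0//.
    by apply: hc; rewrite in_itv /= -ler_norml.
  rewrite /sqnormc; apply: lerD.
    by rewrite -real_normK ?num_real// ler_pXn2r ?nnegrE.
  by rewrite -(real_normK (num_real (Im _))) ler_pXn2r ?nnegrE.
move: h; rewrite gt_max => /andP[h1 h2].
rewrite /sqnormc hK// hL// !expr0n addr0 mulr0.
have /andP[i0 _] := indic01 (`[- M, M] : set R) x.
by apply: mulr_ge0 => //; rewrite mulr_ge0 ?addr_ge0 ?sqr_ge0.
Qed.

Lemma test_fun_L2 (psi : R -> C) : test_fun psi -> L2fun psi.
Proof.
move=> tp; have := test_fun_L2_mul tp (@cst_continuous R R 1).
rewrite (_ : (fun x => _) = psi)//; apply/funext => x.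
by apply: eqcP; rewrite !reimE; ring.
Qed.

Lemma integ_sqr_part (f : R -> C) : L2fun f ->
  integ (fun x => Re (f x) ^+ 2) /\ integ (fun x => Im (f x) ^+ 2).
Proof.
move=> /L2funP[[m1 m2] i]; split.
  apply: (integ_le (measurable_funX 2 m1) i) => x.
  by rewrite ger0_norm ?sqr_ge0// /sqnormc lerDl sqr_ge0.
apply: (integ_le (measurable_funX 2 m2) i) => x.
by rewrite ger0_norm ?sqr_ge0// /sqnormc lerDr sqr_ge0.
Qed.

(** The weak transport equation: the translation of [f] is differentiated through its pairing with
    [psi]. *)
Lemma C1c_shift (psi f : R -> C) : test_fun psi -> L2fun f ->
  C1c (fun t => L2inner psi (fun x => f (x - t)))
      (fun t => L2inner (cderiv psi) (fun x => f (x - t))).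
Proof.
move=> tp lf.
have aux (chi : R -> C) (t : R) : test_fun chi ->
    is_derive t 1 (fun s => Re (L2inner chi (fun x => f (x - s))))
      (Re (L2inner (cderiv chi) (fun x => f (x - t)))) /\
    is_derive t 1 (fun s => Im (L2inner chi (fun x => f (x - s))))
      (Im (L2inner (cderiv chi) (fun x => f (x - t)))).
  move=> tc; have [t1 t2] := test_funP tc.
  have [i1 i2] := integ_sqr_part lf; have /L2funP[[m1 m2] _] := lf.
  have lr (u : R -> R) : rtest u -> L2fun (fun x => rC (u x)).
    move=> hu; apply: test_fun_L2; split; first by case: hu.
    split.
      move=> n x; elim: n x => [|n IH] x; first exact: derivable_cst.
      have -> : (fun y => Im (rC (u y)))^`(n.+1) = cst 0; last exact: derivable_cst.
      apply/funext => y; rewrite derive1Sn.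
      have -> : (fun y => Im (rC (u y)))^`() = cst (0 : R).
        by apply/funext => z; rewrite derive1E /= derive_cst.
      elim: n {IH} y => [|n IH] y; first by rewrite derive1n0.
      by rewrite derive1nS (funext IH) derive1E derive_cst.
    by have [_ [K hK]] := hu; exists K => x h; rewrite hK.
  have ij (u v : R -> R) : rtest u -> measurable_fun setT v -> integ (fun x => v x ^+ 2) ->
     forall s, integ (fun x => u x * v (x - s)).
    move=> hu mv iv s.
    have lv : L2fun (fun x => rC (v x)).
      apply/L2funP; split; first exact: cmeasrC.
      by apply: integ_ext iv => x; rewrite sqnormcrC.
    have [+ _] := cinteg_JM (lr _ hu) (L2fun_shift (- s) lv).
    by apply: integ_ext => x; rewrite !reimE; ring.
  have e1 (g : R -> C) : rtest (fun x => Re (g x)) -> rtest (fun x => Im (g x)) ->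
      (fun s => Re (L2inner g (fun x => f (x - s)))) =
      (fun s => \int[mu]_x (Re (g x) * Re (f (x - s))))%R \+
      (fun s => \int[mu]_x (Im (g x) * Im (f (x - s))))%R.
    move=> g1 g2; apply/funext => s; rewrite /L2inner Re_cintegral /=.
    rewrite -(RintegralD measurableT (ij _ (fun x => Re (f x)) g1 m1 i1 s)
      (ij _ (fun x => Im (f x)) g2 m2 i2 s)).
    by apply: eq_Rintegral => x _; rewrite !reimE; ring.
  have e2 (g : R -> C) : rtest (fun x => Re (g x)) -> rtest (fun x => Im (g x)) ->
      (fun s => Im (L2inner g (fun x => f (x - s)))) =
      (fun s => \int[mu]_x (Re (g x) * Im (f (x - s))))%R \-
      (fun s => \int[mu]_x (Im (g x) * Re (f (x - s))))%R.
    move=> g1 g2; apply/funext => s; rewrite /L2inner Im_cintegral /=.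
    rewrite -(RintegralB measurableT (ij _ (fun x => Im (f x)) g1 m2 i2 s)
      (ij _ (fun x => Re (f x)) g2 m1 i1 s)).
    by apply: eq_Rintegral => x _; rewrite !reimE; ring.
  rewrite (e1 _ t1 t2) (e2 _ t1 t2).
  have [d1 d2] := test_funP (test_fun_cderiv tc).
  have /(congr1 (fun h => h t)) /= -> := e1 _ d1 d2.
  have /(congr1 (fun h => h t)) /= -> := e2 _ d1 d2.
  split; [apply: is_deriveD|apply: is_deriveB].
  - exact: (C1_shift (q := fun x => Re (f x)) t t1 m1 i1).
  - exact: (C1_shift (q := fun x => Im (f x)) t t2 m2 i2).
  - exact: (C1_shift (q := fun x => Im (f x)) t t1 m2 i2).
  - exact: (C1_shift (q := fun x => Re (f x)) t t2 m1 i1).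
move=> t; have [a b] := aux _ t tp.
(* The derivative is again a pairing with a test function, hence differentiable and therefore
   continuous. *)
have [c d] := aux _ t (test_fun_cderiv tp).
split; [exact: a|exact: b| |].
  by apply: differentiable_continuous; apply/derivable1_diffP; case: c.
by apply: differentiable_continuous; apply/derivable1_diffP; case: d.
Qed.

End TestFunctions.

(** * Approximation by step functions *)

Section Density.
Variable R : realType.
Local Notation mu := (@lebesgue_measure R).
Local Notation integ f := (mu.-integrable [set: R] (EFin \o (f : R -> R))).

Definition trunc (n : nat) (q : R -> R) (x : R) : R :=
  if (`|q x| <= n%:R) && (`|x| <= n%:R) then q x else 0.

Lemma measurable_trunc n q : measurable_fun [set: R] q ->
  measurable_fun [set: R] (trunc n q).
Proof.
move=> mq; apply: measurable_fun_ifT => //.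
by apply: measurable_and; apply: measurable_fun_ler => //; exact: measurableT_comp.
Qed.

Lemma truncation_approx (q : R -> R) (e : R) : 0 < e ->
  measurable_fun setT q -> integ (fun x => q x ^+ 2) ->
  exists n : nat, (\int[mu]_x (q x - trunc n q x) ^+ 2)%R < e.
Proof.
move=> e0 mq iq.
pose F n x := (q x - trunc n q x) ^+ 2.
have mF n : measurable_fun [set: R] (F n).
  apply: measurable_funX; apply: measurable_funB => //; exact: measurable_trunc.
have hF n x : `|F n x| <= q x ^+ 2.
  rewrite /F ger0_norm ?sqr_ge0// /trunc.
  by case: ifP => _; rewrite ?subrr ?subr0// expr0n sqr_ge0.
have cF x : (fun n => F n x) @ \oo --> (0 : R).
  apply: cvg_near_cst; near=> n; rewrite /F /trunc.
  have -> : `|q x| <= n%:R by near: n; exact: nbhs_infty_ger.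
  have -> : `|x| <= n%:R by near: n; exact: nbhs_infty_ger.
  by rewrite /= subrr expr0n.
have h := cvg_Rintegral0 mF iq hF cF.
have [n _ hn] := cvgr_lt (0 : R) h _ e0.
by exists n; exact: (hn n (leqnn n)).
Unshelve. all: by end_near. Qed.

Definition clip (n : R) (y : R) := Num.max (- n) (Num.min n y).

(** Clipping is the projection onto [[-n, n]], hence it brings any [y] closer to every point of that
    segment. *)
Lemma clip_dist (n y z : R) : `|z| <= n -> `|z - clip n y| <= `|z - y|.
Proof.
rewrite ler_norml => /andP[z1 z2].
have ab (u : R) : u <= `|u| /\ - u <= `|u| by rewrite ler_norm -normrN ler_norm.
have [a1 a2] := ab (z - y); rewrite ler_norml /clip.
by have [h|h] := leP n y; have [h'|h'] := leP (- n) _; apply/andP; split; lra.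
Qed.

Lemma clip_bound (n y : R) : 0 <= n -> `|clip n y| <= n.
Proof.
move=> n0; rewrite /clip ler_norml le_max lexx /= ge_max ge_min lexx /=; lra.
Qed.

(** Approximation in mean is upgraded to mean square: after truncation both functions are bounded by
    [n], so the squared difference is at most [2 n] times the difference. *)
Lemma continuous_approx (q : R -> R) (e : R) : 0 < e ->
  measurable_fun setT q -> integ (fun x => q x ^+ 2) ->
  exists g : R -> R, [/\ continuous g, (exists K : R, forall x, K < `|x| -> g x = 0),
   integ (fun x => (q x - g x) ^+ 2) & (\int[mu]_x (q x - g x) ^+ 2)%R < e].
Proof.
move=> e0 mq iq.
have e4 : 0 < e / 4 by rewrite divr_gt0.
have [n hn] := truncation_approx e4 mq iq.
pose r := trunc n q.
have mr : measurable_fun [set: R] r by exact: measurable_trunc.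
have n0 : 0 <= n%:R :> R by exact: ler0n.
have rn x : `|r x| <= n%:R by rewrite /r /trunc; case: ifP => [/andP[]//|_]; rewrite normr0.
pose L : R := n%:R + 1.
pose E : set R := `[- L, L].
have mE : measurable E by exact: measurable_itv.
have mE' : measurable (E : set (measurableTypeR R)) by exact: measurable_itv.
have Efin : (mu E < +oo)%E.
  by rewrite /E lebesgue_measure_itv /=; case: ifP => _; rewrite -?EFinB ltry.
have ri : mu.-integrable E (EFin \o r).
  apply: measurable_bounded_integrable => //; first exact: measurable_funTS.
  exists n%:R; split; first exact: num_real.
  by move=> y ny x _; apply: (le_trans (rn x)); exact: ltW.
have [g_ [cg ig hg]] := approximation_continuous_integrable mE Efin ri.
(* Chosen so that [2 n d <= e / 4]; the [+ 1] covers [n = 0]. *)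
pose d : R := e / (8 * (n%:R + 1)).
have d0 : 0 < d by rewrite divr_gt0//; lra.
have /fine_cvgP[_ hg'] := hg.
have [N _ hN] := cvgr_lt (0 : R) hg' d d0.
pose h := g_ N; have ch : continuous h by exact: cg.
have {}hN : (\int[mu]_(z in E) `|r z - h z| < d)%R := hN N (leqnn N).
(* A plateau function, equal to 1 on [[-n, n]], where the truncated function may be nonzero, and to
   0 outside [[-(n + 1), n + 1]]. Neither this cutoff nor the clipping increases the distance to the
   truncated function. *)
pose theta (x : R) : R := Num.max 0 (Num.min 1 (L - `|x|)).
have cmm (u v : R -> R) : continuous u -> continuous v ->
   continuous (fun x => Num.max (u x) (v x)) /\ continuous (fun x => Num.min (u x) (v x)).
  by move=> cu cv; split => x; [apply: continuous_max|apply: continuous_min]; [exact: cu|exact: cv|exact: cu|exact: cv].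
have ccst (c : R) : continuous (fun _ : R => c) by move=> x; exact: cvg_cst.
have cth : continuous theta.
  apply: (proj1 (cmm _ _ (ccst 0) _)); apply: (proj2 (cmm _ _ (ccst 1) _)).
  by move=> x; apply: cvgB; [exact: cvg_cst|exact: norm_continuous].
have ccl : continuous (fun x => clip n%:R (h x)).
  by apply: (proj1 (cmm _ _ (ccst _) _)); apply: (proj2 (cmm _ _ (ccst _) _)).
pose g x := theta x * clip n%:R (h x).
have cgg : continuous g by move=> x; apply: cvgM; [exact: cth|exact: ccl].
have th01 x : 0 <= theta x <= 1 by rewrite /theta le_max lexx /= ge_max ler01 ge_min lexx.
have gsupp x : L < `|x| -> g x = 0.
  move=> Lx; rewrite /g (_ : theta x = 0) ?mul0r//.
  by rewrite /theta; apply/max_idPl; rewrite ge_min subr_le0 (ltW Lx) orbT.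
have gclose x : E x -> `|r x - g x| <= `|r x - h x|.
  move=> _; apply: le_trans (clip_dist (h x) (rn x)).
  have [xn|xn] := leP `|x| n%:R.
    rewrite /g (_ : theta x = 1) ?mul1r// /theta /L.
    by rewrite min_l ?max_r//; lra.
  have -> : r x = 0 by rewrite /r /trunc [`|x| <= _]leNgt xn andbF.
  by rewrite !sub0r !normrN /g normrM ler_piMl// ger0_norm; have /andP[] := th01 x.
have gn x : `|g x| <= n%:R.
  rewrite /g normrM -[leRHS]mul1r ler_pM//; last exact: clip_bound.
  by rewrite ger0_norm; have /andP[] := th01 x.
have mg : measurable_fun [set: R] g by exact: continuous_measurable_fun.
have rE x : ~ E x -> r x = 0.
  move=> Ex; rewrite /r /trunc; case: ifP => // /andP[_ xn]; exfalso; apply: Ex.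
  by rewrite /E /= in_itv /= -ler_norml /L; lra.
have gE x : ~ E x -> g x = 0.
  by move=> Ex; apply: gsupp; rewrite ltNge; apply/negP => xL; apply: Ex; rewrite /E /= in_itv /= -ler_norml.
have mrg : measurable_fun [set: R] (fun x => (r x - g x) ^+ 2).
  by apply: measurable_funX; exact: measurable_funB.
have irg : integ (fun x => (r x - g x) ^+ 2).
  apply: (integ_le mrg (integZ ((2 * n%:R) ^+ 2) (integ_indic_seg L))) => x.
  rewrite ger0_norm ?sqr_ge0//.
  have [Ex|Ex] := pselect (E x).
    rewrite indicE mem_set// mulr1.
    by have := rn x; have := gn x; rewrite !ler_norml => /andP[? ?] /andP[? ?]; nra.
  by rewrite rE// gE// subr0 expr0n mulr_ge0 ?sqr_ge0//; have /andP[] := indic01 (`[- L, L] : set R) x.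
have irg2 : (\int[mu]_x (r x - g x) ^+ 2)%R <= e / 4.
  have -> : (\int[mu]_x (r x - g x) ^+ 2 = \int[mu]_(x in E) (r x - g x) ^+ 2)%R.
    rewrite [RHS]Rintegral_mkcond; apply: eq_Rintegral => x _; rewrite patchE.
    case: ifPn => // /negP Ex; rewrite rE ?gE ?subr0 ?expr0n//.
      by move=> Ex'; apply: Ex; rewrite inE.
    by move=> Ex'; apply: Ex; rewrite inE.
  have iE : mu.-integrable E (EFin \o (fun x => `|r x - h x|)).
    have ib : mu.-integrable E (EFin \o (fun x => r x - h x)).
      by have := integrableB mE' ri (ig N).
    exact: (integrable_norm ib).
  apply: (@le_trans _ _ (2 * n%:R * \int[mu]_(z in E) `|r z - h z|)%R).
    rewrite -RintegralZl//; apply: le_Rintegral => //.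
    - by apply: integrableS irg.
    - by have := integrableZl mE' (2 * n%:R) iE.
    - move=> x Ex; rewrite -real_normK ?num_real// expr2.
      apply: ler_pM => //; last exact: gclose.
      by apply: (le_trans (ler_normB _ _)); have := rn x; have := gn x; lra.
  apply: (@le_trans _ _ (2 * n%:R * d)); first by rewrite ler_wpM2l ?mulr_ge0// ltW.
  rewrite /d; have -> : e / 4 = 2 * (n%:R + 1) * (e / (8 * (n%:R + 1))).
    by field; rewrite gt_eqF//; lra.
  by rewrite ler_wpM2r ?(ltW d0)//; lra.
have mqr : measurable_fun [set: R] (fun x => (q x - r x) ^+ 2).
  by apply: measurable_funX; exact: measurable_funB.
have iqr : integ (fun x => (q x - r x) ^+ 2).
  apply: (integ_le mqr iq) => x; rewrite ger0_norm ?sqr_ge0// /r /trunc.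
  by case: ifP => _; rewrite ?subrr ?subr0 ?expr0n ?sqr_ge0.
have key x : (q x - g x) ^+ 2 <= 2 * (q x - r x) ^+ 2 + 2 * (r x - g x) ^+ 2.
  by have := sqr_ge0 (q x - r x - (r x - g x)); nra.
have iqg : integ (fun x => (q x - g x) ^+ 2).
  apply: (integ_le _ (integD (integZ 2 iqr) (integZ 2 irg))).
    by apply: measurable_funX; exact: measurable_funB.
  by move=> x; rewrite ger0_norm ?sqr_ge0.
exists g; split => //; first by exists L.
apply: (@le_lt_trans _ _ (2 * (\int[mu]_x (q x - r x) ^+ 2) + 2 * (\int[mu]_x (r x - g x) ^+ 2))%R).
  rewrite -!RintegralZl// -RintegralD//; [|exact: integZ|exact: integZ].
  apply: le_Rintegral => //; exact: (integD (integZ 2 iqr) (integZ 2 irg)).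
by move: hn irg2; rewrite -/r; lra.
Qed.

End Density.

(** * Continuity of translations in mean square, and dyadic step functions *)

Section Approximation.
Variable R : realType.
Local Notation mu := (@lebesgue_measure R).
Local Notation C := R[i].
Local Notation Re := complex.Re.
Local Notation Im := complex.Im.
Local Notation integ f := (mu.-integrable [set: R] (EFin \o (f : R -> R))).

Definition ccontinuous (g : R -> C) :=
  continuous (fun x => Re (g x)) /\ continuous (fun x => Im (g x)).

Lemma ccontinuous_meas g : ccontinuous g -> cmeasurable setT g.
Proof. by move=> [a b]; split; exact: continuous_measurable_fun. Qed.

Lemma ccontinuous_sqnormc g : ccontinuous g -> continuous (fun x => sqnormc (g x)).
Proof.
move=> [a b] x; apply: cvgD; rewrite expr2.
  by under eq_fun do rewrite expr2; apply: cvgM; exact: a.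
by under eq_fun do rewrite expr2; apply: cvgM; exact: b.
Qed.

Lemma ccontinuousB (f g : R -> C) : ccontinuous f -> ccontinuous g ->
  ccontinuous (fun x => f x - g x).
Proof.
move=> [a b] [c d]; split.
  rewrite (_ : (fun x => _) = (fun x => Re (f x) - Re (g x))); last first.
    by apply/funext => x; rewrite !reimE.
  by move=> x; apply: cvgB; [exact: a|exact: c].
rewrite (_ : (fun x => _) = (fun x => Im (f x) - Im (g x))); last first.
  by apply/funext => x; rewrite !reimE.
by move=> x; apply: cvgB; [exact: b|exact: d].
Qed.

Lemma ccontinuous_cst (c : C) : ccontinuous (fun _ => c).
Proof. by split => x; exact: cvg_cst. Qed.

Lemma ccontinuous_comp (f : R -> C) (h : R -> R) : ccontinuous f -> continuous h ->
  ccontinuous (fun x => f (h x)).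
Proof.
move=> [a b] ch; split => x.
  exact: (@continuous_comp _ _ _ h (fun y => Re (f y)) x (ch x) (a (h x))).
exact: (@continuous_comp _ _ _ h (fun y => Im (f y)) x (ch x) (b (h x))).
Qed.

Lemma ccontinuous_bound (g : R -> C) (K : R) : ccontinuous g ->
  (forall x, K < `|x| -> g x = 0) -> exists2 B, 0 <= B & forall x, sqnormc (g x) <= B.
Proof.
move=> cg hK.
have K0 : - (Num.max K 0) <= Num.max K 0.
  have : 0 <= Num.max K 0 by rewrite le_max lexx orbT.
  lra.
have cn : {within `[- (Num.max K 0), Num.max K 0], continuous (fun x => sqnormc (g x))}.
  by apply: continuous_subspaceT; exact: ccontinuous_sqnormc.
have [c _ hc] := EVT_max K0 cn.
exists (sqnormc (g c)) => [|x]; first exact: sqnormc_ge0.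
have [h|h] := leP `|x| (Num.max K 0).
  by apply: hc; rewrite in_itv /= -ler_norml.
rewrite hK ?sqnormc0 ?sqnormc_ge0//; apply: le_lt_trans h.
by rewrite le_max lexx.
Qed.

Lemma L2_approx_continuous (f : R -> C) (e : R) : 0 < e -> L2fun f ->
  exists g : R -> C, [/\ ccontinuous g, (exists K : R, forall x, K < `|x| -> g x = 0),
    integ (fun x => sqnormc (f x - g x)) & (\int[mu]_x sqnormc (f x - g x))%R < e].
Proof.
move=> e0 lf; have e2 : 0 < e / 2 by rewrite divr_gt0.
have [i1 i2] := integ_sqr_part lf; have /L2funP[[m1 m2] _] := lf.
have [g1 [c1 [K1 h1] j1 l1]] := continuous_approx e2 m1 i1.
have [g2 [c2 [K2 h2] j2 l2]] := continuous_approx e2 m2 i2.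
have E x : sqnormc (f x - Complex (g1 x) (g2 x)) =
    (Re (f x) - g1 x) ^+ 2 + (Im (f x) - g2 x) ^+ 2 by rewrite /sqnormc !reimE.
exists (fun x => Complex (g1 x) (g2 x)); split => //.
- exists (Num.max K1 K2) => x; rewrite gt_max => /andP[a b].
  by rewrite h1// h2.
- by apply: integ_ext (integD j1 j2) => x; rewrite E.
- under eq_Rintegral do rewrite E.
  rewrite RintegralD//; lra.
Qed.

Lemma sqnormcD2_le (z w : C) : sqnormc (z + w) <= 2 * sqnormc z + 2 * sqnormc w.
Proof. by have := sqnormcD_le z w (@ltr01 R); rewrite invr1. Qed.

(** For a continuous, compactly supported function this is dominated convergence; the general case
    follows since the approximation error is the same before and after translation. *)
Lemma shift_continuous (f : R -> C) (e : R) : 0 < e -> L2fun f ->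
  exists2 d : R, 0 < d & forall h, `|h| < d ->
    (\int[mu]_x sqnormc (f (x + h) - f x))%R < e.
Proof.
(* Three error terms, each entering with the factor 4, add up to less than [12 e / 16]. *)
move=> e0 lf; have e16 : 0 < e / 16 by rewrite divr_gt0.
have [g [cg [K hK] ig lg]] := L2_approx_continuous e16 lf.
have [B B0 hB] := ccontinuous_bound cg hK.
have mg := ccontinuous_meas cg; have /L2funP[mf _] := lf.
pose F (h x : R) := sqnormc (g (x + h) - g x).
have mF h : measurable_fun [set: R] (F h).
  by apply: meas_sqnormc; apply: cmeasB => //; exact: cmeas_comp (measurable_shift h) mg.
have F0 h x : 0 <= F h x by exact: sqnormc_ge0.
have hF h x : `|h - 0| < 1 -> `|F h x| <= 4 * B * \1_(`[- (K + 1), K + 1] : set R) x.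
  rewrite subr0 => h1; rewrite ger0_norm//.
  have [xK|xK] := leP `|x| (K + 1).
    rewrite indic_seg_norm// mulr1 (le_trans (sqnormcD2_le _ _))// sqnormcN.
    by have := hB (x + h); have := hB x; lra.
  rewrite /F !hK ?subrr ?sqnormc0; first by have /andP[] := indic01 (`[- (K + 1), K + 1] : set R) x; move=> *; rewrite !mulr_ge0.
    lra.
  have : `|x| <= `|x + h| + `|h| by rewrite -{1}(addrK h x) (le_trans (ler_normB _ _)).
  lra.
have iF h : integ (F h).
  apply: (integ_le (mF h) (integZ (4 * B) (integD (integ_indic_seg K) (integ_indic_seg (K + `|h|))))) => x.
  rewrite ger0_norm//.
  have /andP[p0 p1] := indic01 (`[- K, K] : set R) x.
  have /andP[q0 q1] := indic01 (`[- (K + `|h|), (K + `|h|)] : set R) x.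
  have [xK|xK] := leP `|x| (K + `|h|).
    rewrite (indic_seg_norm xK) (@le_trans _ _ (4 * B))//.
      by rewrite (le_trans (sqnormcD2_le _ _))// sqnormcN; have := hB (x + h); have := hB x; lra.
    by rewrite ler_peMr ?mulr_ge0//; lra.
  rewrite /F !hK ?subrr ?sqnormc0; first by rewrite !mulr_ge0// addr_ge0.
    by have := normr_ge0 h; lra.
  have : `|x| <= `|x + h| + `|h| by rewrite -{1}(addrK h x) (le_trans (ler_normB _ _)).
  lra.
have cF x : continuous (F ^~ x).
  have cc : ccontinuous (fun h => g (x + h) - g x).
    apply: ccontinuousB; last exact: ccontinuous_cst.
    apply: (ccontinuous_comp cg) => h; apply: cvgD; [exact: cvg_cst|exact: cvg_id].
  exact: (ccontinuous_sqnormc cc).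
have I0 : (\int[mu]_x F 0 x)%R = 0.
  under eq_Rintegral do rewrite /F addr0 subrr sqnormc0.
  by rewrite Rintegral_cst// mul0r.
have : (\int[mu]_x F h x)%R @[h --> (0 : R)] --> (0 : R).
  rewrite -[X in _ --> X]I0; exact: (continuous_under_integral_dom iF cF
    (integZ (4 * B) (integ_indic_seg (K + 1))) hF).
move=> /cvgr_lt /(_ _ e16) /nbhs_ballP[d d0 hd].
exists d => // h hh.
have hd' : (\int[mu]_x F h x)%R < e / 16.
  by apply: hd; rewrite /ball /= sub0r normrN.
have mfg : measurable_fun [set: R] (fun x => sqnormc (f x - g x)).
  by apply: meas_sqnormc; exact: cmeasB.
have ig' := integrableT_shift h mfg ig.
have eg' := RintegralT_shift h mfg ig.
have i3 := integD (integZ 4 ig') (integD (integZ 4 (iF h)) (integZ 4 ig)).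
have key x : sqnormc (f (x + h) - f x) <= 4 * sqnormc (f (x + h) - g (x + h)) +
    (4 * F h x + 4 * sqnormc (f x - g x)).
  have -> : f (x + h) - f x = (f (x + h) - g (x + h)) +
    ((g (x + h) - g x) + - (f x - g x)) by ring.
  have := sqnormcD2_le (f (x + h) - g (x + h)) ((g (x + h) - g x) + - (f x - g x)).
  have := sqnormcD2_le (g (x + h) - g x) (- (f x - g x)).
  rewrite sqnormcN; have := sqnormc_ge0 (f (x + h) - g (x + h)); rewrite /F; lra.
have mff : measurable_fun [set: R] (fun x => sqnormc (f (x + h) - f x)).
  by apply: meas_sqnormc; apply: cmeasB => //; exact: cmeas_comp (measurable_shift h) mf.
apply: (@le_lt_trans _ _ (\int[mu]_x (4 * sqnormc (f (x + h) - g (x + h)) +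
    (4 * F h x + 4 * sqnormc (f x - g x))))%R).
  apply: le_Rintegral => //; apply: (integ_le mff i3) => x.
  by rewrite ger0_norm ?sqnormc_ge0.
rewrite RintegralD//; [|exact: integZ|by apply: integD; exact: integZ].
rewrite RintegralD//; [|exact: integZ|exact: integZ].
rewrite !RintegralZl//; lra.
Qed.

Definition cell (s p x : R) : bool := (p <= x) && (x < p + s).

Definition stepf (s : R) (l : seq (C * R)) (x : R) : C :=
  \sum_(ap <- l) (if cell s ap.2 x then ap.1 else 0).

(** Left endpoints at distance at least [s] mean that the half-open cells [[p, p + s)] are pairwise
    disjoint; in this form the condition is visibly invariant under translation. *)
Definition separated_cells (s : R) (l : seq (C * R)) : bool :=
  pairwise (fun ap bq : C * R => s <= `|ap.2 - bq.2|) l.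

Lemma cell_floor (s x : R) (m : int) : 0 < s ->
  cell s (m%:~R * s) x = (Num.floor (x / s) == m).
Proof.
move=> s0; rewrite floor_eq /cell ler_pdivlMr// ltr_pdivrMr// intrD mulrDl.
by rewrite mul1r.
Qed.

(** The value of [g] at the left endpoint of the grid cell containing [x]. *)
Definition sample (s : R) (g : R -> C) (x : R) : C := g ((Num.floor (x / s))%:~R * s).

Lemma sample_dist (s x : R) : 0 < s -> `|(Num.floor (x / s))%:~R * s - x| <= s.
Proof.
move=> s0; have /andP[a b] := floor_itv (x / s).
have a' : (Num.floor (x / s))%:~R * s <= x by rewrite -ler_pdivlMr.
have b' : x < (Num.floor (x / s))%:~R * s + s.
  by move: b; rewrite intrD ltr_pdivrMr// mulrDl mul1r.
by rewrite ler_norml; apply/andP; split; lra.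
Qed.

Definition grid (s : R) (N : nat) (g : R -> C) : seq (C * R) :=
  [seq (g ((j%:Z - N%:Z)%:~R * s), (j%:Z - N%:Z)%:~R * s) | j <- iota 0 (2 * N)].

Lemma separated_grid s N g : 0 < s -> separated_cells s (grid s N g).
Proof.
move=> s0; rewrite /separated_cells /grid pairwise_map.
apply/(pairwiseP 0%N) => i j; rewrite !inE size_iota => hi hj ij /=.
rewrite !nth_iota// !add0n -mulrBl normrM (gtr0_norm s0) ler_peMl ?(ltW s0)//.
rewrite -intrB -intr_norm -[1]/(1%:~R) ler_int; lia.
Qed.

Lemma stepf_grid (s K : R) (N : nat) (g : R -> C) x : 0 < s -> K < N%:R * s ->
  (forall x, K < `|x| -> g x = 0) -> stepf s (grid s N g) x = sample s g x.
Proof.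
move=> s0 KN hK; rewrite /stepf /grid big_map /sample.
set m := Num.floor (x / s).
have E j : (if cell s ((j%:Z - N%:Z)%:~R * s) x then g ((j%:Z - N%:Z)%:~R * s) else 0) =
    if m == j%:Z - N%:Z then g (m%:~R * s) else 0.
  by rewrite cell_floor//; case: eqP => // <-.
rewrite (eq_bigr _ (fun j _ => E j)).
have [h|h] := boolP ((- N%:Z <= m) && (m < N%:Z)).
  have [j jE] : exists j : nat, m = j%:Z - N%:Z by exists (absz (m + N%:Z)); lia.
  rewrite (bigD1_seq j) ?iota_uniq//=; last by rewrite mem_iota; lia.
  rewrite jE eqxx big1 ?addr0// => i ij; case: eqP => // /eqP; lia.
rewrite big_seq big1; last first.
  move=> j; rewrite mem_iota => hj; case: eqP => // mj; exfalso; lia.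
rewrite hK// normrM (gtr0_norm s0); apply: (lt_le_trans KN).
by rewrite ler_pM2r// -intr_norm -[N%:R]/(N%:Z%:~R) ler_int; lia.
Qed.

(** The threshold [k0] is followed by all finer grids, so that two functions can later be
    approximated with the same cell width. *)
Lemma stepf_approx (f : R -> C) (e : R) : 0 < e -> L2fun f ->
  exists k0 : nat, forall k, (k0 <= k)%N -> exists l : seq (C * R),
    [/\ separated_cells ((2 ^+ k)^-1) l, L2fun (stepf ((2 ^+ k)^-1) l) &
     (\int[mu]_x sqnormc (f x - stepf ((2 ^+ k)^-1) l x))%R < e].
Proof.
move=> e0 lf; have e4 : 0 < e / 4 by rewrite divr_gt0.
have [g [cg [K hK] ig lg]] := L2_approx_continuous e4 lf.
have [B B0 hB] := ccontinuous_bound cg hK.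
have mg := ccontinuous_meas cg; have /L2funP[mf _] := lf.
pose s (k : nat) : R := (2 ^+ k)^-1.
have s0 k : 0 < s k by rewrite invr_gt0 exprn_gt0.
have s1 k : s k <= 1 by rewrite invf_le1 ?exprn_gt0// exprn_ege1// ler1n.
have ms k : cmeasurable setT (sample (s k) g).
  apply: cmeas_comp mg; apply: measurable_funM; last exact: measurable_cst.
  have mfl : measurable_fun [set: R] (fun x : R => (Num.floor x)%:~R : R).
    apply: nondecreasing_measurable => // x y xy.
    by rewrite ler_int; exact: le_floor.
  by apply: (measurableT_comp mfl); exact: measurable_funM.
have hF k x : sqnormc (g x - sample (s k) g x) <= 4 * B * \1_(`[- (K + 1), K + 1] : set R) x.
  have [xK|xK] := leP `|x| (K + 1).
    rewrite indic_seg_norm// mulr1 (le_trans (sqnormcD2_le _ _))// sqnormcN /sample.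
    by have := hB x; have := hB ((Num.floor (x / s k))%:~R * s k); lra.
  rewrite /sample !hK ?subrr ?sqnormc0; first by have /andP[] := indic01 (`[- (K + 1), K + 1] : set R) x; move=> *; rewrite !mulr_ge0.
    have := sample_dist x (s0 k); have := s1 k.
    set y := _ * s k => a b.
    have : `|x| <= `|y| + `|y - x|.
      by have := ler_normB y (y - x); rewrite (_ : y - (y - x) = x)//; ring.
    lra.
  lra.
have mF k : measurable_fun [set: R] (fun x => sqnormc (g x - sample (s k) g x)).
  by apply: meas_sqnormc; exact: cmeasB.
have hF' k x : `|sqnormc (g x - sample (s k) g x)| <= 4 * B * \1_(`[- (K + 1), K + 1] : set R) x.
  by rewrite ger0_norm ?sqnormc_ge0.
have iB := integZ (4 * B) (integ_indic_seg (K + 1)).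
have cs : s k @[k --> \oo] --> (0 : R).
  have h2 : `|2^-1 : R| < 1 by rewrite ger0_norm ?invr_ge0// invf_lt1// ltr1n.
  have := cvg_expr h2; apply: cvg_trans; apply: near_eq_cvg.
  by apply: nearW => k; rewrite /s exprVn.
have cF x : sqnormc (g x - sample (s k) g x) @[k --> \oo] --> (0 : R).
  have cy : (Num.floor (x / s k))%:~R * s k @[k --> \oo] --> x.
    apply/cvgrPdist_le => d d0.
    have [k1 _ hk1] := cvgr_lt (0 : R) cs d d0.
    exists k1 => // k kk1 /=.
    by rewrite distrC (le_trans (sample_dist x (s0 k)))// ltW//; exact: hk1.
  have cc : ccontinuous (fun y => g x - g y).
    by apply: ccontinuousB => //; exact: ccontinuous_cst.
  have hq : sqnormc (g x - g y) @[y --> x] --> sqnormc (g x - g x).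
    exact: (ccontinuous_sqnormc cc).
  by have := cvg_comp _ _ cy hq; rewrite subrr sqnormc0.
have h := cvg_Rintegral0 mF iB hF' cF.
have [k0 _ hk0] := cvgr_lt (0 : R) h _ e4.
have [N0 hN0] : exists N : nat, K < N%:R.
  exists (Num.bound `|K|); exact: le_lt_trans (ler_norm K) (archi_boundP (normr_ge0 K)).
exists k0 => k kk0; have {hk0}hk := hk0 k kk0.
(* This number of cells of width [2^-k] on each side covers [[-N0, N0)], which contains the support
   of [g]. *)
pose l := grid (s k) (N0 * 2 ^ k) g.
have lE : stepf (s k) l = sample (s k) g.
  apply/funext => x; apply: (stepf_grid (K := K)) => //.
  by rewrite natrM natrX /s mulfK// gt_eqF// exprn_gt0.
have iS : integ (fun x => sqnormc (g x - sample (s k) g x)) by exact: (integ_le (mF k) iB).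
have iT : integ (fun x => sqnormc (f x - sample (s k) g x)).
  apply: (integ_le _ (integD (integZ 2 ig) (integZ 2 iS))) => [|x].
    by apply: meas_sqnormc; exact: cmeasB.
  rewrite ger0_norm ?sqnormc_ge0// -[f x](subrK (g x)) -addrA.
  by have := sqnormcD2_le (f x - g x) (g x - sample (s k) g x); rewrite addrK.
exists l; rewrite -/(s k) lE; split.
- exact: separated_grid.
- apply/L2funP; split => //.
  have /L2funP[_ fi] := lf.
  apply: (integ_le _ (integD (integZ 2 iT) (integZ 2 fi))) => [|x].
    exact: meas_sqnormc.
  rewrite ger0_norm ?sqnormc_ge0//.
  have := sqnormcD2_le (- (f x - sample (s k) g x)) (f x).
  by rewrite sqnormcN opprB subrK.
- apply: (@le_lt_trans _ _ (\int[mu]_x (2 * sqnormc (f x - g x) +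
     2 * sqnormc (g x - sample (s k) g x)))%R).
    apply: le_Rintegral => //; first by apply: integD; exact: integZ.
    move=> x _; have := sqnormcD2_le (f x - g x) (g x - sample (s k) g x).
    by rewrite addrA subrK.
  rewrite RintegralD//; [|exact: integZ|exact: integZ].
  by rewrite !RintegralZl//; lra.
Qed.

End Approximation.

(** * Pulses *)

Section Pulses.
Variable R : realType.
Local Notation mu := (@lebesgue_measure R).
Local Notation C := R[i].
Local Notation Re := complex.Re.
Local Notation Im := complex.Im.
Local Notation integ f := (mu.-integrable [set: R] (EFin \o (f : R -> R))).

(* [Mult b w al be] generates [(al x + be) S], [Shift b w ga] generates
   [- i ga d/dx S], where [S] flips ion [b] with phase [w] *)
Inductive pulse := Mult of bool & C & R & R | Shift of bool & C & R.

Definition unimodular (p : pulse) : Prop :=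
  match p with Mult _ w _ _ => sqnormc w = 1 | Shift _ w _ => sqnormc w = 1 end.

(** The multiplication pulse rotates pointwise by the angle accumulated at [x]. For the translation
    pulse, the eigenprojections [(1 + S) / 2] and [(1 - S) / 2] of the state travel to the right and
    to the left at speed [ga]; the formula expands their sum. *)
Definition evolve (p : pulse) (t : R) (phi : state R) : state R :=
  match p with
  | Mult b w al be => fun k x => rotv b w (t * (al * x + be)) (phi ^~ x) k
  | Shift b w ga => fun k x =>
      rC 2^-1 * (phi k (x - ga * t) + phi k (x + ga * t)) +
      rC 2^-1 * phase b w k * (phi (flip b k) (x - ga * t) - phi (flip b k) (x + ga * t))
  end.

Definition ctl3 (b : bool) (c cr cb : C) (k : 'I_6) : C :=
  nth 0 (if b then [:: 0; 0; 0; c; cr; cb] else [:: c; cr; cb; 0; 0; 0]) k.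

Local Notation r2 := ((Num.sqrt (2 : R))^-1).

(** From [a + a^dagger = sqrt 2 x] and [a^dagger - a = - sqrt 2 d/dx]: equal sideband amplitudes
    produce [al x], opposite ones produce [- i ga d/dx], and [1 / sqrt 2] is the normalisation. *)
Definition control (p : pulse) : 'I_6 -> C :=
  match p with
  | Mult b w al be => ctl3 b (rC be * w) (rC (al * r2) * w) (rC (al * r2) * w)
  | Shift b w ga => ctl3 b 0 (iC R * rC (ga * r2) * w) (- (iC R * rC (ga * r2) * w))
  end.

Definition pulse_ham (p : pulse) (psi : state R) : state R :=
  match p with
  | Mult b w al be => fun k x => phase b w k * (rC (al * x + be) * psi (flip b k) x)
  | Shift b w ga => fun k x => phase b w k * (- iC R * rC ga * cderiv (psi (flip b k)) x)
  end.

Lemma r2_sqr : r2 * r2 = 2^-1.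
Proof. by rewrite -invfM -expr2 sqr_sqrtr. Qed.

Lemma rCD (x y : R) : rC (x + y) = rC x + rC y.
Proof. by apply: eqcP; rewrite !reimE ?addr0. Qed.
Lemma rCM (x y : R) : rC (x * y) = rC x * rC y.
Proof. by apply: eqcP; rewrite !reimE; ring. Qed.
Lemma rCN (x : R) : rC (- x) = - rC x.
Proof. by apply: eqcP; rewrite !reimE ?oppr0. Qed.
Lemma rC1 : rC (1 : R) = 1. Proof. by []. Qed.
Lemma rC0 : rC (0 : R) = 0. Proof. by []. Qed.
Lemma rC2 : rC (2 : R) = 2.
Proof. by rewrite (_ : (2 : R) = 1 + 1)// rCD. Qed.
Lemma conjcrC (x : R) : conjc (rC x) = rC x.
Proof. by apply: eqcP; rewrite !reimE ?oppr0. Qed.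
Lemma conjcM (z w : C) : conjc (z * w) = conjc z * conjc w.
Proof. by apply: eqcP; rewrite !reimE; ring. Qed.
Lemma conjcN (z : C) : conjc (- z) = - conjc z.
Proof. by apply: eqcP; rewrite !reimE. Qed.
Lemma conjciC : conjc (iC R) = - iC R.
Proof. by apply: eqcP; rewrite !reimE ?oppr0. Qed.
Lemma iC_sqr : iC R * iC R = -1.
Proof. by apply: eqcP; rewrite !reimE; ring. Qed.

Lemma opA0 (f : R -> C) x : opA 0 0 0 f x = 0.
Proof. by rewrite /opA !mul0r !addr0. Qed.
Lemma opAd0 (f : R -> C) x : opAd 0 0 0 f x = 0.
Proof. by rewrite /opAd !conjc0 !mul0r !addr0. Qed.

Lemma hamiltonian_ctl3 b c cr cb t (psi : state R) k x :
  hamiltonian (fun j _ => ctl3 b c cr cb j) t psi k x =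
  (if excited b k then opAd c cr cb (psi (flip b k)) x
   else opA c cr cb (psi (flip b k)) x).
Proof.
by elim/I4_ind: k; case: b; rewrite /hamiltonian /= ?(opA0, opAd0, addr0, add0r).
Qed.

Lemma hamiltonian_control p t (psi : state R) :
  hamiltonian (fun j _ => control p j) t psi = pulse_ham p psi.
Proof.
apply/funext => k; apply/funext => x; case: p => [b w al be|b w ga] /=.
  rewrite hamiltonian_ctl3 /phase /opA /opAd /ann /cre.
  set f := psi (flip b k) x; set f' := cderiv _ x.
  have h : rC r2 * rC r2 * 2 = 1 :> C.
    by rewrite -rC2 -!rCM r2_sqr mulVf ?rC1// pnatr_eq0.
  case: (excited b k); rewrite ?conjcM ?conjcrC rCD !rCM.
    transitivity (conjc w * (rC be * f + (rC r2 * rC r2 * 2) * rC al * rC x * f));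
      first by ring.
    by rewrite h; ring.
  transitivity (w * (rC be * f + (rC r2 * rC r2 * 2) * rC al * rC x * f));
    first by ring.
  by rewrite h; ring.
rewrite hamiltonian_ctl3 /phase /opA /opAd /ann /cre.
set f := psi (flip b k) x; set f' := cderiv _ x.
have h : rC r2 * rC r2 * 2 = 1 :> C.
  by rewrite -rC2 -!rCM r2_sqr mulVf ?rC1// pnatr_eq0.
case: (excited b k); rewrite ?(conjcN, conjcM, conjcrC, conjciC, conjc0) !rCM ?rC0.
  transitivity (conjc w * (- iC R * rC ga * (rC r2 * rC r2 * 2) * f')); first by ring.
  by rewrite h; ring.
transitivity (w * (- iC R * rC ga * (rC r2 * rC r2 * 2) * f')); first by ring.
by rewrite h; ring.
Qed.

Lemma evolveB p t (phi psi : state R) :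
  evolve p t (sub_state phi psi) = sub_state (evolve p t phi) (evolve p t psi).
Proof.
apply/funext => k; apply/funext => x; case: p => [b w al be|b w ga] /=;
  rewrite /sub_state /= /rotv; ring.
Qed.

Lemma evolveK p t (phi : state R) : unimodular p ->
  evolve p (- t) (evolve p t phi) = phi.
Proof.
case: p => [b w al be|b w ga] /= hw; apply/funext => k; apply/funext => x.
  rewrite -[LHS]/(rotv b w (- t * (al * x + be)) (rotv b w (t * (al * x + be)) (phi ^~ x)) k).
  by rewrite rotvD// mulNr addNr rotv0.
rewrite flipK phase_flip !mulrN !opprK -!addrA addNr subrr !addr0.
have h := phaseJ b k hw.
have h2 : rC 2^-1 * 2 = 1 :> C by rewrite -rC2 -rCM mulVf ?pnatr_eq0.
set A := phi k (x + _); set B := phi k (x + (- _ + - _));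
set A' := phi (flip b k) (x + _); set B' := phi (flip b k) (x + (- _ + - _)).
(* The values translated twice in the same direction carry the factor [1 - S^2 = 0]; only those
   brought back to [x] survive. *)
transitivity (rC 2^-1 * rC 2^-1 * ((A + B) * (1 - phase b w k * conjc (phase b w k))
   + 2 * phi k x * (1 + phase b w k * conjc (phase b w k)))); first by ring.
rewrite h subrr mulr0 add0r.
transitivity ((rC 2^-1 * 2) * (rC 2^-1 * 2) * phi k x); first by ring.
by rewrite h2 !mul1r.
Qed.

Lemma mstate_evolve p t (phi : state R) : mstate phi -> mstate (evolve p t phi).
Proof.
move=> mp; case: p => [b w al be|b w ga] k /=.
  have mt : measurable_fun [set: R] (fun x : R => t * (al * x + be)).
    apply: measurable_funM => //; apply: measurable_funD => //; exact: measurable_funM.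
  rewrite /rotv; apply: cmeasB.
    apply: cmeasM (mp k); apply: cmeasrC; apply: (measurableT_comp _ mt).
    by apply: continuous_measurable_fun; exact: continuous_cos.
  apply: cmeasM (mp (flip b k)); apply: cmeasM; last exact: cmeas_cst.
  apply: cmeasM; first exact: cmeas_cst.
  apply: cmeasrC; apply: (measurableT_comp _ mt).
  by apply: continuous_measurable_fun; exact: continuous_sin.
have ms a j : cmeasurable setT (fun x => phi j (x + a)).
  exact: (cmeas_comp (measurable_shift a) (mp j)).
apply: cmeasD.
  by apply: cmeasM; [exact: cmeas_cst|apply: cmeasD; exact: ms].
apply: cmeasM; first exact: cmeas_cst.
by apply: cmeasB; exact: ms.
Qed.

(* projections onto the eigenspaces of the flip *)
Definition flip_proj (b : bool) (w : C) (v : 'I_4 -> C) : 'I_4 -> C :=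
  fun k => rC 2^-1 * (v k + phase b w k * v (flip b k)).

Lemma phaseN b (w : C) k : phase b (- w) k = - phase b w k.
Proof. by rewrite /phase conjcN; case: ifP. Qed.

Lemma flip_proj_eigen b w v k : sqnormc w = 1 ->
  flip_proj b w v (flip b k) = conjc (phase b w k) * flip_proj b w v k.
Proof.
move=> hw; rewrite /flip_proj flipK phase_flip; have h := phaseJ b k hw.
transitivity (rC 2^-1 * (phase b w k * conjc (phase b w k) * v (flip b k) + conjc (phase b w k) * v k)); first by rewrite h; ring.
ring.
Qed.

(** The eigenspaces of the Hermitian matrix [S] for 1 and -1 are orthogonal. The vectors [u] and [v]
    are distinct because the two parts of a translated state are read at different points. *)
Lemma sqnormv_flip_projD b w (u v : 'I_4 -> C) : sqnormc w = 1 ->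
  sqnormv (fun k => flip_proj b w u k + flip_proj b (- w) v k) =
  sqnormv (flip_proj b w u) + sqnormv (flip_proj b (- w) v).
Proof.
move=> hw; have hw' : sqnormc (- w) = 1 by rewrite sqnormcN.
pose X k := 2 * Re (conjc (flip_proj b w u k) * flip_proj b (- w) v k).
have -> : sqnormv (fun k => flip_proj b w u k + flip_proj b (- w) v k) =
  sqnormv (flip_proj b w u) + sqnormv (flip_proj b (- w) v) + \sum_k X k.
  rewrite /sqnormv -!big_split /=; apply: eq_bigr => k _.
  by rewrite /X /sqnormc !reimE; ring.
rewrite -[RHS]addr0; congr (_ + _).
have : \sum_k X k = - \sum_k X k.
  rewrite -{1}(sum_flip b) -sumrN; apply: eq_bigr => k _.
  rewrite /X !flip_proj_eigen// phaseN.
  have := sqnormc_phase b w k; rewrite hw.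
  set z := phase b w k; set p := flip_proj b w u k; set q := flip_proj b (- w) v k.
  move=> h; transitivity (- (2 * ((Re p * Re q + Im p * Im q) * sqnormc z))).
    by rewrite /sqnormc !reimE; ring.
  by rewrite h !reimE; ring.
by move=> /eqP; rewrite -addr_eq0 -mulr2n mulrn_eq0 /= => /eqP.
Qed.

Lemma sqnormv_flip_proj b w (u : 'I_4 -> C) : sqnormc w = 1 ->
  sqnormv u = sqnormv (flip_proj b w u) + sqnormv (flip_proj b (- w) u).
Proof.
move=> hw; rewrite -sqnormv_flip_projD//; congr sqnormv; apply/funext => k.
rewrite /flip_proj phaseN.
have h2 : rC 2^-1 * 2 = 1 :> C by rewrite -rC2 -rCM mulVf ?pnatr_eq0.
transitivity (rC 2^-1 * 2 * u k); first by rewrite h2 mul1r.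
ring.
Qed.

Lemma evolve_shiftE b w ga t (phi : state R) x :
  (evolve (Shift b w ga) t phi) ^~ x = (fun k => flip_proj b w (phi ^~ (x - ga * t)) k +
     flip_proj b (- w) (phi ^~ (x + ga * t)) k).
Proof. by apply/funext => k; rewrite /= /flip_proj phaseN; ring. Qed.

Lemma integrable_flip_proj b w (phi : state R) : sqnormc w = 1 -> L2state phi ->
  measurable_fun setT (fun x => sqnormv (flip_proj b w (phi ^~ x))) /\
  integ (fun x => sqnormv (flip_proj b w (phi ^~ x))).
Proof.
move=> hw /L2stateP[mp ip].
have m : mstate (fun k x => flip_proj b w (phi ^~ x) k).
  move=> k; rewrite /flip_proj; apply: cmeasM; first exact: cmeas_cst.
  by apply: cmeasD => //; apply: cmeasM => //; exact: cmeas_cst.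
split; first exact: (meas_sqnormv m).
apply: (integ_le (meas_sqnormv m) ip) => x.
rewrite ger0_norm ?sqnormv_ge0// (sqnormv_flip_proj b (phi ^~ x) hw) lerDl.
exact: sqnormv_ge0.
Qed.

(** A multiplication pulse is unitary at each point. A translation pulse preserves only the total
    norm: it moves two orthogonal parts by opposite amounts, and each keeps its integral. *)
Lemma evolve_isometry p t (phi : state R) : unimodular p -> L2state phi ->
  L2state (evolve p t phi) /\ sqnorm (evolve p t phi) = sqnorm phi.
Proof.
move=> hp lp; have /L2stateP[mp ip] := lp.
have me := mstate_evolve p t mp.
case: p hp me => [b w al be|b w ga] hw me.
  have E x : sqnormv ((evolve (Mult b w al be) t phi) ^~ x) = sqnormv (phi ^~ x).
    by rewrite sqnormv_rotv.
  split; last by apply: eq_Rintegral => x _; exact: E.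
  by apply: (L2state_dom (c := 1) me lp) => x; rewrite mul1r E.
have hw' : sqnormc (- w) = 1 by rewrite sqnormcN.
have E x : sqnormv ((evolve (Shift b w ga) t phi) ^~ x) =
   sqnormv (flip_proj b w (phi ^~ (x - ga * t))) +
   sqnormv (flip_proj b (- w) (phi ^~ (x + ga * t))).
  by rewrite evolve_shiftE sqnormv_flip_projD.
have [m1 i1] := integrable_flip_proj b hw lp.
have [m2 i2] := integrable_flip_proj b hw' lp.
have j1 := integrableT_shift (- (ga * t)) m1 i1.
have j2 := integrableT_shift (ga * t) m2 i2.
split.
  apply/L2stateP; split => //.
  by apply: integ_ext (integD j1 j2) => x; rewrite E.
rewrite /sqnorm; under eq_Rintegral do rewrite E.
rewrite (RintegralD measurableT j1 j2).
rewrite (RintegralT_shift (- (ga * t)) m1 i1) (RintegralT_shift (ga * t) m2 i2).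
rewrite -RintegralD//; apply: eq_Rintegral => x _.
by rewrite -sqnormv_flip_proj.
Qed.

End Pulses.

(** * The closed formulas solve the system *)

Section PulseSolutions.
Variable R : realType.
Local Notation mu := (@lebesgue_measure R).
Local Notation C := R[i].
Local Notation Re := complex.Re.
Local Notation Im := complex.Im.
Local Notation integ f := (mu.-integrable [set: R] (EFin \o (f : R -> R))).

Lemma sqnormE (phi : state R) : (forall k, integ (fun x => sqnormc (phi k x))) ->
  sqnorm phi = \sum_k (\int[mu]_x sqnormc (phi k x))%R.
Proof. by move=> h; rewrite /sqnorm /sqnormv Rint_sum. Qed.

Lemma L2state_shift_continuous (phi : state R) (e : R) : 0 < e -> L2state phi ->
  exists2 d : R, 0 < d & forall h k, `|h| < d ->
    (\int[mu]_x sqnormc (phi k (x + h) - phi k x))%R < e.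
Proof.
move=> e0 lp.
have H k := shift_continuous e0 (lp k).
have [d0 d0p h0] := H 0%R; have [d1 d1p h1] := H 1%R.
have [d2 d2p h2] := H 2%R; have [d3 d3p h3] := H 3%R.
exists (Num.min (Num.min d0 d1) (Num.min d2 d3)); first by rewrite !lt_min d0p d1p d2p d3p.
move=> h k; rewrite !lt_min => /andP[/andP[a0 a1] /andP[a2 a3]].
by elim/I4_ind: k; [exact: h0|exact: h1|exact: h2|exact: h3].
Qed.

Lemma sqnormv_sub_le (u v : 'I_4 -> C) :
  sqnormv (fun k => u k - v k) <= 2 * sqnormv u + 2 * sqnormv v.
Proof.
have := sqnormvD_le u (fun k => - v k) (@ltr01 R).
by rewrite invr1 sqnormvN.
Qed.

Lemma continuous_rotv_arg b (w : C) (f : R -> R) (v : 'I_4 -> C) k :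
  continuous f -> ccontinuous (fun t : R => rotv b w (f t) v k).
Proof.
move=> cf; have [ccos csin] : continuous (fun t => cos (f t)) /\ continuous (fun t => sin (f t)).
  split => t; [apply: (@continuous_comp _ _ _ f cos)|apply: (@continuous_comp _ _ _ f sin)];
    [exact: cf|exact: continuous_cos|exact: cf|exact: continuous_sin].
have E t : rotv b w (f t) v k = rC (cos (f t)) * v k -
    rC (sin (f t)) * (iC R * phase b w k * v (flip b k)) by rewrite /rotv; ring.
have key (g : R -> R) (z : C) : continuous g -> ccontinuous (fun t => rC (g t) * z).
  move=> cg; split.
    rewrite (_ : (fun x => _) = (fun t => g t * Re z)); last first.
      by apply/funext => t; rewrite !reimE; ring.
    by move=> t; apply: cvgM; [exact: cg|exact: cvg_cst].
  rewrite (_ : (fun x => _) = (fun t => g t * Im z)); last first.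
    by apply/funext => t; rewrite !reimE; ring.
  by move=> t; apply: cvgM; [exact: cg|exact: cvg_cst].
rewrite (funext E); apply: ccontinuousB; exact: key.
Qed.

(** Dominated convergence settles multiplication pulses, with four times the squared norm of [phi]
    as bound; translation pulses reduce to continuity of translations in mean square. *)
Lemma evolve_sqnorm_continuous p (phi : state R) (t e : R) : unimodular p -> L2state phi ->
  0 < e -> exists2 d : R, 0 < d & forall s, `|s - t| < d ->
    sqnorm (sub_state (evolve p s phi) (evolve p t phi)) < e.
Proof.
move=> hp lp e0; have /L2stateP[mp ip] := lp.
have le s := proj1 (evolve_isometry s hp lp).
have ls s := L2stateB (le s) (le t).
case: p hp le ls => [b w al be|b w ga] hw le ls.
  pose F (s x : R) := sqnormv ((sub_state (evolve (Mult b w al be) s phi)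
     (evolve (Mult b w al be) t phi)) ^~ x).
  have iF s : integ (F s) by have /L2stateP[] := ls s.
  have hF s x : `|s - t| < 1 -> `|F s x| <= 4 * sqnormv (phi ^~ x).
    move=> _; rewrite ger0_norm ?sqnormv_ge0//.
    apply: (le_trans (sqnormv_sub_le _ _)).
    by rewrite !sqnormv_rotv//; lra.
  have cF x : continuous (F ^~ x).
    have ck k : continuous (fun s : R => sqnormc (sub_state (evolve (Mult b w al be) s phi)
       (evolve (Mult b w al be) t phi) k x)).
      apply: ccontinuous_sqnormc; apply: ccontinuousB; last exact: ccontinuous_cst.
      apply: continuous_rotv_arg => s; apply: cvgM; [exact: cvg_id|exact: cvg_cst].
    rewrite (_ : (F ^~ x) = fun s => \sum_k sqnormc (sub_state (evolve (Mult b w al be) s phi)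
       (evolve (Mult b w al be) t phi) k x))//.
    under eq_fun do rewrite big_I4.
    move=> s; apply: cvgD; last exact: ck.
    apply: cvgD; last exact: ck.
    by apply: cvgD; exact: ck.
  have F0 : (\int[mu]_x F t x)%R = 0.
    rewrite (_ : (fun x => F t x) = cst 0); first by rewrite Rintegral_cst// mul0r.
    apply/funext => x; rewrite /F /sqnormv big1// => k _.
    by rewrite /sub_state subrr sqnormc0.
  have : (\int[mu]_x F s x)%R @[s --> t] --> (0 : R).
    by rewrite -[X in _ --> X]F0; exact: (continuous_under_integral_dom iF cF (integZ 4 ip) hF).
  move=> /cvgr_lt /(_ _ e0) /nbhs_ballP[d d0 hd].
  by exists d => // s hs; apply: hd; rewrite /ball /= distrC.
(* Each of the four levels is bounded by four translation errors; 17 rather than 16 makes the total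
   strictly smaller than [e]. *)
have e16 : 0 < e / 17 by rewrite divr_gt0.
have [d d0 hd] := L2state_shift_continuous e16 lp.
(* The displacement is [|ga|] times the elapsed time; the [1 +] allows [ga = 0]. *)
exists (d / (1 + `|ga|)); first by rewrite divr_gt0// ltr_pwDl.
move=> s; rewrite ltr_pdivlMr ?ltr_pwDl// => hs.
have hga (c : R) : `|c| = `|ga| -> `|c * s - c * t| < d.
  move=> hc; rewrite -mulrBr normrM hc mulrC; apply: le_lt_trans hs.
  by rewrite ler_wpM2l// lerDr.
pose D (c : R) k x := sqnormc (phi k (x + c * s) - phi k (x + c * t)).
have mphi k := proj1 (proj1 (L2funP _) (lp k)).
have Dm c k : measurable_fun [set: R] (fun x => sqnormc (phi k (x + c) - phi k x)).
  by apply: meas_sqnormc; apply: cmeasB => //; exact: (cmeas_comp (measurable_shift c) (mphi k)).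
have Di c k : integ (fun x => sqnormc (phi k (x + c) - phi k x)).
  have /L2funP[_ i0] := lp k; have /L2funP[_ i1] := L2fun_shift c (lp k).
  apply: (integ_le (Dm c k) (integD (integZ 2 i1) (integZ 2 i0))) => x.
  rewrite ger0_norm ?sqnormc_ge0//; apply: (le_trans (sqnormcD2_le _ _)).
  by rewrite sqnormcN.
have DE c k : D c k = (fun x => sqnormc (phi k (x + c * t + (c * s - c * t)) - phi k (x + c * t))).
  by apply/funext => x; rewrite /D; congr (sqnormc (phi k _ - _)); ring.
have iD c k : integ (D c k).
  by rewrite DE; exact: (integrableT_shift (c * t) (Dm (c * s - c * t) k) (Di _ k)).
have eD c k : `|c| = `|ga| -> (\int[mu]_x D c k x)%R < e / 17.
  move=> hc; rewrite DE (RintegralT_shift (c * t) (Dm (c * s - c * t) k) (Di _ k)).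
  by apply: hd; exact: hga.
have n1 : `|- ga| = `|ga| by rewrite normrN.
have iS k : integ (fun x => D (- ga) k x + D ga k x + (D (- ga) (flip b k) x + D ga (flip b k) x)).
  exact: (integD (integD (iD _ _) (iD _ _)) (integD (iD _ _) (iD _ _))).
have key k x : sqnormc (sub_state (evolve (Shift b w ga) s phi)
    (evolve (Shift b w ga) t phi) k x) <=
    D (- ga) k x + D ga k x + (D (- ga) (flip b k) x + D ga (flip b k) x).
  rewrite /D /sub_state /= !mulNr.
  set A := phi k (x - ga * s) - phi k (x - ga * t).
  set B := phi k (x + ga * s) - phi k (x + ga * t).
  set A' := phi (flip b k) (x - ga * s) - phi (flip b k) (x - ga * t).
  set B' := phi (flip b k) (x + ga * s) - phi (flip b k) (x + ga * t).
  have -> : rC 2^-1 * (phi k (x - ga * s) + phi k (x + ga * s)) +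
      rC 2^-1 * phase b w k * (phi (flip b k) (x - ga * s) - phi (flip b k) (x + ga * s)) -
      (rC 2^-1 * (phi k (x - ga * t) + phi k (x + ga * t)) +
      rC 2^-1 * phase b w k * (phi (flip b k) (x - ga * t) - phi (flip b k) (x + ga * t))) =
      rC 2^-1 * ((A + B) + phase b w k * (A' + - B')).
    by rewrite /A /B /A' /B'; ring.
  rewrite sqnormcM sqnormcrC.
  have p1 : sqnormc (phase b w k) = 1 by rewrite sqnormc_phase.
  have := sqnormcD2_le (A + B) (phase b w k * (A' + - B')).
  rewrite sqnormcM p1 mul1r.
  have := sqnormcD2_le A B; have := sqnormcD2_le A' (- B'); rewrite sqnormcN; lra.
have iphi k : integ (fun x => sqnormc (sub_state (evolve (Shift b w ga) s phi)
    (evolve (Shift b w ga) t phi) k x)) by have /L2funP[] := ls s k.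
rewrite sqnormE//; apply: (@le_lt_trans _ _ (\sum_(k : 'I_4) 4 * (e / 17))).
  apply: ler_sum => k _.
  apply: (@le_trans _ _ (\int[mu]_x (D (- ga) k x + D ga k x +
     (D (- ga) (flip b k) x + D ga (flip b k) x)))%R).
    by apply: le_Rintegral => // x _; exact: key.
  rewrite (RintegralD measurableT (integD (iD _ _) (iD _ _)) (integD (iD _ _) (iD _ _))).
  rewrite (RintegralD measurableT (iD _ _) (iD _ _)) (RintegralD measurableT (iD _ _) (iD _ _)).
  have := eD (- ga) k n1; have := eD ga k erefl; have := eD (- ga) (flip b k) n1.
  have := eD ga (flip b k) erefl; lra.
by rewrite big_I4; lra.
Qed.

Lemma sqnorm_lt_norm4 (phi : state R) (e : R) : L2state phi -> 0 < e ->
  sqnorm phi < e ^+ 2 -> norm4 phi < e.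
Proof.
move=> lp e0 h; rewrite norm4E// -(ger0_norm (ltW e0)) -sqrtr_sqr.
by rewrite ltr_sqrt// exprn_gt0.
Qed.

(** The closed formula is differentiated in time, and the symmetric generator is then transferred to
    the test state; reindexing the levels by the flip matches the two sides. *)
Lemma evolve_weak (p : pulse R) (phi psi : state R) : unimodular p -> L2state phi ->
  test_state psi ->
  C1c (fun t => inner4 psi (evolve p t phi))
      (fun t => - iC R * inner4 (pulse_ham p psi) (evolve p t phi)).
Proof.
move=> hp lp tp.
have lpsi k : L2fun (psi k) by exact: test_fun_L2.
have le t := proj1 (evolve_isometry t hp lp).
case: p hp le => [b w al be|b w ga] hw le.
  pose g (x : R) := al * x + be.
  have cg : continuous g.
    by move=> x; apply: cvgD; [apply: cvgM; [exact: cvg_cst|exact: cvg_id]|exact: cvg_cst].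
  have mg : measurable_fun setT g by exact: continuous_measurable_fun.
  have lg k : L2fun (fun x => rC (g x) * psi k x) by exact: test_fun_L2_mul.
  pose a k x := conjc (psi k x) * phi k x.
  pose a' k x := - iC R * phase b w k * (conjc (psi k x) * phi (flip b k) x).
  have ia k : cintegrable setT (a k) by exact: cinteg_JM.
  have ia' k : cintegrable setT (a' k) by apply: cintegZ; exact: cinteg_JM.
  have mj k j : cmeasurable setT (fun x => conjc (psi k x) * phi j x).
    by apply: cmeasM; [apply: cmeasJ; have [] := lpsi k|have [] := lp j].
  have iga k : cintegrable setT (fun x => rC (g x) * a k x).
    have := cinteg_JM (lg k) (lp k).
    rewrite (_ : (fun x => _) = (fun x => rC (g x) * a k x))//.
    by apply/funext => x; rewrite /a conjcM conjcrC; ring.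
  have iga' k : cintegrable setT (fun x => rC (g x) * a' k x).
    have := cintegZ (- iC R * phase b w k) (cinteg_JM (lg k) (lp (flip b k))).
    rewrite (_ : (fun x => _) = (fun x => rC (g x) * a' k x))//.
    by apply/funext => x; rewrite /a' conjcM conjcrC; ring.
  have H := C1c_sum (fun k => C1c_mult mg (proj1 (conj (mj k k) I)) (cmeasM (cmeas_cst _) (mj k (flip b k)))
     (ia k) (ia' k) (iga k) (iga' k)).
  apply: C1c_ext H => t.
    apply: eq_bigr => k _; rewrite /L2inner; congr cintegral; apply/funext => x /=.
    by rewrite /a /a' /rotv -/(g x); ring.
  rewrite /inner4 -[in RHS](sum_flip b) mulr_sumr; apply: eq_bigr => k _.
  rewrite /L2inner -cintegralTZ; last first.
    apply: cinteg_JM; last exact: le.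
    exact: (L2funZ (phase b w (flip b k)) (lg (flip b (flip b k)))).
  congr cintegral; apply/funext => x /=.
  rewrite /a /a' /rotv !flipK phase_flip conjcM conjcK conjcM conjcrC -/(g x).
  have h := phaseJ b k hw.
  set c := rC (cos _); set s := rC (sin _).
  transitivity (- iC R * phase b w k * rC (g x) * conjc (psi k x) * c * phi (flip b k) x
    + iC R * iC R * (phase b w k * conjc (phase b w k)) * rC (g x) * conjc (psi k x) * s * phi k x);
    last by ring.
  by rewrite h iC_sqr; ring.
pose J k j (t : R) := L2inner (psi k) (fun x => phi j (x - t)).
pose D k j (t : R) := L2inner (cderiv (psi k)) (fun x => phi j (x - t)).
have JD k j : C1c (J k j) (D k j) by exact: C1c_shift.
have lD k : L2fun (cderiv (psi k)) by apply: test_fun_L2; exact: test_fun_cderiv.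
have lsh j t : L2fun (fun x => phi j (x + t)) by exact: L2fun_shift.
have comb (f : R -> C) k t : L2fun f -> L2inner f (evolve (Shift b w ga) t phi k) =
  rC 2^-1 * (L2inner f (fun x => phi k (x - ga * t)) + L2inner f (fun x => phi k (x + ga * t))) +
  rC 2^-1 * phase b w k * (L2inner f (fun x => phi (flip b k) (x - ga * t)) -
     L2inner f (fun x => phi (flip b k) (x + ga * t))).
  move=> lf /=; rewrite L2innerDr//; last 2 first.
    by apply: L2funZ; exact: L2funD.
    apply: L2funZ; apply: L2funD => //.
    by have := L2funZ (-1) (lsh (flip b k) (ga * t)); under eq_fun do rewrite mulN1r.
  rewrite !L2innerZr//; last 2 first.
    apply: L2funD => //.
    by have := L2funZ (-1) (lsh (flip b k) (ga * t)); under eq_fun do rewrite mulN1r.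
    exact: L2funD.
  rewrite !L2innerDr//; last first.
    by have := L2funZ (-1) (lsh (flip b k) (ga * t)); under eq_fun do rewrite mulN1r.
  congr (_ + _ * (_ + _)).
  rewrite -mulN1r -L2innerZr//; congr L2inner; apply/funext => x; by rewrite mulN1r.
have E j t : (fun x => phi j (x - - ga * t)) = (fun x => phi j (x + ga * t)).
  by apply/funext => x; rewrite mulNr opprK.
have H := C1c_sum (fun k => C1cD
   (C1cZ (rC 2^-1) (C1cD (C1c_scale ga (JD k k)) (C1c_scale (- ga) (JD k k))))
   (C1cZ (rC 2^-1 * phase b w k) (C1cD (C1c_scale ga (JD k (flip b k)))
      (C1cZ (-1) (C1c_scale (- ga) (JD k (flip b k))))))).
apply: C1c_ext H => t.
  by apply: eq_bigr => k _; rewrite comb// /J mulN1r !E.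
rewrite /inner4 -[in RHS](sum_flip b) mulr_sumr; apply: eq_bigr => k _.
have -> : L2inner (pulse_ham (Shift b w ga) psi (flip b k))
    (evolve (Shift b w ga) t phi (flip b k)) =
   conjc (phase b w (flip b k) * (- iC R * rC ga)) * L2inner (cderiv (psi k)) (evolve (Shift b w ga) t phi (flip b k)).
  rewrite -(L2innerZl _ (lD k) (le t (flip b k))); congr L2inner; apply/funext => x /=.
  by rewrite flipK; ring.
rewrite comb// flipK phase_flip /D.
rewrite !E !conjcM conjcK conjcN conjciC conjcrC rCN.
have h := phaseJ b k hw.
set A := L2inner _ _; set B := L2inner _ _; set A' := L2inner _ _; set B' := L2inner _ _.
transitivity ((- (iC R * iC R)) * rC ga * (rC 2^-1 * phase b w k * (A' + B') +
   rC 2^-1 * (phase b w k * conjc (phase b w k)) * (A - B))); last by ring.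
by rewrite iC_sqr h; ring.
Qed.

Lemma pulse_solution (p : pulse R) (phi : state R) (T : R) : unimodular p -> L2state phi ->
  solution (fun j _ => control p j) T (fun t => evolve p t phi).
Proof.
move=> hp lp; have le t := proj1 (evolve_isometry t hp lp).
split; first by move=> t _; exact: le.
split.
  move=> t _ e e0; have e2 : 0 < e ^+ 2 by rewrite exprn_gt0.
  have [d d0 hd] := evolve_sqnorm_continuous t hp lp e2.
  exists d => // s _ hs; apply: sqnorm_lt_norm4 => //; first exact: L2stateB.
  exact: hd.
move=> psi tp t /andP[t0 _].
have [[i1 i2] eJ] := C1c_FTC (evolve_weak hp lp tp) t0.
have E : (fun s => inner4 (hamiltonian (fun j _ => control p j) s psi) (evolve p s phi)) =
    (fun s => inner4 (pulse_ham p psi) (evolve p s phi)).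
  by apply/funext => s; rewrite hamiltonian_control.
split; last first.
  rewrite eJ; congr cintegral; apply/funext => s.
  by rewrite hamiltonian_control.
(* Multiplication by [- i] exchanges real and imaginary parts up to sign, so integrability passes to
   the pairing without that factor. *)
have [e1 e2] : (forall s, Re (inner4 (pulse_ham p psi) (evolve p s phi)) =
     - Im (- iC R * inner4 (pulse_ham p psi) (evolve p s phi))) /\
   (forall s, Im (inner4 (pulse_ham p psi) (evolve p s phi)) =
     Re (- iC R * inner4 (pulse_ham p psi) (evolve p s phi))).
  by split => s; rewrite !reimE; ring.
rewrite E; split.
  by rewrite (funext (fun s => congr1 EFin (e1 s))); have := integrableN i2.
by rewrite (funext (fun s => congr1 EFin (e2 s))).
Qed.

End PulseSolutions.

(** * Programs *)

Section Programs.
Variable R : realType.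
Local Notation mu := (@lebesgue_measure R).
Local Notation C := R[i].
Local Notation Re := complex.Re.
Local Notation Im := complex.Im.
Local Notation integ f := (mu.-integrable [set: R] (EFin \o (f : R -> R))).

Lemma integ_restrict (D : set (measurableTypeR R)) (f : R -> R) : measurable D ->
  mu.-integrable D (EFin \o f) <-> integ (f \_ D).
Proof. by move=> mD; rewrite -restrict_EFin; exact: integrable_mkcond. Qed.

Lemma concat_integral (F F1 F2 : R -> R) (T1 t : R) : 0 <= T1 -> T1 < t ->
  mu.-integrable `[0, T1] (EFin \o F1) -> mu.-integrable `[0, t - T1] (EFin \o F2) ->
  (forall x, x <= T1 -> F x = F1 x) -> (forall x, T1 < x -> F x = F2 (x - T1)) ->
  mu.-integrable `[0, t] (EFin \o F) /\
  (\int[mu]_(x in `[0%R, t]) F x = \int[mu]_(x in `[0%R, T1]) F1 x +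
     \int[mu]_(x in `[0%R, t - T1]) F2 x)%R.
Proof.
move=> T0 Tt i1 i2 h1 h2.
(* The second interval is open at 0 so that the junction time is counted once. *)
pose D1 : set R := `[0, T1]; pose D2 : set R := `]0, t - T1].
have mD1 : measurable (D1 : set (measurableTypeR R)) by exact: measurable_itv.
have mD2 : measurable (D2 : set (measurableTypeR R)) by exact: measurable_itv.
have mDt : measurable (`[0, t]%classic : set (measurableTypeR R)) by exact: measurable_itv.
have mD2' : measurable (`[0, t - T1]%classic : set (measurableTypeR R)) by exact: measurable_itv.
pose f1 := F1 \_ D1; pose f2 := F2 \_ D2.
have i2' : mu.-integrable D2 (EFin \o F2).
  have sD : D2 `<=` `[0, t - T1].
    by move=> x; rewrite /D2 /= !in_itv /= => /andP[/ltW -> ->].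
  exact: (integrableS mD2' mD2 sD i2).
have j1 : integ f1 by exact: (proj1 (integ_restrict F1 mD1) i1).
have j2 : integ f2 by exact: (proj1 (integ_restrict F2 mD2) i2').
have m2 : measurable_fun [set: R] f2 by apply/measurable_EFinP; exact: measurable_int j2.
have k2 := integrableT_shift (- T1) m2 j2.
have E x : (F \_ (`[0, t] : set R)) x = f1 x + f2 (x - T1).
  rewrite /f1 /f2 !patchE /D1 /D2.
  have inE' (a b : R) (u v : bool) (y : R) :
    (y \in ([set` Interval (BSide u a) (BSide v b)] : set R)) =
    (y \in Interval (BSide u a) (BSide v b)) by rewrite mem_setE.
  rewrite !inE' !in_itv /= subr_gt0 lerD2r.
  have [xT|Tx] := leP x T1.
    rewrite (le_trans xT (ltW Tt)) !andbT /= addr0; case: ifP => // _; exact: h1.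
  rewrite andbF (le_trans T0 (ltW Tx)) /= add0r; case: ifP => // _; exact: h2.
split.
  apply: (proj2 (integ_restrict F mDt)).
  by apply: integ_ext (integD j1 k2) => x; rewrite E.
rewrite Rintegral_mkcond; under eq_Rintegral do rewrite E.
rewrite (RintegralD measurableT j1 k2) (RintegralT_shift (- T1) m2 j2).
rewrite /f1 /f2 -!Rintegral_mkcond; congr (_ + _).
exact: Rintegral_itv_obnd_cbnd.
Qed.

Definition concat (A : Type) (T1 : R) (f g : R -> A) (t : R) : A :=
  if t <= T1 then f t else g (t - T1).

(** At the junction the states agree while the controls may jump; continuity there combines both
    moduli, and the integral identities of the two stages add up. *)
Lemma solution_concat (u1 u2 : controls R) (T1 T2 : R) (phi1 phi2 : R -> state R) :
  0 < T1 -> 0 <= T2 -> solution u1 T1 phi1 -> solution u2 T2 phi2 ->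
  phi1 T1 = phi2 0 ->
  solution (fun k => concat T1 (u1 k) (u2 k)) (T1 + T2) (concat T1 phi1 phi2).
Proof.
move=> T1_gt0 T2_ge0 [l1 [c1 w1]] [l2 [c2 w2]] e12.
split.
  move=> t ht; rewrite /concat; case: leP => h; [apply: l1|apply: l2]; lra.
split.
  move=> t /andP[t0 tT] e e0; rewrite /concat; case: (ltgtP t T1) => h.
  - have ht : 0 <= t <= T1 by lra.
    have [d d0 hd] := c1 t ht e e0.
    exists (Num.min d (T1 - t)); first by rewrite lt_min d0 /=; lra.
    move=> s hs; rewrite lt_min => /andP[sd]; rewrite ltr_norml => /andP[s1 s2].
    have -> : s <= T1 by lra.
    by apply: hd => //; lra.
  - have ht : 0 <= t - T1 <= T2 by lra.
    have [d d0 hd] := c2 _ ht e e0.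
    exists (Num.min d (t - T1)); first by rewrite lt_min d0 /=; lra.
    move=> s hs; rewrite lt_min => /andP[sd]; rewrite ltr_norml => /andP[s1 s2].
    have -> : (s <= T1) = false by apply/negbTE; rewrite -ltNge; lra.
    apply: hd; first by lra.
    by rewrite (_ : s - T1 - (t - T1) = s - t)//; ring.
  - have ht : 0 <= t <= T1 by lra.
    have h0 : (0 : R) <= 0 <= T2 by lra.
    have [d d0 hd] := c1 t ht e e0.
    have [d' d0' hd'] := c2 0 h0 e e0.
    exists (Num.min d d'); first by rewrite lt_min d0.
    move=> s hs; rewrite lt_min => /andP[sd sd'].
    case: (leP s T1) => sT; first by apply: hd => //; lra.
    rewrite h e12; apply: hd'; first by lra.
    by rewrite subr0 -h.
move=> psi tp t /andP[t0 tT].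
have [tT1|T1t] := leP t T1.
  have ht : 0 <= t <= T1 by lra.
  have [[i1 i2] e1] := w1 psi tp t ht.
  have E (s : R) : s \in (`[0, t] : set R) ->
     inner4 (hamiltonian (fun k => concat T1 (u1 k) (u2 k)) s psi) (concat T1 phi1 phi2 s) =
     inner4 (hamiltonian u1 s psi) (phi1 s).
    rewrite inE /= in_itv /= => /andP[_ st].
    by rewrite /concat /hamiltonian (le_trans st tT1).
  split.
    split; [apply: eq_integrable i1|apply: eq_integrable i2] => // s hs /=; by rewrite E.
  rewrite {1 2}/concat tT1 (ltW T1_gt0) e1.
  by apply: eqcP; apply: eq_Rintegral => s hs; rewrite E.
have hT1 : 0 <= T1 <= T1 by lra.
have ht : 0 <= t - T1 <= T2 by lra.
have [[i1 i2] e1] := w1 psi tp T1 hT1.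
have [[j1 j2] e2] := w2 psi tp _ ht.
pose K1 s := inner4 (hamiltonian u1 s psi) (phi1 s).
pose K2 s := inner4 (hamiltonian u2 s psi) (phi2 s).
pose K s := inner4 (hamiltonian (fun k => concat T1 (u1 k) (u2 k)) s psi) (concat T1 phi1 phi2 s).
have KE1 (s : R) : s <= T1 -> K s = K1 s.
  by move=> h; rewrite /K /K1 /concat /hamiltonian h.
have KE2 (s : R) : T1 < s -> K s = K2 (s - T1).
  by move=> h; rewrite /K /K2 /concat /hamiltonian leNgt h.
have [a1 b1] := @concat_integral (fun s => Re (K s)) _ _ T1 t (ltW T1_gt0) T1t i1 j1
  (fun s h => f_equal (fun z : C => Re z) (KE1 s h)) (fun s h => f_equal (fun z : C => Re z) (KE2 s h)).
have [a2 b2] := @concat_integral (fun s => Im (K s)) _ _ T1 t (ltW T1_gt0) T1t i2 j2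
  (fun s h => f_equal (fun z : C => Im z) (KE1 s h)) (fun s h => f_equal (fun z : C => Im z) (KE2 s h)).
split; first by split.
have -> : inner4 psi (concat T1 phi1 phi2 t) - inner4 psi (concat T1 phi1 phi2 0) =
   (inner4 psi (phi1 T1) - inner4 psi (phi1 0)) + (inner4 psi (phi2 (t - T1)) - inner4 psi (phi2 0)).
  by rewrite /concat leNgt T1t (ltW T1_gt0) e12 /=; ring.
have cZ D (f : R -> C) : measurable (D : set R) -> mu.-integrable D (EFin \o (fun s => Re (f s))) ->
   mu.-integrable D (EFin \o (fun s => Im (f s))) ->
   cintegral D (fun s => - iC R * f s) = - iC R * cintegral D f.
  move=> mD p q; apply: eqcP; rewrite [RHS]reimE !Re_cintegral !Im_cintegral !reimE.
    rewrite oppr0 mul0r sub0r mulN1r opprK; apply: eq_Rintegral => s _.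
    by rewrite !reimE; ring.
  rewrite oppr0 mul0r add0r -RintegralZl//; apply: eq_Rintegral => s _.
  by rewrite !reimE; ring.
rewrite e1 e2 !cZ// -mulrDr; congr (_ * _).
by apply: eqcP; [rewrite [LHS]ReD; exact: (esym b1)|rewrite [LHS]ImD; exact: (esym b2)].
Qed.

Definition run (l : seq (pulse R)) (phi : state R) : state R :=
  foldl (fun psi p => evolve p 1 psi) phi l.

Lemma run_cat l1 l2 phi : run (l1 ++ l2) phi = run l2 (run l1 phi).
Proof. exact: foldl_cat. Qed.

Fixpoint unimodular_prog (l : seq (pulse R)) : Prop :=
  if l is p :: l' then unimodular p /\ unimodular_prog l' else True.

Lemma unimodular_prog_cat l1 l2 : unimodular_prog l1 -> unimodular_prog l2 ->
  unimodular_prog (l1 ++ l2).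
Proof. by elim: l1 => //= p l1 IH [hp h1] h2; split => //; exact: IH. Qed.

Lemma run_isometry l phi : unimodular_prog l -> L2state phi ->
  L2state (run l phi) /\ sqnorm (run l phi) = sqnorm phi.
Proof.
elim: l phi => [|p l IH] phi //= [hp hl] lp.
have [le ne] := evolve_isometry 1 hp lp.
by have [a b] := IH _ hl le; rewrite b.
Qed.

Lemma runB l phi psi : run l (sub_state phi psi) = sub_state (run l phi) (run l psi).
Proof. by elim: l phi psi => //= p l IH phi psi; rewrite evolveB IH. Qed.

Lemma run_L2 l phi : unimodular_prog l -> L2state phi -> L2state (run l phi).
Proof. by move=> h1 h2; have [] := run_isometry h1 h2. Qed.

Lemma run_norm4 l phi : unimodular_prog l -> L2state phi -> norm4 (run l phi) = norm4 phi.
Proof. by move=> h1 h2; have [a b] := run_isometry h1 h2; rewrite !norm4E// b. Qed.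

Lemma run_dist l phi psi : unimodular_prog l -> L2state phi -> L2state psi ->
  dist (run l phi) (run l psi) = dist phi psi.
Proof.
by move=> hl h1 h2; rewrite /dist -runB run_norm4//; exact: L2stateB.
Qed.

(** The same evolution carried out in time [tau] instead of 1: coefficients and duration enter only
    through their product. *)
Definition rescale (p : pulse R) (tau : R) : pulse R :=
  match p with
  | Mult b w al be => Mult b w (al / tau) (be / tau)
  | Shift b w ga => Shift b w (ga / tau)
  end.

Lemma evolve_rescale p (tau : R) phi : tau != 0 -> evolve (rescale p tau) tau phi = evolve p 1 phi.
Proof.
move=> t0; apply/funext => k; apply/funext => x; case: p => [b w al be|b w ga] /=.
  by congr (rotv b w _ _ k); field.
by rewrite !(divfK t0) !mulr1.
Qed.

(** Dividing by [-1] reverses the sign of the generator, so the inverse is again a pulse run for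
    positive time. *)
Definition inv_pulse (p : pulse R) : pulse R := rescale p (-1).

Lemma inv_pulseK p phi : unimodular p -> evolve (inv_pulse p) 1 (evolve p 1 phi) = phi.
Proof.
move=> hp; rewrite -[RHS](evolveK 1 phi hp).
apply/funext => k; apply/funext => x; case: p {hp} => [b w al be|b w ga] /=.
  by congr (rotv b w _ _ k); field.
by rewrite !mulr1 !invrN1 !mulrN1.
Qed.

Lemma unimodular_rescale p tau : unimodular p -> unimodular (rescale p tau).
Proof. by case: p. Qed.

Definition inv_prog (l : seq (pulse R)) := rev (map inv_pulse l).

Lemma unimodular_inv_prog l : unimodular_prog l -> unimodular_prog (inv_prog l).
Proof.
elim: l => //= p l IH [hp hl]; rewrite /inv_prog /= rev_cons -cats1.
by apply: unimodular_prog_cat; [exact: IH|split => //; exact: unimodular_rescale].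
Qed.

Lemma inv_progK l phi : unimodular_prog l -> run (inv_prog l) (run l phi) = phi.
Proof.
elim: l phi => //= p l IH phi [hp hl].
rewrite /inv_prog /= rev_cons -cats1 run_cat -/(inv_prog l) IH//=.
exact: inv_pulseK.
Qed.

Definition strength (p : pulse R) : R :=
  match p with Mult _ _ al be => `|al| + `|be| | Shift _ _ ga => `|ga| end.

Lemma strength_rescale p (tau : R) : 0 < tau -> strength (rescale p tau) = strength p / tau.
Proof.
by move=> t0; case: p => * /=; rewrite !normrM !normfV (gtr0_norm t0) ?mulrDl.
Qed.

Lemma evolve0 (p : pulse R) phi : evolve p 0 phi = phi.
Proof.
apply/funext => k; apply/funext => x; case: p => [b w al be|b w ga] /=.
  by rewrite mul0r rotv0.
rewrite mulr0 subr0 addr0 subrr mulr0 addr0.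
have h2 : rC 2^-1 * 2 = 1 :> C by rewrite -rC2 -rCM mulVf ?pnatr_eq0.
transitivity (rC 2^-1 * 2 * phi k x); first by ring.
by rewrite h2 mul1r.
Qed.

Lemma cabsM (z w : C) : cabs (z * w) = cabs z * cabs w.
Proof.
rewrite /cabs -sqrtrM ?addr_ge0 ?sqr_ge0//; congr Num.sqrt.
exact: (sqnormcM z w).
Qed.

Lemma cabs_rC (r : R) : cabs (rC r) = `|r|.
Proof. by rewrite /cabs /= expr0n addr0 sqrtr_sqr. Qed.

Lemma cabs_unit (w : C) : sqnormc w = 1 -> cabs w = 1.
Proof. by move=> h; rewrite /cabs -/(sqnormc w) h sqrtr1. Qed.

Lemma control_le p j : unimodular p -> cabs (control p j) <= strength p.
Proof.
have r1 : `|(Num.sqrt (2 : R))^-1| <= 1.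
  rewrite ger0_norm ?invr_ge0 ?sqrtr_ge0// invf_le1 ?sqrtr_gt0//.
  by rewrite -[leLHS]sqrtr1 ler_wsqrtr// ler1n.
have c0 : cabs (0 : C) = 0 by rewrite -[0]/(rC 0) cabs_rC normr0.
have ci : cabs (iC R) = 1 by apply: cabs_unit; rewrite /sqnormc /=; ring.
have cN (z : C) : cabs (- z) = cabs z.
  by rewrite /cabs -!/(sqnormc _) -[LHS]/(Num.sqrt (sqnormc (- z))) sqnormcN.
have nth_le (b : bool) (c cr cb : C) (B : R) : cabs c <= B -> cabs cr <= B -> cabs cb <= B ->
   cabs (ctl3 b c cr cb j) <= B.
  move=> h1 h2 h3; have B0 : 0 <= B by apply: le_trans h1; exact: sqrtr_ge0.
  by case: j => [[|[|[|[|[|[|//]]]]]] hj]; rewrite /ctl3 /=; case: b; rewrite /= ?c0.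
case: p => [b w al be|b w ga] /= hw; apply: nth_le;
  rewrite ?cN ?cabsM ?cabs_rC ?(cabs_unit hw) ?ci ?c0 ?mulr1 ?mul1r//.
- by rewrite lerDr.
- by rewrite normrM ler_wpDr// ler_piMr.
- by rewrite normrM ler_wpDr// ler_piMr.
- by rewrite normr0.
- by rewrite normrM ler_piMr.
- by rewrite normrM ler_piMr.
Qed.

Definition bounded_controls (B : R) (u : controls R) :=
  (forall k, cmeasurable setT (u k)) /\ forall k t, cabs (u k t) <= B.

(** The time [T0] depends on the program and on [B] alone: it is fixed before the initial state,
    which changes from one pulse to the next in the induction. *)
Lemma realize (B : R) l : 0 < B -> unimodular_prog l ->
  exists T0 : R, 0 < T0 /\ forall T, T0 < T -> forall phi0, L2state phi0 ->
   exists u, bounded_controls B u /\ exists phi,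
     solution u T phi /\ phi 0 = phi0 /\ phi T = run l phi0.
Proof.
move=> B0; elim: l => [|p l IH] /=.
  move=> _; exists 1; split => // T T1 phi0 lp.
  (* The zero pulse: after the last instruction the state rests for whatever time is left. *)
  pose p : pulse R := Mult false 1 0 0.
  have hp : unimodular p by rewrite /= /sqnormc /=; ring.
  have ep t : evolve p t phi0 = phi0.
    apply/funext => k; apply/funext => x; rewrite /= mul0r add0r mulr0.
    by rewrite rotv0.
  exists (fun j _ => control p j); split.
    split; first by move=> k; exact: cmeas_cst.
    move=> k t; apply: (le_trans (control_le k hp)).
    by rewrite /= normr0 addr0 ltW.
  exists (fun t => evolve p t phi0); split; first exact: pulse_solution.
  by rewrite !ep.
move=> [hp hl]; have [T0 [T0_gt0 h]] := IH hl.
have s0 : 0 <= strength p by case: p {hp} => *; rewrite ?addr_ge0 ?normr_ge0.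
(* Long enough that [strength p / tau <= B], and positive even for a pulse of strength 0. *)
pose tau := 1 + strength p / B.
have tau0 : 0 < tau by rewrite ltr_pwDl// divr_ge0// ltW.
exists (tau + T0); split; first by rewrite addr_gt0.
move=> T hT phi0 lp.
have hp' := unimodular_rescale tau hp.
have [le _] := evolve_isometry 1 hp lp.
have hT' : T0 < T - tau by lra.
have [u2 [[mu2 bu2] [phi2 [s2 [i2 f2]]]]] := h _ hT' _ le.
exists (fun k => concat tau (fun _ => control (rescale p tau) k) (u2 k)); split.
  split=> [k|k t].
    apply: cmeas_if; last by apply: cmeas_comp (mu2 k); exact: measurable_shift.
      by apply: measurable_fun_ler => //; exact: measurable_cst.
    exact: cmeas_cst.
  rewrite /concat; case: ifP => // _.
  apply: (le_trans (control_le k hp')).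
  have -> : strength (rescale p tau) = strength p / tau.
    exact: strength_rescale.
  rewrite ler_pdivrMr// /tau mulrDr mulr1 (mulrC B) divfK ?gt_eqF// lerDr ltW//.
exists (concat tau (fun t => evolve (rescale p tau) t phi0) phi2); split.
  rewrite -[X in solution _ X _](subrK tau T) addrC.
  apply: solution_concat => //; [by lra|exact: pulse_solution|].
  by rewrite i2 evolve_rescale// gt_eqF.
split.
  rewrite /concat (ltW tau0).
  exact: evolve0.
rewrite /concat; have -> : (T <= tau) = false by apply/negbTE; rewrite -ltNge; lra.
by rewrite f2.
Qed.

End Programs.

(** * Rotations by realizable angle functions *)

Section Trig.
Variable R : realType.

Lemma sin_le_norm (y : R) : `|sin y| <= `|y|.
Proof.
wlog y0 : y / 0 <= y.
  move=> h; have [/h//|/ltW y0] := leP 0 y.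
  by rewrite -normrN -sinN -(normrN y) h// oppr_ge0.
have ct : {within `[0, y], continuous (@sin R)}.
  by apply: continuous_subspaceT; exact: continuous_sin.
have [c _] := MVT_segment y0 (fun x _ => is_derive_sin x) ct.
rewrite sin0 !subr0 => ->; rewrite normrM ler_piMl//; exact: cos_max.
Qed.

Lemma one_sub_cos (y : R) : 1 - cos y = 2 * sin (y / 2) ^+ 2.
Proof.
have {1}-> : y = (y / 2) *+ 2 by rewrite -mulr_natr divfK ?pnatr_eq0.
by rewrite cos_mulr2n sin2cos2 -mulr_natr; ring.
Qed.

Lemma one_sub_cos_ge0 (y : R) : 0 <= 1 - cos y.
Proof. by rewrite subr_ge0 cos_le1. Qed.

Lemma one_sub_cos_le (y : R) : 1 - cos y <= y ^+ 2.
Proof.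
rewrite one_sub_cos -real_normK ?num_real//.
have := sin_le_norm (y / 2); have := normr_ge0 (sin (y / 2)).
rewrite normrM normfV (ger0_norm (ler0n R 2)) -(real_normK (num_real y)).
have := normr_ge0 y; nra.
Qed.

Lemma one_sub_cos_le1 (y : R) : 1 - cos y <= `|y|.
Proof.
rewrite one_sub_cos -real_normK ?num_real//.
have := sin_le_norm (y / 2); have := normr_ge0 (sin (y / 2)); have := sin_max (y / 2).
rewrite normrM normfV (ger0_norm (ler0n R 2)).
have := normr_ge0 y; nra.
Qed.

(** A quadratic bound is all that the Trotter argument uses: [n] steps of size [1 / n] leave an
    error [O(1 / n)]. The mean value theorem reduces it to the linear bound on [1 - cos]. *)
Lemma sin_sub_le (y : R) : `|sin y - y| <= y ^+ 2.
Proof.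
wlog y0 : y / 0 <= y.
  move=> h; have [/h//|/ltW y0] := leP 0 y.
  by have := h (- y); rewrite sinN -opprD normrN sqrrN => -> //; rewrite oppr_ge0.
have ct : {within `[0, y], continuous (fun x => sin x - x)}.
  apply: continuous_subspaceT => x; apply: cvgB; [exact: continuous_sin|exact: cvg_id].
have df (x : R) : x \in `]0, y[%R -> is_derive x 1 (fun x => sin x - x) (cos x - 1).
  by move=> _; apply: is_deriveB.
have [c] := @MVT_segment R (fun x => sin x - x) (fun x => cos x - 1) 0 y y0 df ct.
rewrite in_itv /= => /andP[c0 cy].
rewrite sin0 !subr0 => ->; rewrite normrM distrC ger0_norm ?one_sub_cos_ge0//.
rewrite expr2 ger0_norm// ler_wpM2r//.
by apply: (le_trans (one_sub_cos_le1 c)); rewrite ger0_norm.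
Qed.

End Trig.

(** * The Trotter step on vectors of [C^4] *)

Section Vectors.
Variable R : realType.
Local Notation C := R[i].
Implicit Types (u v : 'I_4 -> C).

Definition vnorm v : R := Num.sqrt (sqnormv v).

Lemma vnorm_ge0 v : 0 <= vnorm v. Proof. exact: sqrtr_ge0. Qed.

Lemma vnorm_sqr v : vnorm v ^+ 2 = sqnormv v.
Proof. by rewrite sqr_sqrtr ?sqnormv_ge0. Qed.

Lemma vnormD u v : vnorm (fun k => u k + v k) <= vnorm u + vnorm v.
Proof.
apply: sqrt_minkowski; [exact: sqnormv_ge0..|].
by move=> d d0; exact: sqnormvD_le.
Qed.

Lemma vnormZ (z : C) v : vnorm (fun k => z * v k) = cabs z * vnorm v.
Proof.
rewrite /vnorm /cabs -/(sqnormc z) -sqrtrM ?sqnormc_ge0//; congr Num.sqrt.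
by rewrite /sqnormv mulr_sumr; apply: eq_bigr => k _; rewrite sqnormcM.
Qed.

Lemma vnorm_rotv b w t v : sqnormc w = 1 -> vnorm (rotv b w t v) = vnorm v.
Proof. by move=> hw; rewrite /vnorm sqnormv_rotv. Qed.

Definition flipv (b : bool) (w : C) v : 'I_4 -> C := fun k => phase b w k * v (flip b k).

Lemma rotvE b w t v :
  rotv b w t v = fun k => rC (cos t) * v k - iC R * rC (sin t) * flipv b w v k.
Proof. by apply/funext => k; rewrite /rotv /flipv; ring. Qed.

Lemma vnorm_flipv b w v : sqnormc w = 1 -> vnorm (flipv b w v) = vnorm v.
Proof.
move=> hw; congr Num.sqrt; rewrite /sqnormv -[RHS](sum_flip b).
by apply: eq_bigr => k _; rewrite sqnormcM sqnormc_phase hw mul1r.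
Qed.

Lemma flipvK b w v : sqnormc w = 1 -> flipv b w (flipv b w v) = v.
Proof.
move=> hw; apply/funext => k; rewrite /flipv flipK phase_flip mulrA.
by rewrite phaseJ// mul1r.
Qed.

(** Multiplying the phase by [i] turns the axis by a quarter of a circle; flips about orthogonal
    axes anticommute like two Pauli matrices. *)
Lemma flipv_anticomm b w v k :
  flipv b w (flipv b (iC R * w) v) k = - flipv b (iC R * w) (flipv b w v) k.
Proof.
rewrite /flipv flipK !phase_flip /phase.
by case: (excited b k); rewrite ?(conjcM, conjciC, conjcN, conjcK); ring.
Qed.

Lemma rotv_flipv b w t v :
  rotv b w t (flipv b (iC R * w) v) = flipv b (iC R * w) (rotv b w (- t) v).
Proof.
apply/funext => k; rewrite !rotvE flipv_anticomm cosN sinN rCN /flipv.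
rewrite !phase_flip flipK; ring.
Qed.

Lemma rotv_lin b w t (x y : C) u v :
  rotv b w t (fun k => x * u k + y * v k) = fun k => x * rotv b w t u k + y * rotv b w t v k.
Proof. by apply/funext => k; rewrite /rotv; ring. Qed.

Lemma flipv_lin b w (x y : C) u v :
  flipv b w (fun k => x * u k + y * v k) = fun k => x * flipv b w u k + y * flipv b w v k.
Proof. by apply/funext => k; rewrite /flipv; ring. Qed.

(* The rotations by [f / 2] and [- f / 2] turn the axis of the middle rotation by
   opposite angles: for small [u] the product of the two steps is a rotation by
   [2 u cos f] about the original axis, up to [O(u^2)]. *)
Definition conj_rot b w (u f : R) v :=
  rotv b w (f / 2) (rotv b (iC R * w) u (rotv b w (- (f / 2)) v)).

(** Write [R_f] for the rotation about the first axis and [S'] for the flip about the second.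
    Conjugation acts on [S'] only, and anticommutation merges the two half angles:
    [R_(f/2) S' R_(-f/2) = R_f S']. *)
Lemma conj_rotE b w (u f : R) v : sqnormc w = 1 -> conj_rot b w u f v =
  fun k => rC (cos u) * v k + (- iC R * rC (sin u)) * rotv b w f (flipv b (iC R * w) v) k.
Proof.
move=> hw; rewrite /conj_rot [rotv b (iC R * w) _ _]rotvE.
rewrite (_ : (fun k => _) = fun k => rC (cos u) * rotv b w (- (f / 2)) v k +
   (- iC R * rC (sin u)) * flipv b (iC R * w) (rotv b w (- (f / 2)) v) k); last first.
  by apply/funext => k; ring.
rewrite rotv_lin rotvD// subrr rotv0; apply/funext => k; congr (_ + _ * _).
by rewrite -rotv_flipv rotvD//; congr (rotv b w _ _ k); field.
Qed.

Definition trotter_step b w (u f : R) v := conj_rot b w u f (conj_rot b w u (- f) v).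

(** The terms of first order carry [R_f S'] and [R_(-f) S'], whose sum is [2 cos f S']; this is
    where the cosine of the angle function arises. *)
Lemma trotter_stepE b w (u f : R) v : sqnormc w = 1 -> trotter_step b w u f v =
  fun k => rC (cos u ^+ 2) * v k - iC R * rC (sin (u *+ 2) * cos f) * flipv b (iC R * w) v k
     - rC (sin u ^+ 2) * rotv b w (f *+ 2) v k.
Proof.
move=> hw; have hw' : sqnormc (iC R * w) = 1.
  by rewrite sqnormcM hw mulr1 /sqnormc /=; ring.
rewrite /trotter_step conj_rotE// conj_rotE//; apply/funext => k.
rewrite flipv_lin rotv_lin -rotv_flipv flipvK// rotvD// !rotvE.
rewrite sin_mulr2n cosN sinN -(mulr2n f) -(mulr_natr (cos u * sin u)) !expr2 !rCM rCN rC2.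
have i2 := iC_sqr R.
set s := rC (sin u); set c := rC (cos u); set cf := rC (cos f); set sf := rC (sin f).
set Y := flipv b (iC R * w) v k; set F2 := rC (cos (f *+ 2)); set S2 := rC (sin (f *+ 2)).
set Z := flipv b w v k.
transitivity (c * c * v k - iC R * (s * c * 2) * cf * Y +
   (iC R * iC R) * s * s * (F2 * v k - iC R * S2 * Z)); first by ring.
by rewrite i2; ring.
Qed.

Lemma trotter_step_error b w (u f : R) v : sqnormc w = 1 ->
  vnorm (fun k => trotter_step b w u f v k - rotv b (iC R * w) (u *+ 2 * cos f) v k)
   <= 14 * u ^+ 2 * vnorm v.
Proof.
move=> hw; have hw' : sqnormc (iC R * w) = 1.
  by rewrite sqnormcM hw mulr1 /sqnormc /=; ring.
set th := u *+ 2 * cos f.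
rewrite trotter_stepE// (rotvE b (iC R * w)).
rewrite (_ : (fun k => _) = fun k => rC (cos u ^+ 2 - cos th) * v k +
   ((- iC R * rC (sin (u *+ 2) * cos f - sin th)) * flipv b (iC R * w) v k +
    (- rC (sin u ^+ 2)) * rotv b w (f *+ 2) v k)); last first.
  by apply/funext => k; rewrite !(rCD, rCN); ring.
apply: (le_trans (vnormD _ _)); rewrite vnormZ.
apply: (@le_trans _ _ (cabs (rC (cos u ^+ 2 - cos th)) * vnorm v +
   (cabs (- iC R * rC (sin (u *+ 2) * cos f - sin th)) * vnorm v +
    cabs (- rC (sin u ^+ 2)) * vnorm v))).
  rewrite lerD2l; apply: (le_trans (vnormD _ _)).
  by rewrite !vnormZ vnorm_flipv// vnorm_rotv.
(* The three coefficients are bounded below by [5 u^2], [8 u^2] and [u^2] in turn, whence the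
   constant 14. *)
rewrite -!mulrDl ler_wpM2r ?vnorm_ge0//.
have cN z : cabs (- z) = cabs z :> R.
  by rewrite /cabs -!/(sqnormc _) -[LHS]/(Num.sqrt (sqnormc (- z))) sqnormcN.
rewrite !cabsM !cN (cabs_unit (w := iC R)) ?mul1r; last by rewrite /sqnormc /=; ring.
rewrite !cabs_rC.
have su : sin u ^+ 2 <= u ^+ 2.
  rewrite -(real_normK (num_real (sin u))) -(real_normK (num_real u)).
  by rewrite ler_pXn2r ?nnegrE// sin_le_norm.
have s0 := sqr_ge0 (sin u).
have cf2 : cos f ^+ 2 <= 1.
  by rewrite -real_normK ?num_real// expr_le1// cos_max.
have cf0 := sqr_ge0 (cos f).
have th2 : th ^+ 2 <= 4 * u ^+ 2.
  rewrite /th -mulr_natr !exprMn; have := sqr_ge0 u; nra.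
have h1 : `|cos u ^+ 2 - cos th| <= 5 * u ^+ 2.
  have := one_sub_cos_le th; have := one_sub_cos_ge0 th; rewrite cos2sin2 ler_norml; lra.
have h2 : `|sin (u *+ 2) * cos f - sin th| <= 8 * u ^+ 2.
  have -> : sin (u *+ 2) * cos f - sin th =
    (sin (u *+ 2) - u *+ 2) * cos f - (sin th - th) by rewrite /th; ring.
  apply: (le_trans (ler_normB _ _)); rewrite normrM.
  have a1 : `|sin (u *+ 2) - u *+ 2| * `|cos f| <= 4 * u ^+ 2.
    have := sin_sub_le (u *+ 2).
    rewrite [X in _ <= X](_ : _ = 4 * u ^+ 2); last by rewrite -mulr_natr; ring.
    by apply: le_trans; rewrite ler_piMr// cos_max.
  have := sin_sub_le th; lra.
rewrite [`|sin u ^+ 2|]ger0_norm//.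
have := sqr_ge0 u; lra.
Qed.

End Vectors.

(** * Strong closure of programs and the class of realizable angles *)

Section Approximable.
Variable R : realType.
Local Notation C := R[i].

(** Membership in the strong closure: the program may depend on the state as well as on the
    precision. *)
Definition approximable (S : state R -> state R) : Prop :=
  (forall phi, L2state phi -> L2state (S phi)) /\
  forall phi (e : R), L2state phi -> 0 < e ->
    exists2 l, unimodular_prog l & dist (run l phi) (S phi) < e.

(** The second program is an isometry, so the error made by the first one is carried along
    unchanged. *)
Lemma approximable_comp S1 S2 : approximable S1 -> approximable S2 ->
  approximable (fun phi => S2 (S1 phi)).
Proof.
move=> [p1 a1] [p2 a2]; split=> [phi lp|phi e lp e0]; first by apply: p2; exact: p1.
have e2 : 0 < e / 2 by rewrite divr_gt0.
have [l2 h2 d2] := a2 _ _ (p1 _ lp) e2.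
have [l1 h1 d1] := a1 _ _ lp e2.
exists (l1 ++ l2); first exact: unimodular_prog_cat.
rewrite run_cat.
have q1 := run_L2 h1 lp; have q2 := run_L2 h2 q1; have q3 := p1 _ lp; have q4 := p2 _ q3.
apply: (le_lt_trans (dist_triangle q2 (run_L2 h2 q3) q4)).
by rewrite run_dist//; lra.
Qed.

Lemma approximable_pulse p : unimodular p -> approximable (evolve p 1).
Proof.
move=> hp; split=> [phi lp|phi e lp e0]; first by have [] := evolve_isometry 1 hp lp.
by exists [:: p]; rewrite //= dist0.
Qed.

Lemma approximable_iter n S : approximable S -> approximable (iter n S).
Proof.
move=> aS; elim: n => [|n IH]; last exact: (approximable_comp IH aS).
by split=> // phi e lp e0; exists [::]; rewrite //= dist0.
Qed.

Lemma approximable_ext S S' : (forall phi, S phi = S' phi) ->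
  approximable S -> approximable S'.
Proof. by move=> /funext ->. Qed.

(** Contraction at every point supplies the domination, so that pointwise convergence of the
    operators implies strong convergence. *)
Lemma approximable_cvg (Sn : nat -> state R -> state R) S :
  (forall n, approximable (Sn n)) -> (forall phi, L2state phi -> mstate (S phi)) ->
  (forall n phi x, sqnormv (Sn n phi ^~ x) <= sqnormv (phi ^~ x)) ->
  (forall phi x, sqnormv (S phi ^~ x) <= sqnormv (phi ^~ x)) ->
  (forall phi x, (fun n => sqnormv (sub_state (Sn n phi) (S phi) ^~ x)) @ \oo --> (0 : R)) ->
  approximable S.
Proof.
move=> an mS bn b cv.
have lS phi : L2state phi -> L2state (S phi).
  by move=> lp; apply: (L2state_dom (c := 1) (mS _ lp) lp) => x; rewrite mul1r.
split=> // phi e lp e0; have e2 : 0 < e / 2 by rewrite divr_gt0.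
have ln n : L2state (Sn n phi) by have [h _] := an n; exact: h.
have hb n x : sqnormv (sub_state (Sn n phi) (S phi) ^~ x) <= 4 * sqnormv (phi ^~ x).
  apply: (le_trans (sqnormv_sub_le _ _)).
  by have := bn n phi x; have := b phi x; lra.
have mn n : mstate (Sn n phi) by have /L2stateP[] := ln n.
have h := cvg_dist_dom mn (mS _ lp) lp hb (cv phi).
have e22 : 0 < (e / 2) ^+ 2 by rewrite exprn_gt0.
have [n _ hn] := cvgr_lt (0 : R) h _ e22.
have {}hn : dist (Sn n phi) (S phi) < e / 2.
  by apply: sqnorm_lt_norm4 => //; [exact: L2stateB (ln n) (lS _ lp)|exact: (hn n (leqnn n))].
have [_ a] := an n; have [l hl dl] := a phi _ lp e2.
exists l => //.
apply: (le_lt_trans (dist_triangle (run_L2 hl lp) (ln n) (lS _ lp))); lra.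
Qed.

Definition rotop (b : bool) (w : C) (f : R -> R) (phi : state R) : state R :=
  fun k x => rotv b w (f x) (phi ^~ x) k.

Lemma mstate_rotop b w f phi : measurable_fun [set: R] f -> mstate phi ->
  mstate (rotop b w f phi).
Proof.
move=> mf mp k; rewrite /rotop /rotv; apply: cmeasB.
  apply: cmeasM (mp k); apply: cmeasrC; apply: (measurableT_comp _ mf).
  by apply: continuous_measurable_fun; exact: continuous_cos.
apply: cmeasM (mp (flip b k)); apply: cmeasM; last exact: cmeas_cst.
apply: cmeasM; first exact: cmeas_cst.
apply: cmeasrC; apply: (measurableT_comp _ mf).
by apply: continuous_measurable_fun; exact: continuous_sin.
Qed.

Lemma rotopD b w f g phi : sqnormc w = 1 ->
  rotop b w f (rotop b w g phi) = rotop b w (fun x => f x + g x) phi.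
Proof.
move=> hw; apply/funext => k; apply/funext => x.
by rewrite -[LHS]/(rotv b w (f x) (rotv b w (g x) (phi ^~ x)) k) rotvD.
Qed.

(** Quantifying over the multiple [c] and the axis [w] builds in closure under scaling and lets the
    Trotter argument use two orthogonal axes at once. *)
Definition angle (b : bool) (f : R -> R) : Prop :=
  measurable_fun [set: R] f /\
  forall (c : R) w, sqnormc w = 1 -> approximable (rotop b w (fun x => c * f x)).

Lemma angle_affine b (al be : R) : angle b (fun x => al * x + be).
Proof.
split.
  by apply: measurable_funD => //; exact: measurable_funM.
move=> c w hw; have hp : unimodular (Mult b w (c * al) (c * be)) by [].
apply: approximable_ext (approximable_pulse hp) => phi.
apply/funext => k; apply/funext => x /=; rewrite /rotop.
by congr (rotv b w _ _ k); ring.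
Qed.

Lemma angle_ext b f g : f =1 g -> angle b f -> angle b g.
Proof. by move=> /funext ->. Qed.

Lemma angle_cst b (c : R) : angle b (fun=> c).
Proof. by apply: angle_ext (angle_affine b 0 c) => x; rewrite mul0r add0r. Qed.

Lemma angleD b f g : angle b f -> angle b g -> angle b (fun x => f x + g x).
Proof.
move=> [mf af] [mg ag]; split; first exact: measurable_funD.
move=> c w hw; apply: approximable_ext (approximable_comp (ag c w hw) (af c w hw)) => phi.
by rewrite rotopD//; congr rotop; apply/funext => x; rewrite mulrDr.
Qed.

Lemma angleZ b (r : R) f : angle b f -> angle b (fun x => r * f x).
Proof.
move=> [mf af]; split; first exact: measurable_funM.
move=> c w hw; apply: approximable_ext (af (c * r) w hw) => phi.
by congr rotop; apply/funext => x; rewrite mulrA.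
Qed.

Lemma angle_rot b f w : angle b f -> sqnormc w = 1 -> approximable (rotop b w f).
Proof.
move=> [_ af] hw; apply: approximable_ext (af 1 w hw) => phi.
by congr rotop; apply/funext => x; rewrite mul1r.
Qed.

Lemma cvg_rotv b w (th : nat -> R) (t : R) (v : 'I_4 -> C) :
  th @ \oo --> t ->
  (fun n => sqnormv (fun k => rotv b w (th n) v k - rotv b w t v k)) @ \oo --> (0 : R).
Proof.
move=> ct; rewrite /sqnormv.
have ck k : (fun n => sqnormc (rotv b w (th n) v k - rotv b w t v k)) @ \oo --> (0 : R).
  have cr : ccontinuous (fun s : R => rotv b w s v k - rotv b w t v k).
    apply: ccontinuousB; last exact: ccontinuous_cst.
    by apply: (continuous_rotv_arg b w (f := fun s => s)) => s; exact: cvg_id.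
  have hq : sqnormc (rotv b w s v k - rotv b w t v k) @[s --> t] -->
      sqnormc (rotv b w t v k - rotv b w t v k) by exact: (ccontinuous_sqnormc cr).
  by have := cvg_comp _ _ ct hq; rewrite subrr sqnormc0.
pose d k n := sqnormc (rotv b w (th n) v k - rotv b w t v k).
rewrite (_ : (fun n => _) = (fun n => d 0 n + d 1 n + d 2%R n + d 3%R n)); last first.
  by apply/funext => n; rewrite big_I4.
have := cvgD (cvgD (cvgD (ck 0) (ck 1)) (ck 2%R)) (ck 3%R).
by rewrite !addr0 => h; exact: h.
Qed.

Lemma angle_cvg b (F : nat -> R -> R) (f : R -> R) : (forall n, angle b (F n)) ->
  measurable_fun [set: R] f -> (forall x, (fun n => F n x) @ \oo --> (f x : R)) -> angle b f.
Proof.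
move=> aF mf cF; split=> // c w hw.
apply: (approximable_cvg (Sn := fun n => rotop b w (fun x => c * F n x))).
- by move=> n; have [_ h] := aF n; exact: h.
- by move=> phi /L2stateP[mp _]; apply: mstate_rotop => //; exact: measurable_funM.
- by move=> n phi x; rewrite sqnormv_rotv.
- by move=> phi x; rewrite sqnormv_rotv.
- move=> phi x; apply: (cvg_rotv b w (th := fun n => c * F n x)).
  by apply: cvgM; [exact: cvg_cst|exact: cF].
Qed.

(** Trotter's product: [n + 1] steps, each a rotation by [c g cos f / (n + 1)] up to [O(1 / n^2)].
    The steps are isometries, so the total error is [O(1 / n)] at each point. *)
Lemma angle_mul_cos b f g : angle b f -> angle b g -> angle b (fun x => g x * cos (f x)).
Proof.
move=> af ag; have [mf _] := af; have [mg _] := ag.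
have mc : measurable_fun [set: R] (fun x => cos (f x)).
  apply: (measurableT_comp _ mf); apply: continuous_measurable_fun; exact: continuous_cos.
split=> [|c w hw]; first exact: measurable_funM.
(* A step built on the phase [w'] rotates about [i w']; this choice makes that axis equal to [w]. *)
pose w' := - iC R * w.
have hw' : sqnormc w' = 1 by rewrite sqnormcM hw mulr1 /sqnormc /=; ring.
have ww' : iC R * w' = w by rewrite /w' mulrA mulrN iC_sqr opprK mul1r.
(* The 2 compensates the doubling of the small angle in one Trotter step. *)
pose u n x := c * g x / (2 * n.+1%:R).
pose S n phi := (rotop b w' (fun x => f x / 2) (rotop b w (u n) (rotop b w' (fun x => - (f x / 2)) phi))).
pose S' n phi := (rotop b w' (fun x => - f x / 2) (rotop b w (u n) (rotop b w' (fun x => - (- f x / 2)) phi))).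
pose Q n phi := S n (S' n phi).
have az (r : R) h (w0 : C) : angle b h -> sqnormc w0 = 1 ->
    approximable (rotop b w0 (fun x => r * h x)) by move=> [_ ah]; exact: ah.
have aQ n : approximable (Q n).
  have au : approximable (rotop b w (u n)).
    apply: approximable_ext (az (c / (2 * n.+1%:R)) _ _ ag hw) => phi.
    by congr rotop; apply/funext => x; rewrite /u; ring.
  have ap (r : R) (h : R -> R) : (forall x, h x = r * f x) -> approximable (rotop b w' h).
    by move=> /funext ->; exact: az.
  have ap1 : approximable (rotop b w' (fun x => f x / 2)) by apply: (ap 2^-1) => x; ring.
  have ap2 : approximable (rotop b w' (fun x => - (f x / 2))) by apply: (ap (- 2^-1)) => x; ring.
  have ap3 : approximable (rotop b w' (fun x => - f x / 2)) by apply: (ap (- 2^-1)) => x; ring.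
  have ap4 : approximable (rotop b w' (fun x => - (- f x / 2))) by apply: (ap 2^-1) => x; ring.
  exact: (approximable_comp (approximable_comp (approximable_comp ap4 au) ap3)
    (approximable_comp (approximable_comp ap2 au) ap1)).
have QE n phi x : (Q n phi) ^~ x = trotter_step b w' (u n x) (f x) (phi ^~ x).
  by apply/funext => k; rewrite /trotter_step /conj_rot ww'.
have itE n m phi x : (iter m (Q n) phi) ^~ x =
    iter m (trotter_step b w' (u n x) (f x)) (phi ^~ x).
  elim: m => // m IH; rewrite [LHS]QE [RHS]iterS -IH.
  by [].
have tn n x m v : vnorm (iter m (trotter_step b w' (u n x) (f x)) v) = vnorm v.
  elim: m => // m IH; rewrite iterS -[RHS]IH.
  by rewrite /trotter_step /conj_rot ww' !vnorm_rotv.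
(* Telescoping: the error accumulated so far is preserved by the next step, which adds one local
   error. *)
have err n x m v : vnorm (fun k => iter m (trotter_step b w' (u n x) (f x)) v k -
    rotv b w (m%:R * (u n x *+ 2 * cos (f x))) v k) <= m%:R * (14 * u n x ^+ 2 * vnorm v).
  elim: m => [|m IH].
    rewrite mul0r rotv0 mul0r (_ : (fun k => _) = fun k => 0 * v k); last first.
      by apply/funext => k; rewrite subrr mul0r.
    by rewrite vnormZ -[0]/(rC 0) cabs_rC normr0 mul0r.
  set T := trotter_step _ _ _ _; set th := u n x *+ 2 * cos (f x).
  set z := iter m T v; set z' := rotv b w (m%:R * th) v.
  have -> : rotv b w (m.+1%:R * th) v = rotv b w th z'.
    by rewrite /z' rotvD//; congr rotv; rewrite -natr1; ring.
  have Tlin p q k : T p k - T q k = T (fun k => p k - q k) k.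
    by rewrite /T /trotter_step /conj_rot /rotv; ring.
  rewrite iterS -/z (_ : (fun k => _) = fun k => T (fun k => z k - z' k) k +
    (T z' k - rotv b w th z' k)); last first.
    by apply/funext => k; rewrite -Tlin; ring.
  apply: (le_trans (vnormD _ _)).
  have -> : vnorm (T (fun k => z k - z' k)) = vnorm (fun k => z k - z' k).
    by have := tn n x 1%N (fun k => z k - z' k).
  have := trotter_step_error b (u n x) (f x) z' hw'; rewrite ww' -/T -/th.
  have -> : vnorm z' = vnorm v by rewrite vnorm_rotv.
  move: IH; rewrite -/T -/z -/th -/z' -natr1 mulrDl mul1r; lra.
apply: (approximable_cvg (Sn := fun n => iter n.+1 (Q n))).
- by move=> n; exact: approximable_iter.
- by move=> phi /L2stateP[mp _]; apply: mstate_rotop => //; do !apply: measurable_funM => //.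
- by move=> n phi x; rewrite itE -!vnorm_sqr tn.
- by move=> phi x; rewrite sqnormv_rotv.
move=> phi x; set v := phi ^~ x.
(* One of the two factors [1 / (n + 1)] in [u^2] cancels against the number of steps. *)
pose K : R := 14 * (c * g x / 2) ^+ 2 * vnorm v.
have b1 n : vnorm (sub_state (iter n.+1 (Q n) phi) (rotop b w (fun x => c * (g x * cos (f x))) phi) ^~ x)
    <= K * n.+1%:R^-1.
  have -> : (sub_state (iter n.+1 (Q n) phi) (rotop b w (fun x => c * (g x * cos (f x))) phi) ^~ x) =
    fun k => iter n.+1 (trotter_step b w' (u n x) (f x)) v k -
      rotv b w (n.+1%:R * (u n x *+ 2 * cos (f x))) v k.
    have ang : n.+1%:R * (u n x *+ 2 * cos (f x)) = c * (g x * cos (f x)).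
      rewrite /u -mulr_natr; have := pnatr_eq0 R n.+1; move: (n.+1%:R : R) => q /negbT q0.
      by field.
    by apply/funext => k; rewrite /sub_state -itE ang.
  apply: (le_trans (err n x n.+1 v)); rewrite /K /u le_eqVlt; apply/orP; left; apply/eqP.
  by have := pnatr_eq0 R n.+1; move: (n.+1%:R : R) => q /negbT q0; field.
pose vn n := vnorm (sub_state (iter n.+1 (Q n) phi)
    (rotop b w (fun x => c * (g x * cos (f x))) phi) ^~ x).
have c1 : vn @ \oo --> (0 : R).
  apply: (@squeeze_cvgr _ _ _ _ (cst 0) (fun n => K * n.+1%:R^-1)).
  - by apply: nearW => n; rewrite vnorm_ge0 b1.
  - exact: cvg_cst.
  - rewrite -[X in _ --> X](mulr0 K); apply: cvgM; [exact: cvg_cst|exact: cvg_harmonic].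
have h := cvgM c1 c1; rewrite mul0r in h.
rewrite (_ : (fun n => _) = (fun n => vn n * vn n)); first exact: h.
by apply/funext => n; rewrite -expr2 vnorm_sqr.
Qed.

(** A phase shift by [pi / 2] turns the cosine into a sine, and [n sin (f / n)] tends to [f]. *)
Lemma angleM b f g : angle b f -> angle b g -> angle b (fun x => f x * g x).
Proof.
move=> af ag; have [mf _] := af; have [mg _] := ag.
apply: (angle_cvg (F := fun n x => n.+1%:R * (g x * cos (n.+1%:R^-1 * f x + - (pi / 2))))).
- move=> n; have h := angleD (angleZ n.+1%:R^-1 af) (angle_cst b (- (pi / 2))).
  exact: (angleZ n.+1%:R (angle_mul_cos h ag)).
- exact: measurable_funM.
move=> x; set y := f x.
under eq_fun do rewrite cosBpihalf mulrCA.
rewrite (mulrC y); apply: cvgM; first exact: cvg_cst.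
apply/cvgrPdist_le => e e0.
have h : (fun n => n.+1%:R^-1 * y ^+ 2) @ \oo --> (0 : R).
  rewrite -[X in _ --> X](mul0r (y ^+ 2)).
  by apply: cvgM; [exact: cvg_harmonic|exact: cvg_cst].
have [N _ hN] := cvgr_lt (0 : R) h _ e0; exists N => // n nN.
have {}hN := hN n nN; rewrite /= in hN.
have n0 : (n.+1%:R : R) != 0 by rewrite pnatr_eq0.
have -> : y - n.+1%:R * sin (n.+1%:R^-1 * y) =
   - (n.+1%:R * (sin (n.+1%:R^-1 * y) - n.+1%:R^-1 * y)) by field.
rewrite normrN normrM ger0_norm//; apply: le_trans (ltW hN).
apply: (@le_trans _ _ (n.+1%:R * (n.+1%:R^-1 * y) ^+ 2)).
  by rewrite ler_wpM2l// sin_sub_le.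
by rewrite le_eqVlt; apply/orP; left; apply/eqP; rewrite /GRing.exp /=; field.
Qed.

Lemma angle_sum b n (F : nat -> R -> R) : (forall k, angle b (F k)) ->
  angle b (fun x => \sum_(0 <= k < n) F k x).
Proof.
move=> aF; elim: n => [|n IH].
  by apply: angle_ext (angle_cst b 0) => x; rewrite big_geq.
apply: angle_ext (angleD IH (aF n)) => x; by rewrite big_nat_recr.
Qed.

Lemma angleX b f n : angle b f -> angle b (fun x => f x ^+ n).
Proof.
move=> af; elim: n => [|n IH]; first exact: (angle_cst b 1).
by apply: angle_ext (angleM af IH) => x; rewrite exprS.
Qed.

Lemma angle_exp b f : angle b f -> angle b (fun x => expR (f x)).
Proof.
move=> af; have [mf _] := af.
apply: (angle_cvg (F := fun n x => \sum_(0 <= k < n) exp_coeff (f x) k)).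
- move=> n; apply: angle_sum => k; rewrite /exp_coeff.
  by apply: angle_ext (angleZ (k`!%:R^-1) (angleX k af)) => x; rewrite mulrC.
- apply: (measurableT_comp _ mf); apply: continuous_measurable_fun; exact: continuous_expR.
- by move=> x; exact: (is_cvg_series_exp_coeff (f x)).
Qed.

Definition below (a x : R) : R := if x < a then 1 else 0.

Lemma measurable_below a : measurable_fun [set: R] (below a).
Proof. by apply: measurable_fun_ifT => //; exact: measurable_fun_ltr. Qed.

Lemma angle_below b (a : R) : angle b (below a).
Proof.
(* This exponent tends to minus infinity for [x < a] and to plus infinity for [x >= a]; the [+ 1]
   decides the point [x = a], so that the limit is the indicator everywhere. *)
pose m (n : nat) (x : R) : R := n%:R * (n%:R * (x - a) + 1).
apply: (angle_cvg (F := fun n x => expR (-1 * expR (m n x)))).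
- move=> n; have h : angle b (m n).
    apply: angle_ext (angle_affine b (n%:R * n%:R) (n%:R * (1 - n%:R * a))) => x.
    by rewrite /m; ring.
  exact: (angle_exp (angleZ (-1) (angle_exp h))).
- exact: measurable_below.
move=> x; rewrite /below; under eq_fun do rewrite mulN1r.
case: (ltP x a) => h.
  have cN : (fun n => 1 - expR (- n%:R : R)) @ \oo --> (1 : R).
    rewrite -[X in _ --> X](subr0 1); apply: cvgB; [exact: cvg_cst|exact: cvgn_expR].
  apply: (@squeeze_cvgr _ _ _ _ (fun n => 1 - expR (- n%:R : R)) (cst 1)) => //; last exact: cvg_cst.
  near=> n.
  (* From here on [n (x - a) + 1 <= -1], hence the exponent is at most [- n]. *)
  have n1 : 2 / (a - x) <= n%:R by near: n; exact: nbhs_infty_ger.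
  have : 2 <= n%:R * (a - x) by rewrite -ler_pdivrMr// subr_gt0.
  move=> n2; have n0 : 0 <= n%:R :> R by [].
  have mn : m n x <= - n%:R.
    rewrite (_ : m n x = n%:R * (1 - n%:R * (a - x))); last by rewrite /m; ring.
    by rewrite -[leRHS]mulrN1 ler_wpM2l//; lra.
  rewrite -[X in _ && (_ <= X)]expR0 ler_expR oppr_le0 expR_ge0 andbT.
  apply: le_trans (expR_ge1Dx _); rewrite lerD2l lerN2.
  by rewrite ler_expR.
apply: (@squeeze_cvgr _ _ _ _ (cst 0) (fun n => expR (- n%:R : R))); last 2 first.
- exact: cvg_cst.
- exact: cvgn_expR.
apply: nearW => n; rewrite expR_ge0 ler_expR lerN2 /=.
apply: le_trans (expR_ge1Dx _); rewrite /m.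
have n0 : 0 <= n%:R :> R by [].
have : 0 <= n%:R * (n%:R * (x - a)) by rewrite !mulr_ge0// subr_ge0.
lra.
Unshelve. all: by end_near. Qed.

End Approximable.

(** * Steering *)

Section Steering.
Variable R : realType.
Local Notation C := R[i].

Definition steered (e : R) (phi psi : state R) : Prop :=
  exists2 l, unimodular_prog l & dist (run l phi) psi < e.

Definition reachable (phi psi : state R) : Prop :=
  [/\ L2state phi, L2state psi & forall e, 0 < e -> steered e phi psi].

Lemma dist_steered e phi psi : dist phi psi < e -> steered e phi psi.
Proof. by exists [::]. Qed.

Lemma steered_trans e1 e2 phi psi chi : L2state phi -> L2state psi -> L2state chi ->
  steered e1 phi psi -> steered e2 psi chi -> steered (e1 + e2) phi chi.
Proof.
move=> l1 l2 l3 [p hp dp] [q hq dq]; exists (p ++ q); first exact: unimodular_prog_cat.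
rewrite run_cat; have lp := run_L2 hp l1.
have h := dist_triangle (run_L2 hq lp) (run_L2 hq l2) l3.
by rewrite run_dist// in h; lra.
Qed.

(** The inverse program is an isometry that takes the image of [phi] back to [phi] exactly. *)
Lemma steered_sym e phi psi : L2state phi -> L2state psi ->
  steered e phi psi -> steered e psi phi.
Proof.
move=> l1 l2 [p hp dp]; have hq := unimodular_inv_prog hp; exists (inv_prog p) => //.
have lp := run_L2 hp l1.
by rewrite -{1}(inv_progK phi hp) run_dist// distC.
Qed.

Lemma reachable_refl phi : L2state phi -> reachable phi phi.
Proof. by move=> lp; split => // e e0; apply: dist_steered; rewrite dist0. Qed.

Lemma reachable_trans phi psi chi : reachable phi psi -> reachable psi chi ->
  reachable phi chi.
Proof.
move=> [l1 l2 h1] [_ l3 h2]; split => // e e0.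
have e2 : 0 < e / 2 by rewrite divr_gt0.
rewrite (splitr e); exact: (steered_trans l1 l2 l3 (h1 _ e2) (h2 _ e2)).
Qed.

Lemma reachable_approximable S phi : approximable S -> L2state phi -> reachable phi (S phi).
Proof. by move=> [p a] lp; split => //; [exact: p|move=> e e0; exact: a]. Qed.

Lemma reachable_rotop b w f phi : sqnormc w = 1 -> angle b f -> L2state phi ->
  reachable phi (rotop b w f phi).
Proof. by move=> hw af lp; apply: reachable_approximable => //; exact: angle_rot. Qed.

(** The translation flow with the diagonal matrix of entries 1 (ground) and -1 (excited) in place of
    the flip: ground levels move right by [m], excited ones left. *)
Definition drift (b : bool) (m : R) (phi : state R) : state R :=
  fun k x => phi k (if excited b k then x + m else x - m).

Lemma cos_piquarter_sin : cos (pi / 4) = sin (pi / 4) :> R /\ 2 * cos (pi / 4) ^+ 2 = 1 :> R.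
Proof.
have E : pi / 2 - pi / 4 = pi / 4 :> R by field.
have h : cos (pi / 4) = sin (pi / 4) :> R.
  by rewrite -[in RHS]E sinB sin_pihalf cos_pihalf mul1r mul0r subr0.
by split => //; rewrite mulr2n mulrDl mul1r {2}h; exact: cos2Dsin2.
Qed.

(* Rotations of angle [pi / 4] conjugate the flip occurring in a shift pulse to a
   diagonal matrix with entries [1] and [- 1]. *)
Lemma approximable_drift b m : approximable (drift b m).
Proof.
have hi : sqnormc (iC R) = 1 by rewrite /sqnormc /=; ring.
have h1 : sqnormc (1 : C) = 1 by rewrite /sqnormc /=; ring.
have hp : unimodular (Shift b 1 m) by exact: h1.
have a1 := angle_rot (angle_cst b (pi / 4)) hi.
have a2 := angle_rot (angle_cst b (- (pi / 4))) hi.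
apply: approximable_ext (approximable_comp (approximable_comp a2 (approximable_pulse hp)) a1) => phi.
apply/funext => k; apply/funext => x.
rewrite /rotop /rotv /evolve /drift cosN sinN flipK mulr1.
have [<- hc] := cos_piquarter_sin; move: hc; move: (cos (pi / 4)) => c hc.
have {}hc : 2 * (rC c * rC c) = 1 :> C by rewrite -rC2 -!rCM -expr2 hc.
have h2 : rC 2^-1 * 2 = 1 :> C by rewrite -rC2 -rCM mulVf ?pnatr_eq0.
have i2 := iC_sqr R.
rewrite rCN /phase excited_flip conjciC conjc1 if_same mulr1; case: (excited b k) => /=.
all: set A := phi k (x + m); set B := phi k (x - m);
  set A' := phi (flip b k) (x + m); set B' := phi (flip b k) (x - m).
  transitivity (rC 2^-1 * (rC c * rC c) *
    ((B - iC R * iC R * B' + A - iC R * iC R * A' + B' + iC R * iC R * B - A' - iC R * iC R * A) +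
     iC R * iC R * (B' + iC R * iC R * B + A' + iC R * iC R * A + B - iC R * iC R * B' - A + iC R * iC R * A')));
    first by ring.
  rewrite i2; transitivity ((rC 2^-1 * 2) * (2 * (rC c * rC c)) * A); first by ring.
  by rewrite h2 hc !mul1r.
transitivity (rC 2^-1 * (rC c * rC c) *
    ((B + iC R * iC R * B' + A + iC R * iC R * A' + B' - iC R * iC R * B - A' + iC R * iC R * A) -
     iC R * iC R * (B' - iC R * iC R * B + A' - iC R * iC R * A + B + iC R * iC R * B' - A - iC R * iC R * A')));
    first by ring.
rewrite i2; transitivity ((rC 2^-1 * 2) * (2 * (rC c * rC c)) * B); first by ring.
by rewrite h2 hc !mul1r.
Qed.

Lemma reachable_drift b m phi : L2state phi -> reachable phi (drift b m phi).
Proof. by apply: reachable_approximable; exact: approximable_drift. Qed.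

(** Half-open on purpose: after a drift by [K] the excited levels live in [[-2K, 0)] and the ground
    levels in [[0, 2K)], so the sign of [x] separates them without overlap at 0. *)
Definition supported (K : R) (phi : state R) : Prop :=
  forall k x, ~~ ((- K <= x) && (x < K)) -> phi k x = 0.

(* the drift separates the two levels of ion [b], a flip on the half-line [x < 0]
   then brings both to the ground level *)
Lemma reachable_ground b (K : R) phi : 0 <= K -> L2state phi -> supported K phi ->
  exists psi, [/\ reachable phi psi, supported (2 * K) psi,
    (forall k x, excited b k -> psi k x = 0) &
    ((forall k x, excited (~~ b) k -> phi k x = 0) ->
      forall k x, excited (~~ b) k -> psi k x = 0)].
Proof.
move=> K0 lp sp.
have h1 : sqnormc (1 : C) = 1 by rewrite /sqnormc /=; ring.
pose chi := drift b K phi.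
have rc : reachable phi chi by exact: reachable_drift.
have [_ lc _] := rc.
pose psi := rotop b 1 (fun x => (pi / 2) * below 0 x) chi.
have rp : reachable chi psi by apply: reachable_rotop => //; apply: angleZ; exact: angle_below.
have psiE k x : psi k x = if x < 0 then - iC R * phase b 1 k * chi (flip b k) x else chi k x.
  rewrite /psi /rotop /rotv /below; case: ifP => _.
    by rewrite mulr1 cos_pihalf sin_pihalf rC0 rC1; ring.
  by rewrite mulr0 cos0 sin0 rC0 rC1; ring.
exists psi; split; first exact: reachable_trans rc rp.
- move=> k x hx; rewrite psiE /chi /drift !sp ?mulr0 ?if_same//; case: ifP => _; lra.
- move=> k x ek; rewrite psiE /chi /drift excited_flip ek /=.
  by case: (ltP x 0) => h; rewrite sp ?mulr0//; lra.
(* Everything acts on ion [b] alone, so the other ion stays in its ground levels; this allows the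
   two ions to be treated one after the other. *)
- move=> hphi k x ek; rewrite psiE /chi /drift !hphi ?excited_flipN// mulr0.
  by case: ifP.
Qed.

(** States with the second ion in its ground level: [g] on [gg] and [e] on [eg]. Operations on the
    first ion preserve this form. *)
Definition levels (g e : R -> C) : state R :=
  fun k x => if k == 0%R then g x else if k == 1%R then e x else 0.

Lemma levels_ext phi g e : (forall x, phi 0%R x = g x) -> (forall x, phi 1%R x = e x) ->
  (forall x, phi 2%R x = 0) -> (forall x, phi 3%R x = 0) -> phi = levels g e.
Proof.
move=> h0 h1 h2 h3; apply/funext => k; apply/funext => x.
by elim/I4_ind: k; rewrite /levels /= ?h0 ?h1 ?h2 ?h3.
Qed.

Lemma reachable_scalar K phi : 0 <= K -> L2state phi -> supported K phi ->
  exists2 f, L2fun f & reachable phi (levels f (fun=> 0)).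
Proof.
move=> K0 lp sp.
have [psi [r1 s1 g1 _]] := reachable_ground true K0 lp sp.
have K2 : 0 <= 2 * K by lra.
have [_ lpsi _] := r1.
have [chi [r2 _ g2 k2]] := reachable_ground false K2 lpsi s1.
have {}k2 := k2 g1; exists (chi 0%R); first by have [_ l _] := r2.
suff <- : chi = levels (chi 0%R) (fun=> 0) by exact: reachable_trans r1 r2.
by apply: levels_ext => // x; ((by rewrite g2) || (by rewrite k2)).
Qed.

Lemma truncation_steered phi (e : R) : L2state phi -> 0 < e ->
  exists K psi, [/\ 0 <= K, L2state psi, supported K psi & dist phi psi < e].
Proof.
move=> lp e0; have /L2stateP[mp ip] := lp.
pose F (n : nat) : state R := fun k x => if (- n%:R <= x) && (x < n%:R) then phi k x else 0.
have mF n : mstate (F n).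
  move=> k; apply: (cmeas_if (f := phi k) (g := fun=> 0)); [|exact: mp|exact: cmeas_cst].
  by apply: measurable_and; [exact: measurable_fun_ler|exact: measurable_fun_ltr].
have hF n x : sqnormv (F n ^~ x) <= 1 * sqnormv (phi ^~ x).
  rewrite mul1r; case E : ((- n%:R <= x) && (x < n%:R)).
    by rewrite (_ : F n ^~ x = phi ^~ x)//; apply/funext => k; rewrite /F E.
  rewrite {1}/sqnormv big1 ?sqnormv_ge0// => k _; rewrite /F E; exact: sqnormc0.
have lF n : L2state (F n) by exact: (L2state_dom (mF n) lp (hF n)).
have hb n x : sqnormv (sub_state (F n) phi ^~ x) <= 4 * sqnormv (phi ^~ x).
  by apply: (le_trans (sqnormv_sub_le _ _)); have := hF n x; lra.
have cF x : (fun n => sqnormv (sub_state (F n) phi ^~ x)) @ \oo --> (0 : R).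
  apply: cvg_near_cst; exists (Num.bound `|x|).+1 => // n /= hn.
  have xn : `|x| < n%:R.
    apply: (lt_trans (archi_boundP (normr_ge0 x))); by rewrite ltr_nat.
  have -> : sub_state (F n) phi ^~ x = fun=> 0.
    apply/funext => k; rewrite /sub_state /F; move: xn; rewrite ltr_norml => /andP[a b].
    by rewrite (ltW a) b subrr.
  by rewrite /sqnormv big1// => k _; exact: sqnormc0.
have h := cvg_dist_dom mF mp lp hb cF.
have e2 : 0 < e ^+ 2 by rewrite exprn_gt0.
have [n _ hn] := cvgr_lt (0 : R) h _ e2.
exists n%:R, (F n); split => //; first by move=> k x /negbTE hx; rewrite /F hx.
by rewrite distC//; apply: sqnorm_lt_norm4 => //; [exact: L2stateB|exact: (hn n (leqnn n))].
Qed.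

End Steering.

(** * Merging the cells of a step function *)

Section Merging.
Variable R : realType.
Local Notation C := R[i].

Definition on_cell (s p th x : R) : R := if cell s p x then th else 0.

Lemma angle_on_cell b s p th : 0 < s -> angle b (on_cell s p th).
Proof.
move=> s0.
have h := angleZ th (angleD (angle_below b (p + s)) (angleZ (-1) (angle_below b p))).
apply: angle_ext h => x; rewrite /on_cell /below /cell.
by case: (ltP x p) => h1; case: (ltP x (p + s)) => h2; rewrite /=; (ring || lra).
Qed.

Definition scalar (f : R -> C) : state R := levels f (fun=> 0).

Lemma rotop_levels w f (g e : R -> C) :
  rotop false w f (levels g e) =
  levels (fun x => rC (cos (f x)) * g x - iC R * rC (sin (f x)) * w * e x)
    (fun x => rC (cos (f x)) * e x - iC R * rC (sin (f x)) * conjc w * g x).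
Proof.
by apply: levels_ext => x; rewrite /rotop /rotv /levels /phase /= ?mulr0 ?subr0.
Qed.

Lemma drift_levels m (g e : R -> C) :
  drift false m (levels g e) = levels (fun x => g (x - m)) (fun x => e (x + m)).
Proof. by apply: levels_ext => x; rewrite /drift /levels. Qed.

Lemma reachable_scalar_shift m f : L2state (scalar f) ->
  reachable (scalar f) (scalar (fun x => f (x - m))).
Proof. by move=> lf; have := reachable_drift false m lf; rewrite drift_levels. Qed.

(** Two full flips about different axes return to the level [gg] with a relative phase; the sign in
    [- c] offsets the square of [- i]. *)
Lemma reachable_scalar_phase (c : C) f : sqnormc c = 1 -> L2state (scalar f) ->
  reachable (scalar f) (scalar (fun x => c * f x)).
Proof.
move=> hc lf; have h1 : sqnormc (1 : C) = 1 by rewrite /sqnormc /=; ring.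
have hN : sqnormc (- c) = 1 by rewrite sqnormcN.
have r1 := reachable_rotop h1 (angle_cst false (pi / 2)) lf.
have [_ l1 _] := r1.
have r2 := reachable_rotop hN (angle_cst false (pi / 2)) l1.
suff <- : rotop false (- c) (fun=> pi / 2) (rotop false 1 (fun=> pi / 2) (scalar f)) =
    scalar (fun x => c * f x) by exact: reachable_trans r1 r2.
rewrite /scalar !rotop_levels cos_pihalf sin_pihalf rC0 rC1 conjc1.
congr levels; apply/funext => x; have i2 := iC_sqr R; last by ring.
transitivity (- (iC R * iC R) * (c * f x)); first by ring.
by rewrite i2; ring.
Qed.

(** A unitary matrix can send the vector [(a, a')] to the ground direction: the angle is the
    arctangent of [|a'| / |a|], and the axis corrects the arguments. The expression set to 0 is the
    excited component after rotation. *)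
Lemma ground_rotation (a a' : C) : exists2 w : C, sqnormc w = 1 &
  exists th, rC (cos th) * a' - iC R * rC (sin th) * conjc w * a = 0.
Proof.
have h1 : sqnormc (1 : C) = 1 by rewrite /sqnormc /=; ring.
have cabs0 z : cabs z = 0 -> z = 0 :> C.
  by move=> h; apply: sqnormc_eq0; rewrite -cabs_sq h expr0n.
have [a0|a0] := eqVneq a 0.
  by exists 1 => //; exists (pi / 2); rewrite a0 cos_pihalf rC0 mul0r mulr0 subr0.
have [a0'|a0'] := eqVneq a' 0.
  by exists 1 => //; exists 0; rewrite a0' sin0 rC0 !(mul0r, mulr0) subr0.
have ca : cabs a != 0 by apply: contra_neq a0; exact: cabs0.
have ca' : cabs a' != 0 by apply: contra_neq a0'; exact: cabs0.
pose t := cabs a' / cabs a.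
(* With this axis the second term becomes [- cos th * a'], cancelling the first. *)
pose w : C := conjc (- iC R * a' * conjc a * rC ((cabs a * cabs a')^-1)).
have ci : sqnormc (iC R) = 1 by rewrite /sqnormc /=; ring.
exists w.
  rewrite /w sqnormcJ !sqnormcM sqnormcN ci sqnormcJ sqnormcrC -!cabs_sq; field.
  by apply/andP.
exists (atan t).
have tE : sin (atan t) = t * cos (atan t).
  have := atanK t; rewrite /tan => {2}<-; rewrite divfK//.
  have /andP[h2 h3] : - (pi / 2) < atan t < pi / 2 by rewrite atan_gtNpi2 atan_ltpi2.
  by rewrite gt_eqF// cos_gt0_pihalf// h2.
rewrite tE; move: (cos (atan t)) => c; rewrite /w conjcK rCM.
have i2 := iC_sqr R.
have ja : a * conjc a = rC (cabs a * cabs a) by rewrite mulcJ -cabs_sq.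
transitivity (rC c * a' + (iC R * iC R) * (rC t * rC (cabs a * cabs a')^-1 * (a * conjc a)) * rC c * a'); first by ring.
rewrite i2 ja -!rCM (_ : t * _ * _ = 1) ?rC1; first by ring.
by rewrite /t; field; apply/andP.
Qed.

Local Notation ind s p c := (fun x : R => if cell s p x then (c : C) else 0).

(* The cell [p2] is flipped to the excited level of the first ion, a drift
   superposes the two cells, and a rotation supported there brings everything
   back to the ground level. *)
Lemma merge_cells (s p1 p2 : R) (c1 c2 : C) (h : R -> C) : 0 < s -> s <= `|p1 - p2| ->
  (forall x, cell s p1 x -> h x = 0) -> (forall x, cell s p2 x -> h x = 0) ->
  L2state (scalar (fun x => ind s p1 c1 x + (ind s p2 c2 x + h x))) ->
  exists c : C, reachable (scalar (fun x => ind s p1 c1 x + (ind s p2 c2 x + h x)))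
    (scalar (fun x => ind s ((p1 + p2) / 2) c x + h (x - (p2 - p1) / 2))).
Proof.
(* The midpoint is [q = p1 + m = p2 - m]: the ground cell moves right by [m] and the excited one
   left by [m], so they meet. *)
move=> s0 hp h1 h2 l0; set q := (p1 + p2) / 2; set m := (p2 - p1) / 2.
have disj x : cell s p1 x -> cell s p2 x -> False.
  rewrite /cell => /andP[a b] /andP[c d].
  by move: hp; rewrite leNgt ltr_norml; lra.
have u1 : sqnormc (1 : C) = 1 by rewrite /sqnormc /=; ring.
(* The flip to the excited level multiplies the height [c2] by [- i]. *)
have [w hw [th hth]] := ground_rotation c1 (- iC R * c2).
have r1 := reachable_rotop u1 (angle_on_cell false p2 (pi / 2) s0) l0.
have [_ l1 _] := r1; have r2 := reachable_drift false m l1.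
have [_ l2 _] := r2; have r3 := reachable_rotop hw (angle_on_cell false q th s0) l2.
exists (rC (cos th) * c1 - iC R * rC (sin th) * w * (- iC R * c2)).
have E1 : rotop false 1 (on_cell s p2 (pi / 2))
    (scalar (fun x => ind s p1 c1 x + (ind s p2 c2 x + h x))) =
    levels (fun x => ind s p1 c1 x + h x) (ind s p2 (- iC R * c2)).
  rewrite /scalar rotop_levels conjc1; congr levels; apply/funext => x; rewrite /on_cell.
    case e2: (cell s p2 x).
      rewrite cos_pihalf rC0 h2//; case e1: (cell s p1 x); last by ring.
      by case: (disj x e1 e2).
    by rewrite cos0 sin0 rC0 rC1; ring.
  case e2: (cell s p2 x).
    rewrite cos_pihalf sin_pihalf rC0 rC1 h2//; case e1: (cell s p1 x); last by ring.
    by case: (disj x e1 e2).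
  by rewrite cos0 sin0 rC0 rC1; ring.
have E2 : drift false m (levels (fun x => ind s p1 c1 x + h x) (ind s p2 (- iC R * c2))) =
    levels (fun x => ind s q c1 x + h (x - m)) (ind s q (- iC R * c2)).
  have cE x : cell s p1 (x - m) = cell s q x.
    by rewrite /cell /q /m; apply/andP/andP => -[a b]; split; lra.
  have cE' x : cell s p2 (x + m) = cell s q x.
    by rewrite /cell /q /m; apply/andP/andP => -[a b]; split; lra.
  by rewrite drift_levels; congr levels; apply/funext => x; rewrite ?cE ?cE'.
have E3 : rotop false w (on_cell s q th)
    (levels (fun x => ind s q c1 x + h (x - m)) (ind s q (- iC R * c2))) =
    scalar (fun x => ind s q (rC (cos th) * c1 - iC R * rC (sin th) * w * (- iC R * c2)) x + h (x - m)).
  (* The remainder travels along with the cell [p1] in the ground level, so it still vanishes on the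
     merged cell and is left intact by the local rotation. *)
  have hq x : cell s q x -> h (x - m) = 0.
    move=> hx; apply: h1; move: hx; rewrite /cell /q /m => /andP[a b]; apply/andP; split; lra.
  rewrite rotop_levels; congr levels; apply/funext => x; rewrite /on_cell.
    by case e: (cell s q x); [rewrite hq//; ring|rewrite cos0 sin0 rC0 rC1; ring].
  by case e: (cell s q x); [rewrite hq// addr0|rewrite cos0 sin0 rC0 rC1; ring].
by rewrite -E3 -E2 -E1; exact: reachable_trans r1 (reachable_trans r2 r3).
Qed.

Lemma stepf_cons (s : R) (c : C) (p : R) l x : stepf s ((c, p) :: l) x = ind s p c x + stepf s l x.
Proof. by rewrite /stepf big_cons. Qed.

Lemma stepf_disjoint s p (l : seq (C * R)) x :
  all (fun bq => s <= `|p - bq.2|) l -> cell s p x -> stepf s l x = 0.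
Proof.
elim: l => [|[c q] l IH] /=; first by rewrite /stepf big_nil.
move=> /andP[hq hl] hx; rewrite stepf_cons IH// addr0.
case e: (cell s q x) => //; exfalso; move: hx e hq; rewrite /cell => /andP[a b] /andP[c' d].
by rewrite leNgt ltr_norml; lra.
Qed.

Definition translate_cells (m : R) (l : seq (C * R)) := [seq (ap.1, ap.2 + m) | ap <- l].

Lemma stepf_translate s m l x : stepf s (translate_cells m l) x = stepf s l (x - m).
Proof.
rewrite /stepf big_map; apply: eq_bigr => -[c p] _ /=.
by congr (if _ then _ else _); rewrite /cell; apply/andP/andP => -[a b]; split; lra.
Qed.

Lemma separated_translate s m l : separated_cells s (translate_cells m l) = separated_cells s l.
Proof.
rewrite /separated_cells pairwise_map; apply: eq_pairwise => -[c p] [c' p'] /=.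
by congr (_ <= `|_|); ring.
Qed.

Lemma reachable_cell s c p l : 0 < s -> separated_cells s ((c, p) :: l) ->
  L2state (scalar (stepf s ((c, p) :: l))) ->
  exists q c', reachable (scalar (stepf s ((c, p) :: l))) (scalar (ind s q c')).
Proof.
move=> s0; have [n] := ubnP (size l); elim: n c p l => // n IH c p [|[c2 p2] l] /= hn.
  move=> _ lf; exists p, c; rewrite (_ : stepf s [:: (c, p)] = ind s p c) in lf *.
    exact: reachable_refl.
  by apply/funext => x; rewrite stepf_cons /stepf big_nil addr0.
rewrite /separated_cells /= => /andP[/andP[h1 h2] /andP[h3 h4]] lf.
have fE : stepf s [:: (c, p), (c2, p2) & l] = fun x => ind s p c x + (ind s p2 c2 x + stepf s l x).
  by apply/funext => x; rewrite !stepf_cons.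
rewrite fE in lf *.
have [c' r1] := merge_cells s0 h1 (fun x => stepf_disjoint h2) (fun x => stepf_disjoint h3) lf.
pose l' := translate_cells ((p2 - p) / 2) l; set q := (p + p2) / 2 in r1.
have gE : (fun x => ind s q c' x + stepf s l (x - (p2 - p) / 2)) = stepf s ((c', q) :: l').
  by apply/funext => x; rewrite stepf_cons stepf_translate.
have [_ l1 _] := r1; rewrite gE in l1 r1.
(* The merged cell has taken the place of the first one and moved with the remainder by the same
   amount, so the new list is a translate of a separated one. *)
have sl : separated_cells s ((c', q) :: l').
  have -> : (c', q) :: l' = translate_cells ((p2 - p) / 2) ((c', p) :: l).
    by rewrite /translate_cells /=; congr ((_, _) :: _); rewrite /q; field.
  by rewrite separated_translate /separated_cells /= h2.
have hn' : (size l' < n)%N by rewrite size_map.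
have [q' [c'' r2]] := IH c' q l' hn' sl l1.
by exists q', c''; exact: reachable_trans r1 r2.
Qed.

Lemma reachable_unit_cell s l : 0 < s -> separated_cells s l -> L2state (scalar (stepf s l)) ->
  exists2 a : R, 0 <= a & reachable (scalar (stepf s l)) (scalar (ind s 0 (rC a))).
Proof.
case: l => [|[c p] l] s0 hl lf.
  exists 0 => //; rewrite (_ : stepf s [::] = ind s 0 (rC 0)) in lf *; first exact: reachable_refl.
  by apply/funext => x; rewrite /stepf big_nil rC0 if_same.
have [q [c' r1]] := reachable_cell s0 hl lf; have [_ l1 _] := r1.
have r2 := reachable_scalar_shift (- q) l1; have [_ l2 _] := r2.
have cE : (fun x => (ind s q c') (x - - q)) = ind s 0 c'.
  by apply/funext => x; congr (if _ then _ else _); rewrite /cell; apply/andP/andP => -[a b]; split; lra.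
rewrite cE in r2 l2.
exists (cabs c'); first exact: sqrtr_ge0.
have [z hz zE] : exists2 z : C, sqnormc z = 1 & z * c' = rC (cabs c').
  have [c0|c0] := eqVneq (cabs c') 0.
    exists 1; first by rewrite /sqnormc /=; ring.
    have c0' : c' = 0 by apply: sqnormc_eq0; rewrite -cabs_sq c0 expr0n.
    by rewrite c0 c0' mulr0 rC0.
  exists (conjc c' * rC (cabs c')^-1).
    by rewrite sqnormcM sqnormcJ sqnormcrC -cabs_sq -exprMn divff// expr1n.
  transitivity (c' * conjc c' * rC (cabs c')^-1); first by ring.
  by rewrite mulcJ -cabs_sq -rCM expr2 mulfK.
have r3 := reachable_scalar_phase hz l2.
apply: reachable_trans r1 (reachable_trans r2 _).
rewrite (_ : (fun x => z * ind s 0 c' x) = ind s 0 (rC (cabs c'))) in r3 => //.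
by apply/funext => x; case: ifP; rewrite ?mulr0.
Qed.

End Merging.

(** * The common family of single cells *)

Section Conclusion.
Variable R : realType.
Local Notation C := R[i].

Definition unit_cell (s a : R) : state R :=
  scalar (fun x => if cell s 0 x then rC a else 0).

Lemma L2state_scalar (f : R -> C) : L2fun f -> L2state (scalar f).
Proof.
move=> lf; have l0 : L2fun (fun=> 0 : C).
  by have := L2funZ 0 lf; congr L2fun; apply/funext => x; rewrite mul0r.
by elim/I4_ind; rewrite /scalar /levels.
Qed.

Lemma L2state_unit_cell (s a : R) : L2state (unit_cell s a).
Proof.
apply: L2state_scalar; apply/L2funP.
have mf : cmeasurable setT (fun x : R => if cell s 0 x then rC a else 0).
  apply: (cmeas_if (f := fun=> rC a) (g := fun=> 0)); [|exact: cmeas_cst|exact: cmeas_cst].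
  by apply: measurable_and; [exact: measurable_fun_ler|exact: measurable_fun_ltr].
split => //; apply: (integ_le (meas_sqnormc mf) (integZ (a ^+ 2) (integ_indic_seg s))) => x.
rewrite ger0_norm ?sqnormc_ge0//; have /andP[i0 _] := indic01 (`[- s, s] : set R) x.
case: ifP => [/andP[x0 xs]|_]; last by rewrite sqnormc0 mulr_ge0// sqr_ge0.
by rewrite indic_seg_norm ?mulr1 ?sqnormcrC// ger0_norm//; lra.
Qed.

Lemma norm4Z (r : R) phi : L2state phi ->
  norm4 (fun k x => rC r * phi k x) = `|r| * norm4 phi.
Proof.
move=> lp; have /L2stateP[mp ip] := lp.
have mq : mstate (fun k x => rC r * phi k x).
  by move=> k; apply: cmeasM => //; exact: cmeas_cst.
have vE x : sqnormv (fun k => rC r * phi k x) = r ^+ 2 * sqnormv (phi ^~ x).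
  by rewrite /sqnormv mulr_sumr; apply: eq_bigr => k _; rewrite sqnormcM sqnormcrC.
have lq : L2state (fun k x => rC r * phi k x).
  by apply: (L2state_dom mq lp (c := r ^+ 2)) => x; rewrite vE.
rewrite !norm4E// -sqrtr_sqr -sqrtrM ?sqr_ge0//; congr Num.sqrt.
by rewrite /sqnorm -RintegralZl//; apply: eq_Rintegral => x _; rewrite vE.
Qed.

(** All these states are nonnegative multiples of a single one, so at fixed width their distance is
    the difference of their norms. *)
Lemma dist_unit_cell (s a a' : R) : 0 <= a -> 0 <= a' ->
  dist (unit_cell s a) (unit_cell s a') = `|norm4 (unit_cell s a) - norm4 (unit_cell s a')|.
Proof.
move=> a0 a0'; have l1 := L2state_unit_cell s 1.
have E r : unit_cell s r = fun k x => rC r * unit_cell s 1 k x.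
  apply/funext => k; apply/funext => x; rewrite /unit_cell /scalar /levels rC1.
  by case: ifP => _; case: ifP => _; rewrite ?mulr0 ?mulr1.
have nE r : 0 <= r -> norm4 (unit_cell s r) = r * norm4 (unit_cell s 1).
  by move=> r0; rewrite (E r) norm4Z// ger0_norm.
transitivity (norm4 (fun k x => rC (a - a') * unit_cell s 1 k x)).
  rewrite /dist; congr norm4; apply/funext => k; apply/funext => x.
  by rewrite /sub_state (E a) (E a') rCD rCN mulrBl.
by rewrite norm4Z// (nE a)// (nE a')// -mulrBl normrM [`|norm4 _|]ger0_norm// norm4_ge0.
Qed.

(** Programs preserve the norm, so the norm of the final cell is known up to the steering error. *)
Lemma steered_norm4 (e : R) phi psi : L2state phi -> L2state psi -> steered e phi psi ->
  `|norm4 phi - norm4 psi| < e.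
Proof.
move=> l1 l2 [l hl dl]; rewrite -(run_norm4 hl l1); apply: le_lt_trans dl.
by apply: norm4_dist => //; exact: run_L2.
Qed.

Lemma steered_unit_cell phi (e : R) : L2state phi -> 0 < e ->
  exists k0 : nat, forall k, (k0 <= k)%N ->
    exists2 a : R, 0 <= a & steered e phi (unit_cell (2 ^+ k)^-1 a).
Proof.
(* One quarter each for truncation, reduction to a scalar function, step approximation and
   merging. *)
move=> lp e0; have e4 : 0 < e / 4 by rewrite divr_gt0.
have [K [psi [K0 lpsi spsi dpsi]]] := truncation_steered lp e4.
have [f lf [_ lsf rf]] := reachable_scalar K0 lpsi spsi.
have e42 : 0 < (e / 4) ^+ 2 by rewrite exprn_gt0.
have [k0 hk0] := stepf_approx e42 lf; exists k0 => k kk0.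
have [l [sl ll dl]] := hk0 k kk0; move: sl ll dl; set s : R := (2 ^+ k)^-1 => sl ll dl.
have s0 : 0 < s by rewrite invr_gt0 exprn_gt0.
have lsl := L2state_scalar ll.
have [a a0 [_ lc rc]] := reachable_unit_cell s0 sl lsl; exists a => //.
have df : dist (scalar f) (scalar (stepf s l)) < e / 4.
  have lB : L2state (sub_state (scalar f) (scalar (stepf s l))) by exact: L2stateB.
  apply: sqnorm_lt_norm4 => //; apply: le_lt_trans dl; rewrite /sqnorm le_eqVlt.
  apply/orP; left; apply/eqP; apply: eq_Rintegral => x _.
  by rewrite /sqnormv big_I4 /sub_state /scalar /levels /= !subrr !sqnormc0 !addr0.
have h1 := steered_trans lp lpsi lsf (dist_steered dpsi) (rf _ e4).
have h2 := steered_trans lsf lsl lc (dist_steered df) (rc _ e4).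
have := steered_trans lp lsf lc h1 h2.
by rewrite (_ : e / 4 + e / 4 + (e / 4 + e / 4) = e)//; field.
Qed.

Lemma steered_same_norm phi psi (e : R) : L2state phi -> L2state psi ->
  norm4 phi = norm4 psi -> 0 < e -> steered e phi psi.
Proof.
move=> l1 l2 nE e0; have e4 : 0 < e / 4 by rewrite divr_gt0.
have [k1 h1] := steered_unit_cell l1 e4; have [k2 h2] := steered_unit_cell l2 e4.
have [a a0 sa] := h1 (maxn k1 k2) (leq_maxl _ _).
have [b b0 sb] := h2 (maxn k1 k2) (leq_maxr _ _).
move: sa sb; set s : R := (2 ^+ maxn k1 k2)^-1 => sa sb.
have la := L2state_unit_cell s a; have lb := L2state_unit_cell s b.
have na := steered_norm4 l1 la sa; have nb := steered_norm4 l2 lb sb.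
(* Both norms lie within [e / 4] of the common norm of the data. *)
have dab : dist (unit_cell s a) (unit_cell s b) < e / 2.
  rewrite (dist_unit_cell s a0 b0); apply: (le_lt_trans (ler_distD (norm4 psi) _ _)).
  by have := ltrD na nb; rewrite nE distrC (_ : e / 4 + e / 4 = e / 2)//; field.
have sb' := steered_sym l2 lb sb.
have := steered_trans l1 lb l2 (steered_trans l1 la lb sa (dist_steered dab)) sb'.
by rewrite (_ : e / 4 + e / 2 + e / 4 = e)//; field.
Qed.

End Conclusion.

Theorem mainTheorem1 (R : realType) (eps M : R) (phi0 phiT : state R) :
  0 < eps -> 0 < M -> L2state phi0 -> L2state phiT -> norm4 phi0 = norm4 phiT ->
  exists T0 : R, 0 < T0 /\
    forall T : R, T0 < T ->
      exists u : controls R, admissible_controls M T u /\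
        exists phi : R -> state R,
          solution u T phi /\ phi 0 = phi0 /\
          norm4 (sub_state (phi T) phiT) < eps.
Proof.
move=> eps0 M0 l0 lT nE; have [l hl dl] := steered_same_norm l0 lT nE eps0.
(* A uniform bound strictly below [M] is required, hence the half. *)
have M2 : 0 < M / 2 by rewrite divr_gt0.
have [T0 [T00 hT]] := realize M2 hl; exists T0; split => // T T0T.
have [u [[mu bu] [phi [sphi [p0 pT]]]]] := hT T T0T phi0 l0.
exists u; split.
  split; first by move=> k; have [m1 m2] := mu k; split; exact: measurable_funTS.
  by exists (M / 2); split => [|k t _]; [lra|exact: bu].
by exists phi; rewrite pT.
Qed.
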